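(* Let $G$ be a metric on channels (not assumed to come from an inner product) satisfying, for all local channel data $\{\Phi,\Delta\}$: (M1) $G_\Phi(\Delta)\ge G_{\Phi\circ\Psi}(\Delta\circ\Psi)$ for every channel $\Psi$ whose output space is the input space of $\Phi$; (M2) $G_\Phi(\Delta)\ge G_{\Psi\circ\Phi}(\Psi\circ\Delta)$ for every channel $\Psi$ whose input space is the output space of $\Phi$; (E) $G_{\Phi\otimes\mathbf I}(\Delta\otimes\mathbf I)=G_\Phi(\Delta)$, where $\mathbf I$ is the identity channel on any space; (A) $\lim_{n\to\infty}\frac1nG_{\Phi^{\otimes n}}(\Delta^{(n)})=G_\Phi(\Delta)$; (C) if $\{\Phi^n,\Delta^n\}$ is a sequence of local channel data with $\|\Phi^n-\Phi^{\otimes n}\|_{\mathrm{cb}}\to0$ and $\frac1{\sqrt n}\|\Delta^n-\Delta^{(n)}\|_{\mathrm{cb}}\to0$, then $\liminf_{n\to\infty}\frac1n\left(G_{\Phi^n}(\Delta^n)-G_{\Phi^{\otimes n}}(\Delta^{(n)})\right)\ge0$; (N0) $G_{\mathrm N(0,1)}(\delta\mathrm N(0,1))=1$. Let $\Omega_{\mathrm{in}}=\{1,\dots,k\}$ be finite and let $\{\Phi,\Delta\}$ be local channel data with input space $\Omega_{\mathrm{in}}$ and output space $\Omega_{\mathrm{out}}$. Suppose that for every $x\in\Omega_{\mathrm{in}}$ the pair $p=\Phi(\cdot|x)$, $\delta=\Delta(\cdot|x)$, with $L=\mathrm d\delta/\mathrm dp$ regarded as a random variable under $p$ and $J=J_p(\delta)$,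 satisfies $\mathbb E_pL^4<\infty$ and one of the following: (a) $\Omega_{\mathrm{out}}$ is a finite set; (b) the law of $L$ under $p$ has a density $\mathrm p_L$ with respect to Lebesgue measure on $\mathbb R$ and $\mathbb E\left(\frac{\int_{-\infty}^{L}(-t)\mathrm p_L(t)\mathrm dt}{J\,\mathrm p_L(L)}\right)^2<\infty$. Then $$G_\Phi(\Delta)=G^{\min}_\Phi(\Delta):=\sup_{x\in\Omega_{\mathrm{in}}}J_{\Phi(\cdot|x)}(\Delta(\cdot|x)).$$
   Context: Spaces are finite sets, $\mathbb R^d$, (measurable) subsets of these, and finite products. A channel $\Phi$ from $\Omega_{\mathrm{in}}$ to $\Omega_{\mathrm{out}}$ is a Markov kernel $\Phi(\cdot|x)$, viewed also as a linear map from (signed) measures on $\Omega_{\mathrm{in}}$ to (signed) measures on $\Omega_{\mathrm{out}}$; composition and tensor product are those of kernels. A tangent vector $\Delta$ at $\Phi$ is a map of the form $c(\Psi_1-\Psi_2)$, $c\in\mathbb R$, with $\Psi_1,\Psi_2$ channels between the same spaces; $\Delta(\cdot|x):=c(\Psi_1(\cdot|x)-\Psi_2(\cdot|x))$. For a probability measure $p$ and a signed measure $\delta$ of total mass $0$ absolutely continuous with respect to $p$, the Fisher information is $J_p(\delta):=\int(\mathrm d\delta/\mathrm dp)^2\,\mathrm dp$. Local channel data $\{\Phi,\Delta\}$ is a channel together with a tangent vector at it such that $\Delta(\cdot|x)$ is absolutely continuous with respect to $\Phi(\cdot|x)$ for all $x$ and $\sup_xJ_{\Phi(\cdot|x)}(\Delta(\cdot|x))<\infty$.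 A metric $G$ on channels assigns to every local channel data (between any spaces) a real number $G_\Phi(\Delta)\ge0$ such that, for fixed $\Phi$, $\Delta\mapsto\sqrt{G_\Phi(\Delta)}$ is a norm on the linear space of admissible $\Delta$. A probability distribution $p$ is identified with the channel sending every input to $p$ (for instance the channel from a one-point space), and similarly for $\delta$, so $G_p(\delta)$ makes sense. $\mathrm N(0,1)$ is the standard Gaussian distribution on $\mathbb R$, with density $\varphi(x)=\frac{1}{\sqrt{2\pi}}e^{-x^2/2}$, and $\delta\mathrm N(0,1)$ is the signed measure with density $x\varphi(x)$. $\Delta^{(n)}:=\Delta\otimes\Phi^{\otimes n-1}+\Phi\otimes\Delta\otimes\Phi^{\otimes n-2}+\cdots+\Phi^{\otimes n-1}\otimes\Delta$. For a linear map $\Lambda$ between spaces of signed measures, $\|\Lambda\|_{\mathrm{cb}}:=\sup_p\|(\Lambda\otimes\mathbf I)(p)\|_1$, the supremum being over probability distributions $p$ on the product of the input space with an auxiliary space, and $\|\cdot\|_1$ denoting total variation norm. In (C), $\Phi^n,\Delta^n$ have the same input and output spaces as $\Phi^{\otimes n}$. *)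

(* Defs.v *)
From HB Require Import structures.
From mathcomp Require Import all_boot all_order all_algebra.
From mathcomp Require Import all_classical all_reals all_analysis.
From mathcomp Require Import measurable_realfun ring lra.

Set Implicit Arguments.
Unset Strict Implicit.
Unset Printing Implicit Defensive.

Import Order.TTheory GRing.Theory Num.Theory.
Import numFieldNormedType.Exports.

Local Open Scope classical_set_scope.
Local Open Scope ring_scope.
Local Open Scope ereal_scope.
Local Open Scope charge_scope.

Definition finite_discrete d (T : measurableType d) : Prop :=
  finite_set [set: T] /\ forall A : set T, measurable A.

(* [is_space_sub] says that [S] is a copy of a measurable subset of [T] with
   the trace sigma-algebra; up to such copies, the constructors generate
   exactly the finite sets, the R^n, their measurable subsets, and finite
   products. A [measurableType] is pointed, hence nonempty. *)
Inductive is_space (R : realType) :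
    forall d : measure_display, measurableType d -> Prop :=
| is_space_finite d (T : measurableType d) :
    finite_discrete T -> is_space R T
| is_space_Rn (n : nat) : is_space R (n.-tuple (measurableTypeR R))
| is_space_line : is_space R (measurableTypeR R)
| is_space_sub d d' (T : measurableType d) (S : measurableType d')
    (f : S -> T) :
    is_space R T -> injective f -> measurable (range f) ->
    (forall A : set S,
       measurable A <-> exists2 B, measurable B & A = f @^-1` B) ->
    is_space R S
| is_space_prod d d' (T : measurableType d) (S : measurableType d') :
    is_space R T -> is_space R S -> is_space R (T * S)%type.

Record mspace (R : realType) := MSpace {
  mspace_display : measure_display;
  mspace_carrier :> measurableType mspace_display;
  mspace_proof : is_space R mspace_carrier }.

Lemma finite_discrete_unit : finite_discrete unit.
Proof. by split=> //; exact: finite_finset. Qed.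

Definition one_point (R : realType) : mspace R :=
  MSpace (is_space_finite R finite_discrete_unit).

Definition real_line (R : realType) : mspace R := MSpace (is_space_line R).

Definition prod_space (R : realType) (X Y : mspace R) : mspace R :=
  MSpace (is_space_prod (mspace_proof X) (mspace_proof Y)).

Definition channel (R : realType) (X Y : mspace R) := R.-pker X ~> Y.

(* [Phi x], recorded as a probability measure. *)
Definition out_prob (R : realType) (X Y : mspace R) (Phi : channel X Y) (x : X)
  : set Y -> \bar R := Phi x.

Section out_prob.
Context (R : realType) (X Y : mspace R) (Phi : channel X Y) (x : X).
HB.instance Definition _ := Measure.on (out_prob Phi x).
Let out_probT : out_prob Phi x [set: Y] = 1.
Proof. exact: prob_kernel. Qed.
HB.instance Definition _ :=
  Measure_isProbability.Build _ _ R (out_prob Phi x) out_probT.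
End out_prob.

Definition channel_id (R : realType) (X : mspace R) : channel X X :=
  kdirac (@measurable_id _ X setT).

Section channel_const.
Context (R : realType) (X Y : mspace R) (p : probability Y R).
Definition kconst (_ : X) : {measure set Y -> \bar R} := p.
Let measurable_kconst U : measurable U ->
  measurable_fun [set: X] (kconst ^~ U).
Proof. by move=> mU; exact: measurable_cst (p U). Qed.
HB.instance Definition _ :=
  isKernel.Build _ _ _ _ _ kconst measurable_kconst.
Let kconstT x : kconst x setT = 1.
Proof. exact: probability_setT. Qed.
HB.instance Definition _ :=
  Kernel_isProbability.Build _ _ _ _ _ kconst kconstT.
Definition channel_const : channel X Y := kconst.
End channel_const.

(* [channel_comp Psi Phi] is Psi o Phi: first Phi, then Psi. *)
Section channel_comp.
Context (R : realType) (X Y Z : mspace R).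
Context (Psi : channel Y Z) (Phi : channel X Y).
Definition kcomposition (x : X) : {measure set Z -> \bar R} :=
  mkcomp_noparam Phi Psi x.
HB.instance Definition _ := Kernel.copy kcomposition (mkcomp_noparam Phi Psi).
Let kcompositionT x : kcomposition x setT = 1.
Proof.
rewrite /kcomposition /mkcomp_noparam /= /kcomp_noparam.
under eq_integral do rewrite prob_kernel.
by rewrite integral_cst// mul1e; exact: prob_kernel.
Qed.
HB.instance Definition _ :=
  Kernel_isProbability.Build _ _ _ _ _ kcomposition kcompositionT.
Definition channel_comp : channel X Z := kcomposition.
End channel_comp.

Section kpullback.
Context d d' d'' (X' : measurableType d) (X : measurableType d')
  (Y : measurableType d'') (R : realType).
Context (f : X' -> X) (mf : measurable_fun setT f) (k : R.-pker X ~> Y).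
Definition kpullback (mf : measurable_fun setT f) (x : X') :
  {measure set Y -> \bar R} := k (f x).
Let measurable_kpullback U : measurable U ->
  measurable_fun [set: X'] (kpullback mf ^~ U).
Proof.
by move=> mU; exact: (measurableT_comp (measurable_kernel k U mU) mf).
Qed.
HB.instance Definition _ :=
  isKernel.Build _ _ _ _ _ (kpullback mf) measurable_kpullback.
Let kpullbackT x : kpullback mf x setT = 1.
Proof. exact: prob_kernel. Qed.
HB.instance Definition _ :=
  Kernel_isProbability.Build _ _ _ _ _ (kpullback mf) kpullbackT.
End kpullback.

Section channel_tensor.
Context (R : realType) (X1 Y1 X2 Y2 : mspace R).
Context (Phi : channel X1 Y1) (Psi : channel X2 Y2).
Definition ktensor (x : X1 * X2) : {measure set (Y1 * Y2) -> \bar R} :=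
  out_prob Phi x.1 \x out_prob Psi x.2.
Let measurable_ktensor U : measurable U ->
  measurable_fun [set: X1 * X2] (ktensor ^~ U).
Proof.
move=> mU.
pose k1 : R.-pker (X1 * X2) ~> Y1 := kpullback Phi (@measurable_fst _ _ X1 X2).
have m2 : measurable_fun setT (fun w : (X1 * X2) * Y1 => w.1.2).
  exact: (measurableT_comp measurable_snd measurable_fst).
pose k2 : R.-pker ((X1 * X2) * Y1) ~> Y2 := kpullback Psi m2.
rewrite [X in measurable_fun _ X](_ : _ = kproduct k1 k2 ^~ U).
  exact: measurable_kproduct.
apply/funext => x; rewrite /ktensor /= /product_measure1 /kproduct.
by apply: eq_integral => y _; rewrite kernel.intker_indicE.
Qed.
HB.instance Definition _ :=
  isKernel.Build _ _ _ _ _ ktensor measurable_ktensor.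
Let ktensorT x : ktensor x setT = 1.
Proof.
rewrite -setXTT.
apply: etrans
  (product_measure1E (out_prob Phi x.1) (out_prob Psi x.2) _ _) _ => //.
rewrite [X in X * _](probability_setT (out_prob Phi x.1)).
by rewrite [X in _ * X](probability_setT (out_prob Psi x.2)) mule1.
Qed.
HB.instance Definition _ :=
  Kernel_isProbability.Build _ _ _ _ _ ktensor ktensorT.
Definition channel_tensor : channel (prod_space X1 X2) (prod_space Y1 Y2) :=
  ktensor.
End channel_tensor.

(* [t Phi + (1 - t) Psi]. *)
Section channel_mix.
Context (R : realType) (X Y : mspace R).
Context (t : R) (t0 : (0 <= t)%R) (t1 : (t <= 1)%R).
Context (Phi Psi : channel X Y).
Let t1' : (0 <= 1 - t)%R. Proof. by rewrite subr_ge0. Qed.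
Definition kmix (x : X) : {measure set Y -> \bar R} :=
  measure_add (mscale (NngNum t0) (Phi x)) (mscale (NngNum t1') (Psi x)).
Lemma kmixE x U : kmix x U = t%:E * Phi x U + (1 - t)%:E * Psi x U.
Proof. exact: measure_addE. Qed.
Let measurable_kmix U : measurable U -> measurable_fun [set: X] (kmix ^~ U).
Proof.
move=> mU; under eq_fun do rewrite kmixE.
by apply: emeasurable_funD; apply: measurable_funeM; exact: measurable_kernel.
Qed.
HB.instance Definition _ := isKernel.Build _ _ _ _ _ kmix measurable_kmix.
Let kmixT x : kmix x setT = 1.
Proof. by rewrite kmixE !prob_kernel !mule1 -EFinD subrKC. Qed.
HB.instance Definition _ := Kernel_isProbability.Build _ _ _ _ _ kmix kmixT.
Definition channel_mix : channel X Y := kmix.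
Lemma channel_mixE x U :
  channel_mix x U = t%:E * Phi x U + (1 - t)%:E * Psi x U.
Proof. exact: kmixE. Qed.
End channel_mix.
Arguments channel_mix : simpl never.

(* A tangent vector is given by a presentation [c (Psi1 - Psi2)]; the map it
   denotes is [tangent_map], and presentations are only compared through it. *)
Record tangent (R : realType) (X Y : mspace R) := Tangent {
  tcoef : R;
  tpos : channel X Y;
  tneg : channel X Y }.

Definition tadd_weight (R : realType) (c c' : R) : R :=
  (`|c| / (`|c| + `|c'|))%R.
Lemma tadd_weight_ge0 (R : realType) (c c' : R) : (0 <= tadd_weight c c')%R.
Proof. by rewrite divr_ge0// addr_ge0. Qed.
Lemma tadd_weight_le1 (R : realType) (c c' : R) : (tadd_weight c c' <= 1)%R.
Proof.
rewrite /tadd_weight; have [->|n0] := eqVneq (`|c| + `|c'|)%R 0%R.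
  by rewrite invr0 mulr0.
by rewrite ler_pdivrMr ?mul1r ?lerDl// lt_def n0 addr_ge0.
Qed.

Section tangent_theory.
Context (R : realType).
Implicit Types X Y Z : mspace R.

Definition tangent_map X Y (D : tangent X Y) (x : X) :
    {charge set Y -> \bar R} :=
  cscale (tcoef D)
    (cadd (charge_of_finite_measure (out_prob (tpos D) x))
          (copp (charge_of_finite_measure (out_prob (tneg D) x)))).

Lemma tangent_mapE X Y (D : tangent X Y) x U :
  tangent_map D x U = (tcoef D)%:E * (tpos D x U - tneg D x U).
Proof. by []. Qed.

(* Set functions of the library are total, with unspecified values on
   non-measurable sets; equality of channels and of tangent vectors as maps is
   equality on measurable sets. *)
Definition channel_eq X Y (Phi Psi : channel X Y) : Prop :=
  forall x U, measurable U -> Phi x U = Psi x U.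

Definition tangent_eq X Y (D E : tangent X Y) : Prop :=
  forall x U, measurable U -> tangent_map D x U = tangent_map E x U.

Definition tscale X Y (a : R) (D : tangent X Y) : tangent X Y :=
  Tangent (a * tcoef D)%R (tpos D) (tneg D).

(* The sum of c(Psi1 - Psi2) and c'(Psi1' - Psi2') written again as
   |c| + |c'| times a difference of two channels, after exchanging Psi1 and
   Psi2 if c < 0 and Psi1' and Psi2' if c' < 0; see [taddE]. *)
Definition tadd X Y (D E : tangent X Y) : tangent X Y :=
  let mix := channel_mix (tadd_weight_ge0 (tcoef D) (tcoef E))
                         (tadd_weight_le1 (tcoef D) (tcoef E)) in
  let p (F : tangent X Y) := if (0 <= tcoef F)%R then tpos F else tneg F in
  let n (F : tangent X Y) := if (0 <= tcoef F)%R then tneg F else tpos F in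
  Tangent (`|tcoef D| + `|tcoef E|)%R (mix (p D) (p E)) (mix (n D) (n E)).

Lemma taddE X Y (D E : tangent X Y) x U : measurable U ->
  tangent_map (tadd D E) x U = tangent_map D x U + tangent_map E x U.
Proof.
move=> mU.
have fin (F : channel X Y) : F x U \is a fin_num.
  exact: fin_num_measure (out_prob F x) _ mU.
have sgnE (F : tangent X Y) : tangent_map F x U =
    `|tcoef F|%:E * ((if (0 <= tcoef F)%R then tpos F else tneg F) x U -
                     (if (0 <= tcoef F)%R then tneg F else tpos F) x U).
  rewrite tangent_mapE; case: ifPn => F0; first by rewrite ger0_norm.
  rewrite ltr0_norm ?ltNge// -(fineK (fin (tpos F))) -(fineK (fin (tneg F))).
  by rewrite -!(EFinN, EFinD, EFinM); congr EFin; rewrite mulNr -mulrN opprB.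
rewrite (sgnE D) (sgnE E) tangent_mapE.
rewrite /tadd /= !channel_mixE.
set a := if _ then _ else _; set b := if _ then _ else _.
set a' := if _ then _ else _; set b' := if _ then _ else _.
rewrite -(fineK (fin a)) -(fineK (fin b)) -(fineK (fin a')) -(fineK (fin b')).
rewrite -!(EFinN, EFinM, EFinD); congr EFin; rewrite /tadd_weight.
have [d0|n0] := eqVneq (`|tcoef D| + `|tcoef E|)%R 0%R; last by field.
have /andP[/eqP -> /eqP ->] : (`|tcoef D| == 0)%R && (`|tcoef E| == 0)%R.
  by rewrite -paddr_eq0// d0.
by rewrite !add0r !mul0r addr0.
Qed.

Definition tsub X Y (D E : tangent X Y) : tangent X Y :=
  tadd D (tscale (-1)%R E).

Definition channel_diff X Y (Phi Psi : channel X Y) : tangent X Y :=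
  Tangent 1%R Phi Psi.

(* Operations on channels extend to tangent vectors by linearity, that is, by
   acting on both channels of a presentation. *)
Definition tangent_pre X Y Z (D : tangent Y Z) (Psi : channel X Y) :
    tangent X Z :=
  Tangent (tcoef D) (channel_comp (tpos D) Psi) (channel_comp (tneg D) Psi).

Definition tangent_post X Y Z (Psi : channel Y Z) (D : tangent X Y) :
    tangent X Z :=
  Tangent (tcoef D) (channel_comp Psi (tpos D)) (channel_comp Psi (tneg D)).

Definition tangent_tensorl X1 Y1 X2 Y2
    (D : tangent X1 Y1) (Psi : channel X2 Y2) :
    tangent (prod_space X1 X2) (prod_space Y1 Y2) :=
  Tangent (tcoef D) (channel_tensor (tpos D) Psi) (channel_tensor (tneg D) Psi).

Definition tangent_tensorr X1 Y1 X2 Y2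
    (Psi : channel X1 Y1) (D : tangent X2 Y2) :
    tangent (prod_space X1 X2) (prod_space Y1 Y2) :=
  Tangent (tcoef D) (channel_tensor Psi (tpos D)) (channel_tensor Psi (tneg D)).

Fixpoint space_pow X (n : nat) : mspace R :=
  if n is m.+1 then prod_space X (space_pow X m) else one_point R.

Fixpoint channel_pow X Y (Phi : channel X Y) (n : nat) :
    channel (space_pow X n) (space_pow Y n) :=
  if n is m.+1 then channel_tensor Phi (channel_pow Phi m)
  else channel_id (one_point R).

(* Delta^(n), with Phi (x) _ factored out of all terms but the first:
   Delta^(n+1) = Delta (x) Phi^n + Phi (x) Delta^(n), and Delta^(0) = 0. *)
Fixpoint tangent_pow X Y (Phi : channel X Y) (D : tangent X Y) (n : nat) :
    tangent (space_pow X n) (space_pow Y n) :=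
  if n is m.+1 then
    tadd (tangent_tensorl D (channel_pow Phi m))
         (tangent_tensorr Phi (tangent_pow Phi D m))
  else channel_diff (channel_id (one_point R)) (channel_id (one_point R)).

(* No factor 1/2: this is the total mass of the variation of [nu]. *)
Definition tv_norm d (T : measurableType d) (nu : {charge set T -> \bar R}) :
    \bar R :=
  let (P, exN) := cid (Hahn_decomposition nu) in
  let (N, nuPN) := cid exN in
  charge_variation nuPN [set: T].

(* (L (x) I)(p) is computed by viewing [p] as a channel from a point. *)
Definition cb_norm X Y (L : tangent X Y) : \bar R :=
  ereal_sup [set r | exists (Z : mspace R) (p : probability (prod_space X Z) R),
    r = tv_norm (tangent_map
          (tangent_pre (tangent_tensorl L (channel_id Z))
                       (channel_const (one_point R) p)) tt)].

Definition fisher d (T : measurableType d) (p : probability T R)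
    (delta : {charge set T -> \bar R}) : \bar R :=
  \int[p]_y ((('d delta '/d p) y) ^+ 2).

Definition G_min X Y (Phi : channel X Y) (D : tangent X Y) : \bar R :=
  ereal_sup (range (fun x => fisher (out_prob Phi x) (tangent_map D x))).

Definition local_data X Y (Phi : channel X Y) (D : tangent X Y) : Prop :=
  (forall x, tangent_map D x `<< Phi x) /\ G_min Phi D < +oo.

(* The value at [Phi], [D] is only meaningful when [local_data Phi D]. *)
Definition metric_fun :=
  forall X Y : mspace R, channel X Y -> tangent X Y -> R.

(* [is_metric_ext] says that [G] depends only on the maps; the other fields say
   that [sqrt G] is a norm in [D]. *)
Record is_metric (G : metric_fun) : Prop := IsMetric {
  is_metric_ext : forall X Y (Phi Phi' : channel X Y) (D D' : tangent X Y),
    local_data Phi D -> channel_eq Phi Phi' -> tangent_eq D D' ->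
    G X Y Phi D = G X Y Phi' D';
  is_metric_ge0 : forall X Y (Phi : channel X Y) (D : tangent X Y),
    local_data Phi D -> (0 <= G X Y Phi D)%R;
  is_metric_eq0 : forall X Y (Phi : channel X Y) (D : tangent X Y),
    local_data Phi D -> Num.sqrt (G X Y Phi D) = 0%R ->
    forall x U, measurable U -> tangent_map D x U = 0;
  is_metric_scale : forall X Y (Phi : channel X Y) (a : R) (D : tangent X Y),
    local_data Phi D ->
    Num.sqrt (G X Y Phi (tscale a D)) = (`|a| * Num.sqrt (G X Y Phi D))%R;
  is_metric_triangle : forall X Y (Phi : channel X Y) (D E : tangent X Y),
    local_data Phi D -> local_data Phi E ->
    (Num.sqrt (G X Y Phi (tadd D E)) <=
     Num.sqrt (G X Y Phi D) + Num.sqrt (G X Y Phi E))%R }.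

Definition monotone_pre (G : metric_fun) : Prop :=
  forall X Y (Phi : channel X Y) (D : tangent X Y), local_data Phi D ->
  forall W (Psi : channel W X),
    (G X Y Phi D >= G W Y (channel_comp Phi Psi) (tangent_pre D Psi))%R.

Definition monotone_post (G : metric_fun) : Prop :=
  forall X Y (Phi : channel X Y) (D : tangent X Y), local_data Phi D ->
  forall Z (Psi : channel Y Z),
    (G X Y Phi D >= G X Z (channel_comp Psi Phi) (tangent_post Psi D))%R.

Definition tensor_id_invariant (G : metric_fun) : Prop :=
  forall X Y (Phi : channel X Y) (D : tangent X Y), local_data Phi D ->
  forall Z,
    G (prod_space X Z) (prod_space Y Z) (channel_tensor Phi (channel_id Z))
      (tangent_tensorl D (channel_id Z)) = G X Y Phi D.

Definition asymptotically_additive (G : metric_fun) : Prop :=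
  forall X Y (Phi : channel X Y) (D : tangent X Y), local_data Phi D ->
    ((n%:R)^-1 * G _ _ (channel_pow Phi n) (tangent_pow Phi D n))%R
      @[n --> \oo] --> G X Y Phi D.

Definition asymptotically_continuous (G : metric_fun) : Prop :=
  forall X Y (Phi : channel X Y) (D : tangent X Y), local_data Phi D ->
  forall (Phis : forall n, channel (space_pow X n) (space_pow Y n))
         (Ds : forall n, tangent (space_pow X n) (space_pow Y n)),
    (forall n, local_data (Phis n) (Ds n)) ->
    cb_norm (channel_diff (Phis n) (channel_pow Phi n)) @[n --> \oo] --> 0 ->
    ((Num.sqrt n%:R)^-1)%:E * cb_norm (tsub (Ds n) (tangent_pow Phi D n))
      @[n --> \oo] --> 0 ->
    0 <= limn_einf (fun n => ((n%:R)^-1 *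
      (G _ _ (Phis n) (Ds n) -
       G _ _ (channel_pow Phi n) (tangent_pow Phi D n)))%:E).

(* A distribution is a channel out of the one-point space. *)
Definition std_gaussian : channel (one_point R) (real_line R) :=
  @channel_const R (one_point R) (real_line R) (normal_prob 0%R 1%R).

(* [D] is the signed measure with density x phi(x). *)
Definition is_gaussian_shift (D : tangent (one_point R) (real_line R)) : Prop :=
  forall U : set (measurableTypeR R), measurable U ->
    tangent_map D tt U =
    \int[lebesgue_measure]_(x in U) (x * normal_pdf 0%R 1%R x)%:E.

Definition gaussian_normalized (G : metric_fun) : Prop :=
  forall D, is_gaussian_shift D -> G _ _ std_gaussian D = 1%R.

Definition score d (T : measurableType d) (p : probability T R)
    (delta : {charge set T -> \bar R}) (y : T) : R :=
  fine (('d delta '/d p) y).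

(* [_ / 0 = 0] is harmless here: if the law of [L] has a density [pL], then
   [J] > 0 and [pL (L y)] > 0 for p-almost every [y]. *)
Definition score_density_condition d (T : measurableType d)
    (p : probability T R) (delta : {charge set T -> \bar R}) : Prop :=
  let L := score p delta in
  let J := fine (fisher p delta) in
  exists pL : measurableTypeR R -> R,
    [/\ measurable_fun setT pL,
        (forall t, (0 <= pL t)%R),
        (forall A : set (measurableTypeR R), measurable A ->
           p (L @^-1` A) = \int[lebesgue_measure]_(t in A) (pL t)%:E) &
        \int[p]_y ((((\int[lebesgue_measure]_(t in `]-oo, L y]) (- t * pL t)) /
                     (J * pL (L y))) ^+ 2)%R)%:E < +oo].

End tangent_theory.

(* Main.v *)
(** Let [L x] be the score of [Phi x] and [J x] its variance, and let [c ^+ 2]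
    exceed every [J x]. Add to the normalised score sum
    [(c * sqrt n)^-1 * sum_i L (x i) (y i)] of an output string [y] an
    independent centred Gaussian whose variance makes the total variance 1. By
    Lindeberg replacement the law of the smoothed sum is close to N(0,1) in
    total variation, even with the weight [1 + |s|]. The conditional law of [y]
    given the smoothed sum [s] is then a channel that approximately sends
    N(0,1) to the n-th power of [Phi], and [c * sqrt n] times the shift of
    N(0,1) to the n-th tangent. Axioms (C) and (A) and monotonicity give
    [G Phi D <= c ^+ 2].

    Conversely, for a fixed input [x], smoothing the score sum approximately
    sends the n-th power of [Phi x] to N(0,1) and its tangent to
    [(J x / c) * sqrt n] times the shift. Followed by the first simulation, with
    target N(0,1) and [k] times the shift, which is possible for [k < J x / c],
    it yields [k ^+ 2 <= G Phi D], and [c] may be taken close to the square root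
    of [J x]. *)
Require Import Defs.
From HB Require Import structures.
From mathcomp Require Import all_boot all_order all_algebra.
From mathcomp Require Import all_classical all_reals all_analysis.
From mathcomp Require Import measurable_realfun.
From mathcomp Require Import ring lra.
Set Implicit Arguments.
Unset Strict Implicit.
Unset Printing Implicit Defensive.
Import Order.TTheory GRing.Theory Num.Theory.
Import numFieldNormedType.Exports.

Local Open Scope classical_set_scope.
Local Open Scope ring_scope.

(** * Integrals and bounded functionals *)

(** For finite alphabets the score sum takes finitely many values, so its law never approaches
    N(0,1) in total variation; the added Gaussian noise repairs this, and it also bounds all
    derivatives of the smoothed density. For these bounds to be uniform in [n] and in the input
    string, the noise variance must stay away from 0, which is why [c ^+ 2] exceeds every variance
    strictly; the excess is removed only at the end. The noise depends on the input string so that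
    every smoothed law approaches the same N(0,1): the Gaussian resource does not know the input,
    only the channel that processes it does. The weight [1 + |s|] enters because the shift has
    density [s] against N(0,1), so that replacing the smoothed law by N(0,1) is tested against both
    [1] and [s]. Channels and tangent vectors are handled through their action on bounded measurable
    functions, and local data through a dual inequality. Estimates uniform over inputs and over test
    functions bounded by 1 then control the cb norm, and no Radon-Nikodym derivative of a composed
    channel has to be identified. *)

Notation Rintegrable mu f := (mu.-integrable [set: _] (EFin \o f)).

Section Rintegral_setT.
Context d (T : measurableType d) (R : realType).
Variable mu : {measure set T -> \bar R}.
Implicit Types f g : T -> R.

Lemma Rintegrable_measurable f : Rintegrable mu f -> measurable_fun setT f.
Proof. by move=> /integrableP[/measurable_EFinP]. Qed.

Lemma Rintegrable_le f g : measurable_fun setT f ->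
  (forall x, `|f x| <= g x) -> Rintegrable mu g -> Rintegrable mu f.
Proof.
move=> mf fg ig; apply: le_integrable ig => //; first exact/measurable_EFinP.
by move=> x _ /=; rewrite lee_fin (le_trans (fg x))// ler_norm.
Qed.

Lemma RintegrableZ k f : Rintegrable mu f -> Rintegrable mu (fun x => k * f x).
Proof.
move=> fi; rewrite (_ : _ \o _ = fun x => k%:E * (f x)%:E)%E.
  exact: integrableZl.
by apply/funext => x /=; rewrite EFinM.
Qed.

Lemma RintegrableD f g : Rintegrable mu f -> Rintegrable mu g ->
  Rintegrable mu (fun x => f x + g x).
Proof.
move=> fi gi; rewrite (_ : _ \o _ = (EFin \o f) \+ (EFin \o g))%E.
  exact: integrableD.
by apply/funext => x /=; rewrite EFinD.
Qed.

Lemma RintegrableB f g : Rintegrable mu f -> Rintegrable mu g ->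
  Rintegrable mu (fun x => f x - g x).
Proof.
move=> fi gi; rewrite (_ : _ \o _ = (EFin \o f) \- (EFin \o g))%E.
  exact: integrableB.
by apply/funext => x /=; rewrite EFinB.
Qed.

Lemma Rintegrable_normr f : Rintegrable mu f -> Rintegrable mu (fun x => `|f x|).
Proof. exact: integrable_norm. Qed.

Lemma Rintegral_EFin f : Rintegrable mu f ->
  (\int[mu]_x (f x)%:E = (\int[mu]_x f x)%R%:E)%E.
Proof. by move=> fi; rewrite fineK//; exact: integrable_fin_num. Qed.

Lemma eq_RintegralT f g : f =1 g -> \int[mu]_x f x = \int[mu]_x g x.
Proof. by move=> /funext ->. Qed.

Lemma RintegralTZ k f : Rintegrable mu f ->
  \int[mu]_x (k * f x) = k * \int[mu]_x f x.
Proof. exact: RintegralZl. Qed.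

Lemma RintegralTD f g : Rintegrable mu f -> Rintegrable mu g ->
  \int[mu]_x (f x + g x) = \int[mu]_x f x + \int[mu]_x g x.
Proof. exact: RintegralD. Qed.

Lemma RintegralTB f g : Rintegrable mu f -> Rintegrable mu g ->
  \int[mu]_x (f x - g x) = \int[mu]_x f x - \int[mu]_x g x.
Proof. exact: RintegralB. Qed.

Lemma le_RintegralT f g : Rintegrable mu f -> Rintegrable mu g ->
  (forall x, f x <= g x) -> \int[mu]_x f x <= \int[mu]_x g x.
Proof. by move=> fi gi fg; exact: le_Rintegral. Qed.

Lemma normr_Rintegral_le f g : Rintegrable mu f -> Rintegrable mu g ->
  (forall x, `|f x| <= g x) -> `|\int[mu]_x f x| <= \int[mu]_x g x.
Proof.
move=> fi gi fg; apply: le_trans (le_normr_Rintegral _ fi) _ => //.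
by apply: le_RintegralT => //; exact: Rintegrable_normr.
Qed.

Lemma RintegralT_ge0 f : (forall x, 0 <= f x) -> 0 <= \int[mu]_x f x.
Proof. by move=> f0; exact: Rintegral_ge0. Qed.

End Rintegral_setT.

Section Rintegral_product.
Context d1 d2 (T1 : measurableType d1) (T2 : measurableType d2) (R : realType).
Variables (m1 : {sigma_finite_measure set T1 -> \bar R})
          (m2 : {sigma_finite_measure set T2 -> \bar R}).
Implicit Types f K : T1 * T2 -> R.

(** Tonelli, with the iterated integral of the majorant [K] in place of that of [f]: in the
    applications the inner integral of [K] has a closed form. *)
Lemma Rintegrable_product f K : measurable_fun setT f ->
  measurable_fun setT K -> (forall z, `|f z| <= K z) ->
  (forall y, Rintegrable m1 (fun x => K (x, y))) ->
  Rintegrable m2 (fun y => \int[m1]_x K (x, y)) ->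
  Rintegrable (m1 \x m2)%E f.
Proof.
move=> mf mK fK iK1 iK2.
have mf' := (measurable_EFinP _ _).2 mf.
apply/(integrable21ltyP _ _ mf').
apply: (@le_lt_trans _ _ (\int[m2]_y (\int[m1]_x K (x, y))%R%:E)%E); last first.
  by rewrite Rintegral_EFin// ltry.
have K0 z : 0 <= K z by rewrite (le_trans _ (fK z)).
apply: ge0_le_integral => //.
- by move=> y _; exact: integral_ge0.
- apply: (measurable_fun_fubini_tonelli_G (fun z => `|(f z)%:E|%E)) => //.
  exact: measurableT_comp.
- by move/Rintegrable_measurable/measurable_EFinP : iK2.
- move=> y _; rewrite -Rintegral_EFin//; apply: ge0_le_integral => //.
  + apply: measurableT_comp => //; apply/measurable_EFinP.
    by apply: measurableT_comp mf _; exact: measurable_pair2.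
  + apply/measurable_EFinP.
    by apply: measurableT_comp mK _; exact: measurable_pair2.
  + by move=> x _; rewrite lee_fin fK.
Qed.

Variable f : T1 * T2 -> R.
Hypothesis fi : Rintegrable (m1 \x m2)%E f.
Hypothesis fi1 : forall x, Rintegrable m2 (fun y => f (x, y)).
Hypothesis fi2 : forall y, Rintegrable m1 (fun x => f (x, y)).

(** Every section, not just almost every one, is required to be integrable: the inner real-valued
    integral is the [fine] part of an extended one and then agrees with it everywhere. *)
Lemma Rintegrable_fubini1 : Rintegrable m1 (fun x => \int[m2]_y f (x, y)).
Proof.
rewrite (_ : _ \o _ = fubini_F m2 (EFin \o f)); first exact: integrable_fubini_F.
by apply/funext => x; rewrite /fubini_F /= -Rintegral_EFin.
Qed.

Lemma Rintegral_product1 :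
  \int[(m1 \x m2)%E]_z f z = \int[m1]_x \int[m2]_y f (x, y).
Proof.
rewrite [LHS]/Rintegral -integral12_prod_meas1//; congr fine.
by apply: eq_integral => x _; rewrite /fubini_F /= -Rintegral_EFin.
Qed.

Lemma Rintegral_product2 :
  \int[(m1 \x m2)%E]_z f z = \int[m2]_y \int[m1]_x f (x, y).
Proof.
rewrite [LHS]/Rintegral -integral21_prod_meas1//; congr fine.
by apply: eq_integral => x _; rewrite /fubini_G /= -Rintegral_EFin.
Qed.

Lemma Rfubini : \int[m1]_x \int[m2]_y f (x, y) = \int[m2]_y \int[m1]_x f (x, y).
Proof. by rewrite -Rintegral_product1 Rintegral_product2. Qed.

End Rintegral_product.

Section bounded_measurable.
Context d (T : measurableType d) (R : realType).
Implicit Types (f g : T -> R) (mu : {measure set T -> \bar R}).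

Definition bounded_measurable f :=
  measurable_fun setT f /\ exists M : R, forall y, `|f y| <= M.

Lemma bounded_measurable_cst k : bounded_measurable (fun=> k).
Proof. by split => //; exists `|k|. Qed.

Lemma bounded_measurable_indic A : measurable A ->
  bounded_measurable (\1_A : T -> R).
Proof.
move=> mA; split; first exact: measurable_indic.
by exists 1 => y; rewrite indicE; case: (_ \in _); rewrite ?normr1 ?normr0.
Qed.

Lemma bounded_measurableD f g : bounded_measurable f -> bounded_measurable g ->
  bounded_measurable (fun y => f y + g y).
Proof.
move=> [mf [M fM]] [mg [N gN]]; split; first exact: measurable_funD.
by exists (M + N) => y; rewrite (le_trans (ler_normD _ _))// lerD.
Qed.

Lemma bounded_measurableM f g : bounded_measurable f -> bounded_measurable g ->
  bounded_measurable (fun y => f y * g y).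
Proof.
move=> [mf [M fM]] [mg [N gN]]; split; first exact: measurable_funM.
by exists (M * N) => y; rewrite normrM ler_pM.
Qed.

Lemma bounded_measurableZ k f : bounded_measurable f ->
  bounded_measurable (fun y => k * f y).
Proof. by move=> bf; apply: bounded_measurableM => //; exact: bounded_measurable_cst. Qed.

Lemma bounded_measurableB f g : bounded_measurable f -> bounded_measurable g ->
  bounded_measurable (fun y => f y - g y).
Proof.
move=> bf bg; rewrite (_ : (fun y => _) = fun y => f y + -1 * g y).
  by apply: bounded_measurableD => //; exact: bounded_measurableZ.
by apply/funext => y; rewrite mulN1r.
Qed.

Lemma bounded_measurableX n f : bounded_measurable f ->
  bounded_measurable (fun y => f y ^+ n).
Proof.
move=> bf; elim: n => [|n ih]; first exact: bounded_measurable_cst.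
rewrite (_ : (fun y => _) = fun y => f y * f y ^+ n).
  exact: bounded_measurableM.
by apply/funext => y; rewrite exprS.
Qed.

Lemma Rintegrable_boundedM mu f g : Rintegrable mu f -> bounded_measurable g ->
  Rintegrable mu (fun y => g y * f y).
Proof.
move=> fi [mg [M gM]].
apply: (@Rintegrable_le _ _ _ _ _ (fun y => M * `|f y|)).
- by apply: measurable_funM => //; exact: Rintegrable_measurable fi.
- by move=> y; rewrite normrM ler_wpM2r.
- exact/RintegrableZ/Rintegrable_normr.
Qed.

(* Integrals of bounded functions are handled as functionals determined by
   their values on indicators. *)
Definition bounded_functional (I : (T -> R) -> R) :=
  [/\ forall f g, bounded_measurable f -> bounded_measurable g ->
        I (fun y => f y + g y) = I f + I g,
      forall (k : R) f, bounded_measurable f -> I (fun y => k * f y) = k * I f &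
      exists C : R, forall f (e : R), bounded_measurable f -> (forall y, `|f y| <= e) ->
        `|I f| <= C * e].

(** Layer cake: a function with values in [[0, M]] is uniformly within [1 / (N + 1)] of a
    combination of indicators of its superlevel sets, and the sup norm bound carries the equality to
    the limit. A general bounded function is first shifted to be nonnegative. This reduces
    identities between iterated integrals to measurable sets. *)
Lemma bounded_functional_ext I1 I2 :
  bounded_functional I1 -> bounded_functional I2 ->
  (forall A, measurable A -> I1 \1_A = I2 \1_A) ->
  forall f, bounded_measurable f -> I1 f = I2 f.
Proof.
move=> [D1 Z1 [C1 B1]] [D2 Z2 [C2 B2]] I12.
have pos f N (M : nat) : measurable_fun setT f -> (forall y, 0 <= f y <= M%:R) ->
    `|I1 f - I2 f| <= (`|C1| + `|C2|) * N.+1%:R^-1.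
  move=> mf f0M.
  pose F j : set T := [set y | j.+1%:R / N.+1%:R <= f y].
  have mF j : measurable (F j).
    rewrite (_ : F j = f @^-1` `[j.+1%:R / N.+1%:R, +oo[).
      by rewrite -[X in measurable X]setTI; exact: mf.
    by apply/seteqP; split => y; rewrite /F /= in_itv/= andbT.
  pose s n : T -> R := fun y => \sum_(j < n) N.+1%:R^-1 * \1_(F j) y.
  have bs n : bounded_measurable (s n).
    elim: n => [|n ih]; rewrite /s.
      rewrite (_ : (fun y => _) = fun=> 0); first exact: bounded_measurable_cst.
      by apply/funext => y; rewrite big_ord0.
    under eq_fun do rewrite big_ord_recr/=.
    apply: bounded_measurableD => //.
    exact/bounded_measurableZ/bounded_measurable_indic.
  have Is n : I1 (s n) = I2 (s n).
    elim: n => [|n ih]; rewrite /s.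
      rewrite (_ : (fun y => _) = fun=> 0 * 0); last first.
        by apply/funext => y; rewrite big_ord0 mulr0.
      by rewrite Z1 ?Z2 ?mul0r//; exact: bounded_measurable_cst.
    rewrite (_ : (fun y => _) = fun y => s n y + N.+1%:R^-1 * \1_(F n) y); last first.
      by apply/funext => y; rewrite big_ord_recr.
    have bF : bounded_measurable (\1_(F n) : T -> R).
      exact: bounded_measurable_indic.
    have bNF : bounded_measurable (fun y => N.+1%:R^-1 * \1_(F n) y : R).
      exact: bounded_measurableZ.
    by rewrite D1// D2// ih Z1// Z2// I12.
  have bf : bounded_measurable f.
    split => //; exists M%:R => y; have /andP[f0 fM] := f0M y.
    by rewrite ger0_norm.
  have N0 : (0 : R) < N.+1%:R by [].
  have fs y : `|f y + -1 * s (M * N.+1)%N y| <= N.+1%:R^-1.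
    have /andP[f0 fM] := f0M y.
    (* Exactly the first [m] superlevel sets contain [y], so the step function rounds [f y] down to
       a multiple of [1 / (N + 1)]. *)
    pose m := Num.truncn (f y * N.+1%:R).
    have fN0 : 0 <= f y * N.+1%:R by rewrite mulr_ge0.
    have /andP[m1 m2] : m%:R <= f y * N.+1%:R < m.+1%:R.
      by rewrite /m; have := Num.Theory.truncn_itv fN0.
    have mM : (m <= M * N.+1)%N.
      rewrite -(ler_nat R) (le_trans m1)// natrM ler_wpM2r//.
    have -> : s (M * N.+1)%N y = m%:R / N.+1%:R.
      rewrite /s -mulr_sumr mulrC; congr (_ / _).
      rewrite -(subnKC mM) big_split_ord/= [X in _ + X]big1 ?addr0; last first.
        move=> j _; rewrite indicE memNset//= /F/= => h.
        move: h; rewrite ler_pdivrMr// => h.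
        have := le_lt_trans h m2; rewrite ltr_nat ltnS leqNgt => /negP; apply.
        by rewrite ltnS leq_addr.
      rewrite (eq_bigr (fun=> 1)) ?sumr_const ?card_ord// => j _.
      rewrite indicE mem_set//= /F/= ler_pdivrMr// (le_trans _ m1)// ler_nat.
      by case: j.
    rewrite mulN1r ger0_norm ?subr_ge0 ?ler_pdivrMr//.
    rewrite lerBlDr -(ler_pM2r N0) mulrDl mulVf ?mulfVK ?gt_eqF// ltW//.
    by rewrite (lt_le_trans m2)// -natr1 addrC.
  have bN : bounded_measurable (fun y => -1 * s (M * N.+1)%N y).
    exact: bounded_measurableZ.
  have bfs : bounded_measurable (fun y => f y + -1 * s (M * N.+1)%N y).
    exact: bounded_measurableD.
  have := B1 _ _ bfs fs; have := B2 _ _ bfs fs.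
  rewrite D1// D2// Z1// Z2// Is => h2 h1.
  set i := _.+1%:R^-1 in h1 h2 *.
  have i0 : 0 <= i by rewrite invr_ge0.
  have h1' : C1 * i <= `|C1| * i by rewrite ler_wpM2r// ler_norm.
  have h2' : C2 * i <= `|C2| * i by rewrite ler_wpM2r// ler_norm.
  move: h1 h2; set u := -1 * _ => h1 h2.
  rewrite (_ : _ - _ = (I1 f + u) - (I2 f + u)); last by ring.
  by rewrite (le_trans (ler_normB _ _))// mulrDl lerD// (le_trans h1, le_trans h2).
have pos' f (M : nat) : measurable_fun setT f -> (forall y, 0 <= f y <= M%:R) ->
    I1 f = I2 f.
  move=> mf f0M; apply/eqP; rewrite -subr_eq0 -normr_eq0 eq_le normr_ge0 andbT.
  apply/ler_addgt0Pl => e e0; rewrite addr0.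
  have C0 : 0 <= `|C1| + `|C2| by rewrite addr_ge0.
  pose N := Num.truncn ((`|C1| + `|C2|) / e).
  apply: le_trans (pos f N M mf f0M) _.
  rewrite ler_pdivrMr// mulrC -ler_pdivrMr// ltW//.
  exact: Num.Theory.truncnS_gt.
move=> f bf; have [mf [M fM]] := bf.
pose m := (Num.truncn `|M|).+1.
have fm y : `|f y| <= m%:R.
  by rewrite (le_trans (fM y))// (le_trans (ler_norm _))// ltW// Num.Theory.truncnS_gt.
have bm : bounded_measurable (fun=> m%:R : R) by exact: bounded_measurable_cst.
have b1 : bounded_measurable (fun=> 1 : R) by exact: bounded_measurable_cst.
have h1 : I1 (fun y => f y + m%:R) = I2 (fun y => f y + m%:R).
  apply: (pos' _ (m + m)%N); first exact: measurable_funD.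
  by move=> y; have := fm y; rewrite ler_norml natrD => /andP[? ?]; lra.
have h2 : I1 (fun=> m%:R) = I2 (fun=> m%:R).
  by apply: (pos' _ m) => // y; rewrite ler0n lexx.
by move: h1; rewrite D1// D2// h2 => /addIr.
Qed.

End bounded_measurable.

Lemma bounded_measurable_comp d d' (T : measurableType d) (S : measurableType d')
    (R : realType) (h : S -> T) (f : T -> R) :
  measurable_fun setT h -> bounded_measurable f ->
  bounded_measurable (fun y => f (h y)).
Proof.
move=> mh [mf [M fM]]; split; first exact: measurableT_comp.
by exists M => y.
Qed.

(** * Channels acting on bounded functions *)

Section channel_op.
Context (R : realType).
Implicit Types X Y Z : mspace R.

Definition channel_op X Y (K : channel X Y) (g : Y -> R) (x : X) : R :=
  \int[K x]_y g y.

Lemma Rintegrable_bounded d (T : measurableType d) (mu : {measure set T -> \bar R})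
  (f : T -> R) : (mu setT < +oo)%E -> bounded_measurable f -> Rintegrable mu f.
Proof.
move=> muT [mf [M fM]]; apply: measurable_bounded_integrable => //.
exists M; split; first exact: num_real.
by move=> N MN y _; exact: le_trans (fM y) (ltW MN).
Qed.

Lemma channel_bounded X Y (K : channel X Y) g x :
  bounded_measurable g -> Rintegrable (K x) g.
Proof. by apply: Rintegrable_bounded; rewrite prob_kernel ltry. Qed.

Lemma channel_op_cst X Y (K : channel X Y) k x : channel_op K (fun=> k) x = k.
Proof. by rewrite /channel_op Rintegral_cst// prob_kernel/= mulr1. Qed.

Lemma channel_op_indic X Y (K : channel X Y) A x : measurable A ->
  channel_op K \1_A x = fine (K x A).
Proof. by move=> mA; rewrite /channel_op /Rintegral integral_indic// setIT. Qed.

Lemma channel_op_le X Y (K : channel X Y) f g x :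
  Rintegrable (K x) f -> Rintegrable (K x) g -> (forall y, f y <= g y) ->
  channel_op K f x <= channel_op K g x.
Proof. exact: le_RintegralT. Qed.

Lemma channel_op_normr_le X Y (K : channel X Y) g x e :
  Rintegrable (K x) g -> (forall y, `|g y| <= e) -> `|channel_op K g x| <= e.
Proof.
move=> ig ge; rewrite -[leRHS](channel_op_cst K e x).
apply: normr_Rintegral_le => //.
exact/channel_bounded/bounded_measurable_cst.
Qed.

Lemma channel_op_functional X Y (K : channel X Y) x :
  bounded_functional (channel_op K ^~ x).
Proof.
split=> [f g bf bg|k f bf|].
- by apply: RintegralTD; exact: channel_bounded.
- by apply: RintegralTZ; exact: channel_bounded.
- exists 1 => f e bf fe; rewrite mul1r; apply: channel_op_normr_le => //.
  exact: channel_bounded.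
Qed.

Lemma bounded_measurable_section X Y (g : X * Y -> R) x :
  bounded_measurable g -> bounded_measurable (fun y => g (x, y)).
Proof. by apply: bounded_measurable_comp; exact: measurable_pair1. Qed.

Lemma bounded_measurable_channel_op2 X Y (K : channel X Y) (g : X * Y -> R) :
  bounded_measurable g ->
  bounded_measurable (fun x => channel_op K (fun y => g (x, y)) x).
Proof.
move=> bg; have [mg [M gM]] := bg.
have bgx x : bounded_measurable (fun y => g (x, y)).
  exact: bounded_measurable_section.
split; last first.
  by exists M => x; apply: channel_op_normr_le => //; exact: channel_bounded.
(* Shifting by the bound [M] makes the integrand nonnegative, as the measurability result for kernel
   integrals requires; the shift integrates to a constant. *)
pose h (z : X * Y) := g z + M.
have bh x : bounded_measurable (fun y => h (x, y)).
  by apply: bounded_measurableD => //; exact: bounded_measurable_cst.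
rewrite (_ : (fun x => _) =
    (fun x => channel_op K (fun y => h (x, y)) x - M)); last first.
  apply/funext => x; rewrite -[in RHS](channel_op_cst K M x).
  rewrite -[RHS]RintegralTB; last 2 first.
  - exact: channel_bounded.
  - exact/channel_bounded/bounded_measurable_cst.
  by apply: eq_RintegralT => y; rewrite /h addrK.
apply: measurable_funB => //; rewrite /channel_op /Rintegral.
apply: (@measurableT_comp _ _ _ _ _ _ fine) => //.
apply: (measurable_fun_integral_finite_kernel (fun z => (h z)%:E) K).
- by move=> z; rewrite lee_fin /h; have := gM z; rewrite ler_norml => /andP[? _]; lra.
- by apply/measurable_EFinP; exact: measurable_funD.
Qed.

Lemma bounded_measurable_channel_op X Y (K : channel X Y) (g : Y -> R) :
  bounded_measurable g -> bounded_measurable (channel_op K g).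
Proof.
move=> bg; apply: (bounded_measurable_channel_op2 K (g := fun z => g z.2)).
exact: bounded_measurable_comp bg.
Qed.

(** On indicators this is the definition of the composed kernel, and both sides are bounded
    functionals of [g]. *)
Lemma channel_op_comp X Y Z (Psi : channel Y Z) (Phi : channel X Y) g x :
  bounded_measurable g ->
  channel_op (channel_comp Psi Phi) g x = channel_op Phi (channel_op Psi g) x.
Proof.
move: g; apply: bounded_functional_ext.
- exact: channel_op_functional.
- split=> [f g bf bg|k f bf|].
  + rewrite -RintegralTD; last 2 first.
    * exact/channel_bounded/bounded_measurable_channel_op.
    * exact/channel_bounded/bounded_measurable_channel_op.
    by apply: eq_RintegralT => y; apply: RintegralTD; exact: channel_bounded.
  + rewrite -RintegralTZ; last first.
      exact/channel_bounded/bounded_measurable_channel_op.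
    by apply: eq_RintegralT => y; apply: RintegralTZ; exact: channel_bounded.
  + exists 1 => f e bf fe; rewrite mul1r; apply: channel_op_normr_le => [|y].
      exact/channel_bounded/bounded_measurable_channel_op.
    by apply: channel_op_normr_le => //; exact: channel_bounded.
- move=> A mA; rewrite channel_op_indic//; congr fine.
  apply: eq_integral => y _; rewrite channel_op_indic// fineK//.
  exact: fin_num_measure (out_prob Psi y) _ mA.
Qed.

Lemma channel_op_tensor_integrable X1 Y1 X2 Y2
    (Phi : channel X1 Y1) (Psi : channel X2 Y2) h x :
  Rintegrable (out_prob Phi x.1 \x out_prob Psi x.2)%E h ->
  (forall y1, Rintegrable (Psi x.2) (fun y2 => h (y1, y2))) ->
  channel_op (channel_tensor Phi Psi) h x =
  channel_op Phi (fun y1 => channel_op Psi (fun y2 => h (y1, y2)) x.2) x.1.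
Proof. by move=> ih h1; exact: Rintegral_product1. Qed.

Lemma channel_op_tensor X1 Y1 X2 Y2
    (Phi : channel X1 Y1) (Psi : channel X2 Y2) g x : bounded_measurable g ->
  channel_op (channel_tensor Phi Psi) g x =
  channel_op Phi (fun y1 => channel_op Psi (fun y2 => g (y1, y2)) x.2) x.1.
Proof.
move=> bg; apply: channel_op_tensor_integrable.
- apply: (@channel_bounded (prod_space X1 X2) (prod_space Y1 Y2)
            (channel_tensor Phi Psi) g x bg).
- by move=> y1; apply: channel_bounded; exact: bounded_measurable_section.
Qed.

Lemma channel_op_dirac X Y (f : X -> Y) (mf : measurable_fun setT f)
    (g : Y -> R) x : measurable_fun setT g ->
  channel_op (kdirac mf : channel X Y) g x = g (f x).
Proof.
move=> mg; rewrite /channel_op /Rintegral /kdirac integral_dirac//.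
  by rewrite diracT mul1e.
exact/measurable_EFinP.
Qed.

Lemma channel_op_id X (g : X -> R) x : measurable_fun setT g ->
  channel_op (channel_id X) g x = g x.
Proof. exact: channel_op_dirac. Qed.

Lemma channel_op_mix X Y t (t0 : 0 <= t) (t1 : t <= 1) (Phi Psi : channel X Y) g x :
  bounded_measurable g ->
  channel_op (channel_mix t0 t1 Phi Psi) g x =
  t * channel_op Phi g x + (1 - t) * channel_op Psi g x.
Proof.
have [DP ZP [CP BP]] := channel_op_functional Phi x.
have [DQ ZQ [CQ BQ]] := channel_op_functional Psi x.
move: g; apply: bounded_functional_ext.
- exact: channel_op_functional.
- split=> [f g bf bg|k f bf|].
  + by rewrite DP// DQ//; ring.
  + by rewrite ZP// ZQ//; ring.
  + exists (`|t * CP| + `|(1 - t) * CQ|) => f e bf fe.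
    rewrite (le_trans (ler_normD _ _))// [leRHS]mulrDl !normrM lerD//.
    * rewrite -mulrA ler_wpM2l// (le_trans (BP _ _ bf fe))//.
      by rewrite ler_wpM2r ?ler_norm// (le_trans _ (fe point)).
    * rewrite -mulrA ler_wpM2l// (le_trans (BQ _ _ bf fe))//.
      by rewrite ler_wpM2r ?ler_norm// (le_trans _ (fe point)).
- move=> A mA; rewrite !channel_op_indic// channel_mixE.
  have fP : Phi x A \is a fin_num by exact: fin_num_measure (out_prob Phi x) _ mA.
  have fQ : Psi x A \is a fin_num by exact: fin_num_measure (out_prob Psi x) _ mA.
  by rewrite fineD ?fin_numM// !fineM.
Qed.

(** Nonnegativity of the variance: expand the integral of [(g - m) ^+ 2], where [m] is the mean. *)
Lemma channel_op_sqr_le X Y (K : channel X Y) g x : bounded_measurable g ->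
  channel_op K g x ^+ 2 <= channel_op K (fun y => g y ^+ 2) x.
Proof.
move=> bg; set m := channel_op K g x.
have b2 : bounded_measurable (fun y => g y ^+ 2) by exact: bounded_measurableX.
have bm : bounded_measurable (fun y => 2 * m * g y) by exact: bounded_measurableZ.
have bc : bounded_measurable (fun _ : Y => m ^+ 2) by exact: bounded_measurable_cst.
have : 0 <= channel_op K (fun y => g y ^+ 2 - 2 * m * g y + m ^+ 2) x.
  apply: RintegralT_ge0 => y.
  by rewrite (_ : _ + _ = (g y - m) ^+ 2) ?sqr_ge0//; ring.
rewrite [X in 0 <= X -> _]RintegralTD; last 2 first.
- by apply: channel_bounded; exact: bounded_measurableB.
- exact: channel_bounded.
rewrite RintegralTB; [|exact: channel_bounded..].
rewrite RintegralTZ; last exact: channel_bounded.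
rewrite -!/(channel_op K _ x) -/m channel_op_cst => h.
by rewrite -subr_ge0 (le_trans h)// le_eqVlt; apply/orP; left; apply/eqP; ring.
Qed.

Definition tangent_op X Y (D : tangent X Y) (g : Y -> R) (x : X) : R :=
  tcoef D * (channel_op (tpos D) g x - channel_op (tneg D) g x).

Lemma bounded_measurable_tangent_op X Y (D : tangent X Y) g :
  bounded_measurable g -> bounded_measurable (tangent_op D g).
Proof.
move=> bg; apply: bounded_measurableZ; apply: bounded_measurableB;
  exact: bounded_measurable_channel_op.
Qed.

Lemma tangent_op_functional X Y (D : tangent X Y) x :
  bounded_functional (tangent_op D ^~ x).
Proof.
have [DP ZP [CP BP]] := channel_op_functional (tpos D) x.
have [DQ ZQ [CQ BQ]] := channel_op_functional (tneg D) x.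
split=> [f g bf bg|k f bf|].
- by rewrite /tangent_op DP// DQ//; ring.
- by rewrite /tangent_op ZP// ZQ//; ring.
- exists (`|tcoef D| * (CP + CQ)) => f e bf fe.
  rewrite /tangent_op normrM -mulrA ler_wpM2l//.
  by rewrite (le_trans (ler_normB _ _))// mulrDl lerD ?BP ?BQ.
Qed.

Lemma tangent_op_tadd X Y (D E : tangent X Y) g x : bounded_measurable g ->
  tangent_op (tadd D E) g x = tangent_op D g x + tangent_op E g x.
Proof.
move=> bg; rewrite /tangent_op /tadd /= !channel_op_mix// /tadd_weight.
have [d0|n0] := eqVneq (`|tcoef D| + `|tcoef E|) 0.
  have /andP[/eqP D0 /eqP E0] : (`|tcoef D| == 0) && (`|tcoef E| == 0).
    by rewrite -paddr_eq0// d0.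
  by rewrite D0 E0 (normr0_eq0 D0) (normr0_eq0 E0); ring.
set a := channel_op (if _ then tpos D else _) g x.
set b := channel_op (if _ then tpos E else _) g x.
set a' := channel_op (if _ then tneg D else _) g x.
set b' := channel_op (if _ then tneg E else _) g x.
have -> : tcoef D * (channel_op (tpos D) g x - channel_op (tneg D) g x) =
    `|tcoef D| * (a - a').
  rewrite /a /a'; case: ifPn => F0; first by rewrite ger0_norm.
  by rewrite ltr0_norm ?ltNge//; ring.
have -> : tcoef E * (channel_op (tpos E) g x - channel_op (tneg E) g x) =
    `|tcoef E| * (b - b').
  rewrite /b /b'; case: ifPn => F0; first by rewrite ger0_norm.
  by rewrite ltr0_norm ?ltNge//; ring.
by field.
Qed.

Lemma tangent_op_tscale X Y k (D : tangent X Y) g x :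
  tangent_op (tscale k D) g x = k * tangent_op D g x.
Proof. by rewrite /tangent_op /= mulrA. Qed.

Lemma tangent_op_tsub X Y (D E : tangent X Y) g x : bounded_measurable g ->
  tangent_op (tsub D E) g x = tangent_op D g x - tangent_op E g x.
Proof. by move=> bg; rewrite tangent_op_tadd// tangent_op_tscale mulN1r. Qed.

Lemma tangent_op_diff X Y (Phi Psi : channel X Y) g x :
  tangent_op (channel_diff Phi Psi) g x = channel_op Phi g x - channel_op Psi g x.
Proof. by rewrite /tangent_op mul1r. Qed.

Lemma tangent_op_post X Y Z (Psi : channel Y Z) (D : tangent X Y) g x :
  bounded_measurable g ->
  tangent_op (tangent_post Psi D) g x = tangent_op D (channel_op Psi g) x.
Proof. by move=> bg; rewrite /tangent_op /= !channel_op_comp. Qed.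

Lemma tangent_op_pre X Y Z (D : tangent Y Z) (Psi : channel X Y) g x :
  bounded_measurable g ->
  tangent_op (tangent_pre D Psi) g x = channel_op Psi (tangent_op D g) x.
Proof.
move=> bg; rewrite /tangent_op /= !channel_op_comp// /channel_op.
rewrite RintegralTZ; last first.
  by apply/channel_bounded/bounded_measurableB; exact: bounded_measurable_channel_op.
by rewrite RintegralTB//; exact/channel_bounded/bounded_measurable_channel_op.
Qed.

Lemma tangent_op_tensorl X1 Y1 X2 Y2 (D : tangent X1 Y1) (Psi : channel X2 Y2) g x :
  bounded_measurable g ->
  tangent_op (tangent_tensorl D Psi) g x =
  tangent_op D (fun y1 => channel_op Psi (fun y2 => g (y1, y2)) x.2) x.1.
Proof. by move=> bg; rewrite /tangent_op /= !channel_op_tensor. Qed.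

Lemma bounded_measurable_tensor_section X2 Y2 Y1 (Psi : channel X2 Y2)
    (g : Y1 * Y2 -> R) x : bounded_measurable g ->
  bounded_measurable (fun y1 => channel_op Psi (fun y2 => g (y1, y2)) x).
Proof.
move=> bg.
(* Pulling [Psi] back along a constant map turns it into a kernel on [Y1], to which the result on
   jointly measurable integrands applies. *)
pose K : channel Y1 Y2 := kpullback Psi (@measurable_cst _ _ Y1 X2 setT x).
exact: (bounded_measurable_channel_op2 K bg).
Qed.

Lemma tangent_op_tensorr X1 Y1 X2 Y2 (Phi : channel X1 Y1) (D : tangent X2 Y2) g x :
  bounded_measurable g ->
  tangent_op (tangent_tensorr Phi D) g x =
  channel_op Phi (fun y1 => tangent_op D (fun y2 => g (y1, y2)) x.2) x.1.
Proof.
move=> bg; rewrite /tangent_op /= !channel_op_tensor// /channel_op.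
rewrite RintegralTZ; last first.
  by apply/channel_bounded/bounded_measurableB;
    exact: bounded_measurable_tensor_section.
by rewrite RintegralTB//;
  apply: channel_bounded; exact: bounded_measurable_tensor_section.
Qed.

End channel_op.

(** * Norms, scores and local data *)

Local Open Scope charge_scope.

Section local_data.
Context (R : realType).
Implicit Types X Y Z W : mspace R.

Lemma tangent_op_indic X Y (D : tangent X Y) A x : measurable A ->
  (tangent_op D \1_A x)%:E = tangent_map D x A.
Proof.
move=> mA; rewrite /tangent_op !channel_op_indic// tangent_mapE.
have fin (F : channel X Y) : F x A \is a fin_num.
  exact: fin_num_measure (out_prob F x) _ mA.
by rewrite EFinM EFinB !fineK.
Qed.

Lemma tv_norm_ge0 d (T : measurableType d) (nu : {charge set T -> \bar R}) :
  (0 <= tv_norm nu)%E.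
Proof.
by rewrite /tv_norm; case: cid => P exN; case: cid => N nuPN; exact: measure_ge0.
Qed.

(** The total variation is attained at the test function that is 1 on the positive and -1 on the
    negative set of a Hahn decomposition. *)
Lemma tv_norm_le X Y (D : tangent X Y) x C :
  (forall g, bounded_measurable g -> (forall y, `|g y| <= 1) ->
    `|tangent_op D g x| <= C) ->
  (tv_norm (tangent_map D x) <= C%:E)%E.
Proof.
move=> DC; rewrite /tv_norm; case: cid => P exN; case: cid => N nuPN.
have [[mP _] [mN _] _ PN0] := nuPN.
have bP : bounded_measurable (\1_P : Y -> R) by exact: bounded_measurable_indic.
have bN : bounded_measurable (\1_N : Y -> R) by exact: bounded_measurable_indic.
have bN' : bounded_measurable (fun y => -1 * \1_N y : R).
  exact: bounded_measurableZ.
have [Dadd DZ _] := tangent_op_functional D x.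
have -> : charge_variation nuPN setT =
    (tangent_op D (fun y => \1_P y + -1 * \1_N y) x)%:E.
  rewrite (Dadd \1_P _ bP bN') (DZ _ \1_N bN) EFinD (EFinM (-1)).
  rewrite !tangent_op_indic//.
  rewrite /charge_variation /= jordan_posE jordan_negE cjordan_posE cjordan_negE.
  by rewrite /crestr0 mem_set// /crestr !setTI mulN1e.
rewrite lee_fin (le_trans (ler_norm _))// DC//; first exact: bounded_measurableD.
move=> y; rewrite !indicE.
have [yP|yP] := boolP (y \in P); have [yN|yN] := boolP (y \in N).
- have : (P `&` N) y by split; [rewrite inE in yP|rewrite inE in yN].
  by rewrite PN0.
- by rewrite mulr0 addr0 normr1.
- by rewrite mulr1 add0r normrN1.
- by rewrite mulr0 addr0 normr0.
Qed.

(** The auxiliary system costs nothing: for a fixed pair [(x, z)] the section of [g] at [z] is again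
    a test function bounded by 1, and the pointwise bound is then averaged over [p]. *)
Lemma cb_norm_le X Y (L : tangent X Y) C :
  (forall x g, bounded_measurable g -> (forall y, `|g y| <= 1) ->
    `|tangent_op L g x| <= C) ->
  (cb_norm L <= C%:E)%E.
Proof.
move=> LC; apply: ge_ereal_sup => _ [Z [p ->]].
apply: tv_norm_le => g bg g1; rewrite tangent_op_pre//.
apply: channel_op_normr_le => [|[x z]].
  exact/channel_bounded/bounded_measurable_tangent_op.
rewrite tangent_op_tensorl//=; apply: LC.
  exact: bounded_measurable_tensor_section.
move=> y; apply: channel_op_normr_le => [|z'//].
by apply: channel_bounded; exact: bounded_measurable_section.
Qed.

Lemma cb_norm_ge0 X Y (L : tangent X Y) : (0 <= cb_norm L)%E.
Proof.
pose p : probability (prod_space X (one_point R)) R := dirac point.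
apply: le_trans (ereal_sup_ubound _); first exact: (tv_norm_ge0 (tangent_map
          (tangent_pre (tangent_tensorl L (channel_id (one_point R)))
                       (channel_const (one_point R) p)) tt)).
by exists (one_point R), p.
Qed.

(** The integral of [(t * g + f) ^+ 2] is a nonnegative quadratic in [t]; evaluate it at its minimum
    [- b / c]. *)
Lemma cauchy_schwarz d (T : measurableType d) (mu : {measure set T -> \bar R})
    (f g : T -> R) :
  measurable_fun setT f -> measurable_fun setT g ->
  Rintegrable mu (fun y => f y ^+ 2) -> Rintegrable mu (fun y => g y ^+ 2) ->
  (\int[mu]_y (g y * f y)) ^+ 2 <= \int[mu]_y (f y ^+ 2) * \int[mu]_y (g y ^+ 2).
Proof.
move=> mf mg if2 ig2.
have igf : Rintegrable mu (fun y => g y * f y).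
  apply: (Rintegrable_le (g := fun y => f y ^+ 2 + g y ^+ 2)).
  - exact: measurable_funM.
  - by move=> y; rewrite ler_norml; apply/andP; split; nra.
  - exact: RintegrableD.
set a := \int[mu]_y (f y ^+ 2); set c := \int[mu]_y (g y ^+ 2).
set b := \int[mu]_y (g y * f y).
have quad t : 0 <= t ^+ 2 * c + 2 * t * b + a.
  have -> : t ^+ 2 * c + 2 * t * b + a =
      \int[mu]_y (t ^+ 2 * g y ^+ 2 + 2 * t * (g y * f y) + f y ^+ 2).
    rewrite RintegralTD//; last first.
      by apply: RintegrableD; exact: RintegrableZ.
    by rewrite RintegralTD ?RintegralTZ//; exact: RintegrableZ.
  apply: RintegralT_ge0 => y.
  by rewrite (_ : _ + _ = (t * g y + f y) ^+ 2) ?sqr_ge0//; ring.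
have c0 : 0 <= c by apply: RintegralT_ge0 => y; exact: sqr_ge0.
have [c00|cn0] := eqVneq c 0.
  (* With [c = 0] the quadratic is affine in [t], and unless [b = 0] this [t] gives it the value
     -1. *)
  have := quad (- (a + 1) / (2 * b)); rewrite c00.
  have [->|b0] := eqVneq b 0; first by move=> _; rewrite expr0n/= mulr0.
  have -> : (- (a + 1) / (2 * b)) ^+ 2 * 0 + 2 * (- (a + 1) / (2 * b)) * b + a = -1.
    by field.
  by rewrite lerNr oppr0 ler10.
have cp : 0 < c by rewrite lt_def cn0.
have := quad (- b / c).
have -> : (- b / c) ^+ 2 * c + 2 * (- b / c) * b + a = (a * c - b ^+ 2) / c.
  by field.
by rewrite pmulr_lge0 ?invr_gt0// subr_ge0.
Qed.

(* For [C] independent of the point, this is the domination of [D] by [Phi]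
   together with the bound [C] on the Fisher information, in dual form. *)
Definition score_bound X Y (Phi : channel X Y) (D : tangent X Y) (C : R) :=
  0 <= C /\ forall x g, bounded_measurable g ->
    tangent_op D g x ^+ 2 <= C * channel_op Phi (fun y => g y ^+ 2) x.

Lemma score_measurable X Y (Phi : channel X Y) (D : tangent X Y) x :
  tangent_map D x `<< Phi x ->
  measurable_fun setT (score (out_prob Phi x) (tangent_map D x)).
Proof.
by move=> DPhi; apply: (@measurableT_comp _ _ _ _ _ _ fine) => //.
Qed.

Lemma score_integrable X Y (Phi : channel X Y) (D : tangent X Y) x :
  tangent_map D x `<< Phi x ->
  Rintegrable (out_prob Phi x) (score (out_prob Phi x) (tangent_map D x)).
Proof.
move=> DPhi; rewrite (_ : _ \o _ = 'd (tangent_map D x) '/d (out_prob Phi x)).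
  exact: Radon_Nikodym_integrable.
by apply/funext => y /=; rewrite fineK//; exact: Radon_Nikodym_fin_num.
Qed.

Lemma fisher_score X Y (Phi : channel X Y) (D : tangent X Y) x :
  tangent_map D x `<< Phi x ->
  fisher (out_prob Phi x) (tangent_map D x) =
  (\int[out_prob Phi x]_y
     (score (out_prob Phi x) (tangent_map D x) y ^+ 2)%:E)%E.
Proof.
move=> DPhi; apply: eq_integral => y _.
by rewrite EFin_expe fineK//; exact: Radon_Nikodym_fin_num.
Qed.

Lemma Rintegral_indicM d (T : measurableType d) (mu : {measure set T -> \bar R})
    (f : T -> R) A : measurable A ->
  \int[mu]_y (\1_A y * f y) = fine (\int[mu]_(y in A) (f y)%:E).
Proof.
move=> mA; rewrite [in RHS]integral_mkcond; congr fine.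
apply: eq_integral => y _; rewrite patchE indicE.
by case: ifP => yA; rewrite ?mul1r ?mul0r.
Qed.

Lemma Rintegral_functional d (T : measurableType d)
    (mu : {measure set T -> \bar R}) (f : T -> R) : Rintegrable mu f ->
  bounded_functional (fun g => \int[mu]_y (g y * f y)).
Proof.
move=> fi; split=> [g h bg bh|k g bg|].
- rewrite -RintegralTD; [|exact: Rintegrable_boundedM..].
  by apply: eq_RintegralT => y; rewrite mulrDl.
- rewrite -RintegralTZ; last exact: Rintegrable_boundedM.
  by apply: eq_RintegralT => y; rewrite mulrA.
- exists (\int[mu]_y `|f y|) => g e bg ge; rewrite mulrC -RintegralTZ.
    apply: normr_Rintegral_le.
    + exact: Rintegrable_boundedM.
    + exact/RintegrableZ/Rintegrable_normr.
    + by move=> y; rewrite normrM ler_wpM2r.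
  exact: Rintegrable_normr.
Qed.

(** The defining property of the Radon-Nikodym derivative, extended from indicators to bounded
    functions. *)
Lemma tangent_op_score X Y (Phi : channel X Y) (D : tangent X Y) x g :
  tangent_map D x `<< Phi x -> bounded_measurable g ->
  tangent_op D g x =
  channel_op Phi (fun y => g y * score (out_prob Phi x) (tangent_map D x) y) x.
Proof.
move=> DPhi; move: g; apply: bounded_functional_ext.
- exact: tangent_op_functional.
- exact: Rintegral_functional (score_integrable DPhi).
- move=> A mA; apply: EFin_inj; rewrite tangent_op_indic//.
  rewrite /channel_op Rintegral_indicM//.
  rewrite (Radon_Nikodym_integral (mu := out_prob Phi x) DPhi mA).
  rewrite -[LHS]fineK; last first.
    by rewrite -Radon_Nikodym_integral//; exact: fin_num_measure.
  congr (fine _)%:E; apply: eq_integral => y _.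
  by rewrite fineK//; exact: Radon_Nikodym_fin_num.
Qed.

Lemma score_bound_dominates X Y (Phi : channel X Y) (D : tangent X Y) C x :
  score_bound Phi D C -> tangent_map D x `<< Phi x.
Proof.
move=> [C0 DC]; apply/null_content_dominatesP => A mA PA0.
have := DC x \1_A (bounded_measurable_indic R mA).
rewrite (_ : channel_op _ _ _ = 0).
  rewrite mulr0 => h; rewrite -tangent_op_indic//; congr EFin.
  by apply/eqP; rewrite -sqrf_eq0 eq_le h sqr_ge0.
rewrite (_ : (fun y => _) = \1_A); first by rewrite channel_op_indic// PA0.
by apply/funext => y; rewrite indicE; case: (_ \in _); rewrite ?expr1n ?expr0n.
Qed.

(** Test with the score truncated at level [n]: both sides then involve the same truncated second
    moment [m], and [m ^+ 2 <= C * m] forces [m <= C]. Monotone convergence removes the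
    truncation. *)
Lemma score_bound_fisher X Y (Phi : channel X Y) (D : tangent X Y) C x :
  score_bound Phi D C ->
  (fisher (out_prob Phi x) (tangent_map D x) <= C%:E)%E.
Proof.
move=> sb; have DPhi := score_bound_dominates (x := x) sb.
rewrite fisher_score//; set L := score _ _.
have mL : measurable_fun setT L := score_measurable DPhi.
pose A n : set Y := [set y | `|L y| <= n%:R].
have mA n : measurable (A n).
  rewrite (_ : A n = (fun y => `|L y|) @^-1` `]-oo, n%:R]).
    rewrite -[X in measurable X]setTI.
    have mnL : measurable_fun setT (fun y => `|L y|) by exact: measurableT_comp.
    exact: mnL.
  by apply/seteqP; split => y; rewrite /A /= in_itv/=.
pose h n y := (\1_(A n) y * L y ^+ 2)%:E.
have hC n : (\int[out_prob Phi x]_y h n y <= C%:E)%E.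
  pose g y := \1_(A n) y * L y.
  have bg : bounded_measurable g.
    split; first by apply: measurable_funM => //; exact: measurable_indic.
    exists n%:R => y; rewrite /g indicE.
    have [|_] := boolP (y \in A n); last by rewrite mul0r normr0.
    by rewrite inE mul1r.
  have gg y : g y ^+ 2 = g y * L y.
    by rewrite /g indicE; case: (_ \in _); rewrite ?mul1r ?mul0r ?expr0n// expr2.
  have [C0 /(_ x g bg)] := sb.
  rewrite (tangent_op_score DPhi bg) -/L.
  rewrite (eq_RintegralT _ gg : channel_op Phi (fun y => g y ^+ 2) x =
    channel_op Phi (fun y => g y * L y) x).
  set m := channel_op _ _ _ => mC.
  have -> : (\int[out_prob Phi x]_y h n y = m%:E)%E.
    rewrite /m -(Rintegral_EFin (mu := out_prob Phi x)); last first.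
      exact: Rintegrable_boundedM (score_integrable DPhi) bg.
    by apply: eq_integral => y _; rewrite /h /g expr2 mulrA.
  rewrite lee_fin; have : 0 <= m.
    by apply: RintegralT_ge0 => y; rewrite -gg sqr_ge0.
  rewrite le_eqVlt => /predU1P[<-//|m0].
  by rewrite -(ler_pM2r m0) -expr2.
have hL : (\int[out_prob Phi x]_y h n y)%E @[n --> \oo] -->
    (\int[out_prob Phi x]_y (L y ^+ 2)%:E)%E.
  have -> : (\int[out_prob Phi x]_y (L y ^+ 2)%:E)%E =
      (\int[out_prob Phi x]_y (limn (h ^~ y)))%E.
    apply: eq_integral => y _; apply/esym/cvg_lim => //.
    apply: cvg_near_cst; exists (Num.truncn `|L y|).+1 => // n /= yn.
    rewrite /h indicE mem_set ?mul1r// /A/=.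
    by rewrite (le_trans (ltW (Num.Theory.truncnS_gt _)))// ler_nat.
  apply: cvg_monotone_convergence => //.
  - move=> n; apply/measurable_EFinP/measurable_funM; first exact: measurable_indic.
    exact: measurable_funX.
  - by move=> n y _; rewrite lee_fin mulr_ge0 ?sqr_ge0.
  - move=> y _ m n mn; rewrite lee_fin ler_wpM2r ?sqr_ge0// !indicE.
    have [|_] := boolP (y \in A m); last by rewrite ler0n.
    rewrite inE => Am; rewrite mem_set// /A/= (le_trans Am)//.
    by rewrite ler_nat.
rewrite -(cvg_lim _ hL)//; apply: lime_le; last exact: nearW.
by apply/cvg_ex; eexists; exact: hL.
Qed.

Lemma score_bound_local_data X Y (Phi : channel X Y) (D : tangent X Y) C :
  score_bound Phi D C -> local_data Phi D.
Proof.
move=> sb; split=> [x|]; first exact: score_bound_dominates sb.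
apply: (@le_lt_trans _ _ C%:E); last exact: ltry.
by apply: ge_ereal_sup => _ [x _ <-]; exact: score_bound_fisher.
Qed.

Lemma fisher_le_G_min X Y (Phi : channel X Y) (D : tangent X Y) x :
  (fisher (out_prob Phi x) (tangent_map D x) <= G_min Phi D)%E.
Proof. by apply: ereal_sup_ubound; exists x. Qed.

Lemma G_min_ge0 X Y (Phi : channel X Y) (D : tangent X Y) : (0 <= G_min Phi D)%E.
Proof.
apply: le_trans (fisher_le_G_min Phi D point).
by apply: integral_ge0 => y _; exact: sqre_ge0.
Qed.

Lemma score2_integrable X Y (Phi : channel X Y) (D : tangent X Y) x :
  local_data Phi D ->
  Rintegrable (out_prob Phi x)
    (fun y => score (out_prob Phi x) (tangent_map D x) y ^+ 2).
Proof.
move=> [DPhi Gmin]; apply/integrableP; split.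
  by apply/measurable_EFinP/measurable_funX/score_measurable.
under eq_integral do rewrite /= ger0_norm ?sqr_ge0//.
rewrite -fisher_score//; exact: le_lt_trans (fisher_le_G_min _ _ _) Gmin.
Qed.

(** Cauchy-Schwarz gives the converse of [score_bound_local_data]. In this dual form local data pass
    to compositions, tensor products and sums by elementary inequalities. *)
Lemma local_data_score_bound X Y (Phi : channel X Y) (D : tangent X Y) :
  local_data Phi D -> score_bound Phi D (fine (G_min Phi D)).
Proof.
move=> PhiD; have [DPhi Gmin] := PhiD.
have G0 := G_min_ge0 Phi D.
have Gfin : G_min Phi D \is a fin_num by rewrite ge0_fin_numE.
split=> [|x g bg]; first exact: fine_ge0.
have g2i : Rintegrable (out_prob Phi x) (fun y => g y ^+ 2).
  exact/channel_bounded/bounded_measurableX.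
rewrite (tangent_op_score (DPhi x) bg).
apply: le_trans (cauchy_schwarz (mu := out_prob Phi x)
  (score_measurable (DPhi x)) (proj1 bg) (score2_integrable x PhiD) g2i) _.
apply: ler_wpM2r.
  by apply: RintegralT_ge0 => y; exact: sqr_ge0.
rewrite -lee_fin -Rintegral_EFin; last exact: score2_integrable.
by rewrite -fisher_score// fineK//; exact: fisher_le_G_min.
Qed.

(** Data processing for the Fisher information in dual form: it only takes
    [(Psi g) ^+ 2 <= Psi (g ^+ 2)]. *)
Lemma score_bound_post X Y Z (Psi : channel Y Z) (Phi : channel X Y) D C :
  score_bound Phi D C ->
  score_bound (channel_comp Psi Phi) (tangent_post Psi D) C.
Proof.
move=> [C0 DC]; split=> // x g bg.
have b2 : bounded_measurable (fun z => g z ^+ 2) by exact: bounded_measurableX.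
have bo : bounded_measurable (channel_op Psi g).
  exact: bounded_measurable_channel_op.
rewrite tangent_op_post// channel_op_comp//.
apply: le_trans (DC _ _ bo) _.
rewrite ler_wpM2l//; apply: channel_op_le.
- exact/channel_bounded/bounded_measurableX.
- exact/channel_bounded/bounded_measurable_channel_op.
- by move=> y; exact: channel_op_sqr_le.
Qed.

Lemma score_bound_pre X Y W (Phi : channel X Y) (Psi : channel W X) D C :
  score_bound Phi D C ->
  score_bound (channel_comp Phi Psi) (tangent_pre D Psi) C.
Proof.
move=> [C0 DC]; split=> // w g bg.
have b2 : bounded_measurable (fun z => g z ^+ 2) by exact: bounded_measurableX.
have bo : bounded_measurable (tangent_op D g).
  exact: bounded_measurable_tangent_op.
have bp : bounded_measurable (channel_op Phi (fun z => g z ^+ 2)).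
  exact: bounded_measurable_channel_op.
rewrite tangent_op_pre// channel_op_comp//.
apply: le_trans (channel_op_sqr_le _ _ bo) _.
rewrite /channel_op -RintegralTZ; last exact: channel_bounded.
apply: channel_op_le => [| |x].
- exact/channel_bounded/bounded_measurableX.
- exact/channel_bounded/bounded_measurableZ.
- exact: DC.
Qed.

Lemma score_bound_tensorl X1 Y1 X2 Y2 (Phi : channel X1 Y1) D
    (Psi : channel X2 Y2) C : score_bound Phi D C ->
  score_bound (channel_tensor Phi Psi) (tangent_tensorl D Psi) C.
Proof.
move=> [C0 DC]; split=> // x g bg.
have b2 : bounded_measurable (fun z => g z ^+ 2) by exact: bounded_measurableX.
have bo := bounded_measurable_tensor_section Psi x.2 bg.
rewrite tangent_op_tensorl// channel_op_tensor//.
apply: le_trans (DC _ _ bo) _; rewrite ler_wpM2l//; apply: channel_op_le.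
- exact/channel_bounded/bounded_measurableX.
- by apply: channel_bounded; exact: (bounded_measurable_tensor_section Psi x.2 b2).
- by move=> y; apply: channel_op_sqr_le; exact: bounded_measurable_section.
Qed.

Lemma score_bound_tensorr X1 Y1 X2 Y2 (Phi : channel X1 Y1)
    (Psi : channel X2 Y2) D C : score_bound Psi D C ->
  score_bound (channel_tensor Phi Psi) (tangent_tensorr Phi D) C.
Proof.
move=> [C0 DC]; split=> // x g bg.
have b2 : bounded_measurable (fun z => g z ^+ 2) by exact: bounded_measurableX.
have bs := bounded_measurable_tensor_section Psi x.2 b2.
have bo : bounded_measurable
    (fun y1 => tangent_op D (fun y2 => g (y1, y2)) x.2).
  by apply: bounded_measurableZ; apply: bounded_measurableB;
    exact: bounded_measurable_tensor_section.
rewrite tangent_op_tensorr// channel_op_tensor//.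
apply: le_trans (channel_op_sqr_le _ _ bo) _.
rewrite /channel_op -RintegralTZ; last exact: channel_bounded.
apply: channel_op_le => [| |y].
- exact/channel_bounded/bounded_measurableX.
- exact/channel_bounded/bounded_measurableZ.
- by apply: DC; exact: bounded_measurable_section.
Qed.

(** The factor 2 comes from [(a + b) ^+ 2 <= 2 * a ^+ 2 + 2 * b ^+ 2]. The resulting growth for
    n-fold data is harmless, since there only finiteness for each [n] matters. *)
Lemma score_bound_tadd X Y (Phi : channel X Y) D E C C' :
  score_bound Phi D C -> score_bound Phi E C' ->
  score_bound Phi (tadd D E) (2 * (C + C')).
Proof.
move=> [C0 DC] [C'0 EC]; split=> [|x g bg]; first by rewrite mulr_ge0// addr_ge0.
rewrite tangent_op_tadd//; have := DC x g bg; have := EC x g bg.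
set p := channel_op _ _ _; set a := tangent_op D g x; set b := tangent_op E g x.
have := sqr_ge0 (a - b); nra.
Qed.

Lemma score_bound_tscale X Y (Phi : channel X Y) D C k :
  score_bound Phi D C -> score_bound Phi (tscale k D) (k ^+ 2 * C).
Proof.
move=> [C0 DC]; split=> [|x g bg]; first by rewrite mulr_ge0// sqr_ge0.
by rewrite tangent_op_tscale exprMn -mulrA ler_wpM2l ?sqr_ge0// DC.
Qed.

Lemma score_bound_pow X Y (Phi : channel X Y) D C n : score_bound Phi D C ->
  exists C', score_bound (channel_pow Phi n) (tangent_pow Phi D n) C'.
Proof.
move=> PhiD; elim: n => [|n [C' ih]].
  exists 0; split=> // x g bg.
  by rewrite tangent_op_diff subrr expr0n/= mul0r.
exists (2 * (C + C')).
by apply: score_bound_tadd; [exact: score_bound_tensorl|exact: score_bound_tensorr].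
Qed.

End local_data.

(** * Gaussian densities *)

Section derivative_rules.
Context (R : realType).
Implicit Types (f g : R -> R) (x a b : R).

Lemma is_derive_mulf f g x a b : is_derive x 1 f a -> is_derive x 1 g b ->
  is_derive x 1 (fun y => f y * g y) (a * g x + f x * b).
Proof.
move=> fa gb; apply: (is_derive_eq (is_deriveM fa gb)).
by rewrite /GRing.scale/= addrC [a * _]mulrC.
Qed.

Lemma is_derive_addf f g x a b : is_derive x 1 f a -> is_derive x 1 g b ->
  is_derive x 1 (fun y => f y + g y) (a + b).
Proof. by move=> fa gb; exact: is_deriveD. Qed.

Lemma is_derive_scalef k f x a : is_derive x 1 f a ->
  is_derive x 1 (fun y => k * f y) (k * a).
Proof. by move=> fa; exact: (@is_deriveZ _ _ _ f k x 1 a). Qed.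

Lemma is_derive_cstf k x : is_derive x 1 (fun=> k : R) 0.
Proof. exact: is_derive_cst. Qed.

Lemma is_derive_idf x : is_derive x 1 (fun y : R => y) 1.
Proof. exact: is_derive_id. Qed.

Lemma is_derive_compf f g x a b : is_derive (g x) 1 f a -> is_derive x 1 g b ->
  is_derive x 1 (fun y => f (g y)) (a * b).
Proof. by move=> fa gb; apply: is_derive1_comp. Qed.

Lemma is_derive_invf x : x != 0 -> is_derive x 1 (fun y : R => y^-1) (- x ^- 2).
Proof.
move=> x0; apply: DeriveDef.
  by apply: derivableV => //; exact: derivable_id.
by rewrite (@deriveV _ _ id)// derive_id /GRing.scale/= mulr1.
Qed.

(** By the mean value theorem rather than by integration, so the constant is [C] and not
    [C / (n + 1)]; iterating it yields Taylor bounds without factorials. *)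
Lemma derivative_bound_ge0 f df (C h : R) n : 0 <= h -> f 0 = 0 ->
  (forall x, 0 <= x <= h -> is_derive x 1 f (df x)) ->
  (forall x, 0 <= x <= h -> `|df x| <= C * x ^+ n) ->
  `|f h| <= C * h ^+ n.+1.
Proof.
move=> h0 f0 fd dfC.
have [||c] := MVT_segment (f := f) (df := df) h0.
- by move=> x; rewrite in_itv/= => /andP[x0 xh]; apply: fd; rewrite !ltW.
- apply: derivable_within_continuous => x; rewrite in_itv/= => xh.
  by have fx := fd x xh; apply: ex_derive.
rewrite in_itv/= => /[dup] /andP[c0 ch] ch0; rewrite f0 !subr0 => ->.
rewrite normrM (ger0_norm h0) exprSr mulrA ler_wpM2r//.
rewrite (le_trans (dfC c ch0))//.
have [C0|C0] := leP 0 C; first by rewrite ler_wpM2l// lerXn2r// nnegrE.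
(* A negative [C] is degenerate: the hypothesis at [h] gives [0 <= C * h ^+ n]. *)
have := dfC c ch0; have := normr_ge0 (df c).
have [->|n0] := eqVneq n 0%N; first by rewrite !expr0.
have := dfC h; rewrite h0 lexx => /(_ isT); have := normr_ge0 (df h).
move=> ? ? ? ?.
have hn : 0 <= h ^+ n by rewrite exprn_ge0.
have cn : 0 <= c ^+ n by rewrite exprn_ge0.
nra.
Qed.

Lemma derivative_bound f df (C : R) n : f 0 = 0 ->
  (forall x, is_derive x 1 f (df x)) ->
  (forall x, `|df x| <= C * `|x| ^+ n) ->
  forall x, `|f x| <= C * `|x| ^+ n.+1.
Proof.
move=> f0 fd dfC x; have [x0|x0] := leP 0 x.
  rewrite [`|x|]ger0_norm//; apply: (derivative_bound_ge0 (df := df)) => // y.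
  by move=> /andP[y0 _]; rewrite (le_trans (dfC y))// ger0_norm.
rewrite [`|x| in leRHS]ltr0_norm// -[x in `|f x|]opprK.
apply: (@derivative_bound_ge0 (fun y => f (- y)) (fun y => - df (- y))).
- by rewrite oppr_ge0 ltW.
- by rewrite oppr0.
- by move=> y _; rewrite -mulrN1; apply: (is_derive_compf (g := -%R)) => //.
- by move=> y /andP[y0 _]; rewrite normrN (le_trans (dfC _))// normrN ger0_norm.
Qed.

End derivative_rules.

(* Locked, lest unification unfold it down to the exponential series. *)
HB.lock Definition gauss_density (R : realType) (t s : R) : R :=
  (Num.sqrt (2 * pi))^-1 * expR (- (ln t / 2) - s ^+ 2 / (2 * t)).
Canonical gauss_density_unlockable := Unlockable gauss_density.unlock.
Arguments gauss_density {R} t s.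

Section gaussian_density.
Context (R : realType).
Implicit Types (s t m h z : R).

(* [t] is the variance, [gauss_ds], [gauss_dss], [gauss_dsss] are the partial
   derivatives in [s], and [gauss_dsst] is the derivative in [t] of
   [gauss_dss]. *)
Definition gauss_ds t s : R := - (s / t) * gauss_density t s.
Definition gauss_dss t s : R := (s ^+ 2 / t ^+ 2 - t^-1) * gauss_density t s.
Definition gauss_dsss t s : R :=
  (3 * s / t ^+ 2 - s ^+ 3 / t ^+ 3) * gauss_density t s.
Definition gauss_dsst t s : R :=
  ((s ^+ 2 / t ^+ 2 - t^-1) ^+ 2 / 2 - 2 * s ^+ 2 / t ^+ 3 + t ^- 2) *
  gauss_density t s.

Lemma gauss_density_gt0 t s : 0 < gauss_density t s.
Proof. by rewrite unlock mulr_gt0 ?expR_gt0// invr_gt0 sqrtr_gt0 mulr_gt0// pi_gt0. Qed.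

Lemma gauss_density_ge0 t s : 0 <= gauss_density t s.
Proof. exact/ltW/gauss_density_gt0. Qed.

(** The factor [exp (- ln t / 2)] in [gauss_density] is the inverse square root of the variance.
    Written as a single exponential, the density is differentiable in [t] and jointly measurable by
    the rules for [expR] and [ln]. *)
Lemma normal_pdf_gauss t m s : 0 < t ->
  normal_pdf m (Num.sqrt t) s = gauss_density t (s - m).
Proof.
move=> t0; rewrite normal_pdfE ?gt_eqF ?sqrtr_gt0//.
rewrite /normal_peak /normal_fun sqr_sqrtr ?ltW// unlock.
rewrite expRD mulrA; congr (_ * expR _); last first.
  by rewrite -mulr_natl mulNr.
rewrite expRN -invfM; congr (_^-1).
have -> : expR (ln t / 2) = Num.sqrt t.
  rewrite -powR12_sqrt ?ltW// /powR gt_eqF//; congr expR.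
  by rewrite mulrC.
by rewrite -sqrtrM ?mulr_ge0 ?pi_ge0//; congr Num.sqrt; ring.
Qed.

Lemma is_derive_gauss t s : t != 0 ->
  is_derive s 1 (gauss_density t) (gauss_ds t s).
Proof.
move=> t0.
have dx : is_derive s 1 (fun y : R => - (ln t / 2) + (- (2 * t)^-1) * (y * y))
    (0 + (- (2 * t)^-1) * (1 * s + s * 1)).
  apply: is_derive_addf.
  by apply: is_derive_scalef; apply: is_derive_mulf; exact: is_derive_idf.
rewrite (_ : gauss_density t = fun y => (Num.sqrt (2 * pi))^-1 *
    expR (- (ln t / 2) + (- (2 * t)^-1) * (y * y))); last first.
  apply/funext => y; rewrite unlock; congr (_ * expR (_ + _)).
  by rewrite expr2 mulNr mulrC.
apply: (is_derive_eq (is_derive_scalef _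
  (is_derive_compf (f := expR) (is_derive_expR _) dx))).
rewrite /gauss_ds unlock.
have -> : - (ln t / 2) + - (2 * t)^-1 * (s * s) = - (ln t / 2) - s ^+ 2 / (2 * t).
  by field.
set e := expR _; set c := (Num.sqrt _)^-1.
by field.
Qed.

Lemma is_derive_gauss_ds t s : t != 0 ->
  is_derive s 1 (gauss_ds t) (gauss_dss t s).
Proof.
move=> t0.
have dx : is_derive s 1 (fun y : R => - t^-1 * y) (- t^-1 * 1).
  by apply: is_derive_scalef; exact: is_derive_idf.
rewrite (_ : gauss_ds t = fun y => (- t^-1 * y) * gauss_density t y); last first.
  by apply/funext => y; rewrite /gauss_ds; congr (_ * _); field.
apply: (is_derive_eq (is_derive_mulf dx (is_derive_gauss s t0))).
by rewrite /gauss_dss /gauss_ds; field.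
Qed.

Lemma is_derive_gauss_dss t s : t != 0 ->
  is_derive s 1 (gauss_dss t) (gauss_dsss t s).
Proof.
move=> t0.
have dx : is_derive s 1 (fun y : R => - t^-1 + t ^- 2 * (y * y))
    (0 + t ^- 2 * (1 * s + s * 1)).
  apply: is_derive_addf.
  by apply: is_derive_scalef; apply: is_derive_mulf; exact: is_derive_idf.
rewrite (_ : gauss_dss t = fun y => (- t^-1 + t ^- 2 * (y * y)) *
    gauss_density t y); last first.
  by apply/funext => y; rewrite /gauss_dss; congr (_ * _); field.
apply: (is_derive_eq (is_derive_mulf dx (is_derive_gauss s t0))).
by rewrite /gauss_dsss /gauss_ds; field.
Qed.

(** The heat equation. It lets an increase of the variance absorb the second-order Taylor term of a
    random displacement. *)
Lemma is_derive_gauss_var t s : 0 < t ->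
  is_derive t 1 (gauss_density^~ s) (gauss_dss t s / 2).
Proof.
move=> t0; have tn0 := lt0r_neq0 t0.
have dx : is_derive t 1 (fun y : R => - 2^-1 * ln y + (- s ^+ 2 / 2) * y^-1)
    (- 2^-1 * t^-1 + (- s ^+ 2 / 2) * (- t ^- 2)).
  apply: is_derive_addf; apply: is_derive_scalef; first exact: is_derive1_ln.
  exact: is_derive_invf.
rewrite (_ : gauss_density^~ s = fun y => (Num.sqrt (2 * pi))^-1 *
    expR (- 2^-1 * ln y + (- s ^+ 2 / 2) * y^-1)); last first.
  apply/funext => y; rewrite unlock.
  have -> : - 2^-1 * ln y + - s ^+ 2 / 2 * y^-1 = - (ln y / 2) - s ^+ 2 / (2 * y).
    by rewrite invfM mulrA !mulNr [_^-1 * _]mulrC.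
  by [].
apply: (is_derive_eq (is_derive_scalef _
  (is_derive_compf (f := expR) (is_derive_expR _) dx))).
rewrite /gauss_dss unlock.
have -> : - 2^-1 * ln t + - s ^+ 2 / 2 * t^-1 = - (ln t / 2) - s ^+ 2 / (2 * t).
  by field.
set e := expR _; set c := (Num.sqrt _)^-1.
by field.
Qed.

Lemma is_derive_gauss_dss_var t s : 0 < t ->
  is_derive t 1 (gauss_dss^~ s) (gauss_dsst t s).
Proof.
move=> t0; have tn0 := lt0r_neq0 t0.
have dV := is_derive_invf tn0.
have dx : is_derive t 1 (fun y : R => s ^+ 2 * (y^-1 * y^-1) + -1 * y^-1)
    (s ^+ 2 * (- t ^- 2 * t^-1 + t^-1 * (- t ^- 2)) + -1 * (- t ^- 2)).
  apply: is_derive_addf; apply: is_derive_scalef => //.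
  exact: is_derive_mulf.
rewrite (_ : gauss_dss^~ s = fun y => (s ^+ 2 * (y^-1 * y^-1) + -1 * y^-1) *
    gauss_density y s); last first.
  apply/funext => y; rewrite /gauss_dss; congr (_ * _).
  by rewrite -expr2 exprVn mulN1r.
apply: (is_derive_eq (is_derive_mulf dx (is_derive_gauss_var s t0))).
by rewrite /gauss_dsst /gauss_dss; field.
Qed.

(** The upper bound on [t] controls the exponential by [exp (- s ^+ 2 / 2)], the lower one controls
    the peak. The weight of degree 4 covers all polynomial factors of the derivatives below, and 16
    comes from [exp u >= 1 + u ^+ 2 / 2] at [u = s ^+ 2 / 2]. *)
Lemma poly_gauss_density_bound (t0 : R) : 0 < t0 ->
  exists2 K : R, 0 <= K & forall t s, t0 <= t <= 1 ->
    (1 + s ^+ 2) ^+ 2 * gauss_density t s <= K.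
Proof.
move=> t00; set c : R := (Num.sqrt (2 * pi))^-1.
have c0 : 0 <= c by rewrite invr_ge0.
exists (16 * (c * expR (- (ln t0 / 2)))).
  by rewrite mulr_ge0// mulr_ge0// expR_ge0.
move=> t s /andP[tt0 t1]; have tp : 0 < t := lt_le_trans t00 tt0.
have e1 : expR (- (ln t / 2)) <= expR (- (ln t0 / 2)).
  by rewrite ler_expR lerN2 ler_pM2r// ler_ln.
have e2 : expR (- (s ^+ 2 / (2 * t))) <= expR (- (s ^+ 2 / 2)).
  rewrite ler_expR lerN2 ler_wpM2l ?sqr_ge0// lef_pV2 ?posrE ?mulr_gt0//.
  by rewrite ger_pMr.
have e3 : (1 + s ^+ 2) ^+ 2 * expR (- (s ^+ 2 / 2)) <= 16.
  rewrite expRN ler_pdivrMr ?expR_gt0//.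
  have u0 : 0 <= s ^+ 2 / 2 by rewrite divr_ge0 ?sqr_ge0.
  have := expR_ge1Dxn 1 u0; rewrite [2`!]/= => h.
  apply: le_trans (_ : 16 * (1 + (s ^+ 2 / 2) ^+ 2 / 2%:R) <= _); last first.
    by rewrite ler_wpM2l.
  by have := sqr_ge0 (s ^+ 2 - 1); nra.
rewrite unlock -/c expRD.
move: e1 e2 e3; set E1 := expR (- (ln t / 2)); set E2 := expR (- (s ^+ 2 / (2 * t))).
move=> e1 e2 e3.
rewrite [leLHS](_ : _ = ((1 + s ^+ 2) ^+ 2 * E2) * (c * E1)); last by ring.
apply: ler_pM.
- by rewrite mulr_ge0 ?sqr_ge0 ?expR_ge0.
- by rewrite mulr_ge0 ?expR_ge0.
- by apply: le_trans e3; rewrite ler_wpM2l ?sqr_ge0.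
- by rewrite ler_wpM2l.
Qed.

Lemma gauss_derivatives_bound (t0 : R) : 0 < t0 ->
  exists2 K : R, 0 <= K & forall t s, t0 <= t <= 1 ->
    [/\ gauss_density t s <= K, `|gauss_dss t s| <= K,
        `|gauss_dsss t s| <= K & `|gauss_dsst t s| <= K].
Proof.
move=> t00; have [K K0 gK] := poly_gauss_density_bound t00.
(* As [b >= 1] dominates [1 / t], its fourth power dominates every power of [1 / t] that occurs. *)
pose b : R := 1 + t0^-1.
have b1 : 1 < b by rewrite ltrDl invr_gt0.
have b0 : 0 <= b by rewrite (le_trans _ (ltW b1)).
exists (4 * b ^+ 4 * K); first by rewrite mulr_ge0// mulr_ge0// exprn_ge0.
move=> t s tt; have /andP[tt0 t1] := tt; have tp : 0 < t := lt_le_trans t00 tt0.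
set i := t^-1.
have i0 : 0 <= i by rewrite invr_ge0 ltW.
have ib : i <= b.
  rewrite /b (@le_trans _ _ t0^-1) ?lerDr// lef_pV2// ?posrE//.
set q := s ^+ 2; have q0 : 0 <= q by exact: sqr_ge0.
have aux (p : R) : `|p| <= 4 * b ^+ 4 * (1 + q) ^+ 2 ->
    `|p * gauss_density t s| <= 4 * b ^+ 4 * K.
  move=> hp; rewrite normrM [`|gauss_density _ _|]ger0_norm ?gauss_density_ge0//.
  apply: (@le_trans _ _ (4 * b ^+ 4 * (1 + q) ^+ 2 * gauss_density t s)).
    by rewrite ler_wpM2r ?gauss_density_ge0.
  by rewrite -mulrA ler_wpM2l ?gK// mulr_ge0// exprn_ge0.
have bX (m n : nat) : (m <= n)%N -> b ^+ m <= b ^+ n.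
  by move=> mn; rewrite ler_eXn2l.
have iX n : i ^+ n <= b ^+ n by rewrite lerXn2r// nnegrE.
have i4 n : (n <= 4)%N -> i ^+ n <= b ^+ 4.
  by move=> n4; rewrite (le_trans (iX n))// bX.
have iX0 n : 0 <= i ^+ n by rewrite exprn_ge0.
have i1b := i4 1%N isT; have i2b := i4 2%N isT; have i3b := i4 3%N isT.
have i4b := i4 4%N isT.
have b4 : 1 <= b ^+ 4 by rewrite exprn_ege1// ltW.
have i1p := iX0 1%N; have i2p := iX0 2%N; have i3p := iX0 3%N; have i4p := iX0 4%N.
rewrite expr1 in i1b i1p.
have tV n : t ^- n = i ^+ n by rewrite exprVn.
set B := b ^+ 4 in aux i1b i2b i3b i4b b4 *.
have q2 : 0 <= q ^+ 2 by exact: sqr_ge0.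
split.
- rewrite -[gauss_density _ _]mul1r -[leLHS]ger0_norm.
    by apply: aux; rewrite normr1; nra.
  by rewrite mul1r gauss_density_ge0.
- apply: aux; rewrite tV -/i -/q ler_norml; apply/andP; split; nra.
- apply: aux; rewrite !tV.
  have s1 : `|s| <= 1 + q.
    by rewrite ler_norml; apply/andP; split; rewrite /q; nra.
  have -> : 3 * s * i ^+ 2 - s ^+ 3 * i ^+ 3 = s * (3 * i ^+ 2 - q * i ^+ 3).
    by rewrite /q; ring.
  have h : `|3 * i ^+ 2 - q * i ^+ 3| <= 4 * B * (1 + q).
    by rewrite ler_norml; apply/andP; split; nra.
  rewrite normrM (_ : 4 * B * _ = (1 + q) * (4 * B * (1 + q))); last by ring.
  by rewrite ler_pM.
- apply: aux; rewrite !tV -/i -/q.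
  have -> : (q * i ^+ 2 - i) ^+ 2 / 2 - 2 * q * i ^+ 3 + i ^+ 2 =
      q ^+ 2 / 2 * i ^+ 4 - 3 * q * i ^+ 3 + 3 / 2 * i ^+ 2 by field.
  rewrite ler_norml; apply/andP; split; nra.
Qed.

Lemma gauss_taylor2 (t0 : R) : 0 < t0 ->
  exists2 K : R, 0 <= K & forall t s z, t0 <= t <= 1 ->
    `|gauss_density t (s + z) - gauss_density t s - z * gauss_ds t s| <=
    K * z ^+ 2.
Proof.
move=> t00; have [K K0 gK] := gauss_derivatives_bound t00.
exists K => // t s z tt; have /andP[tt0 t1] := tt.
have tn0 : t != 0 by rewrite gt_eqF// (lt_le_trans t00).
have shift (f df : R -> R) (y : R) : (forall u : R, is_derive u 1 f (df u)) ->
    is_derive y 1 (fun y => f (s + y)) (df (s + y)).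
  move=> fd; rewrite -[df _]mulr1; apply: is_derive_compf => //.
  rewrite -[X in is_derive _ _ _ X]add0r.
  apply: is_derive_addf; exact: is_derive_idf.
rewrite -[z ^+ 2]real_normK ?num_real//.
pose f1 z := gauss_ds t (s + z) - gauss_ds t s.
have f1K : forall z, `|f1 z| <= K * `|z| ^+ 1.
  apply: (derivative_bound (df := fun z => gauss_dss t (s + z))).
  - by rewrite /f1 addr0 subrr.
  - move=> y; rewrite -[X in is_derive _ _ _ X]addr0.
    apply: is_derive_addf; apply: shift => u; exact: is_derive_gauss_ds.
  - by move=> y; rewrite expr0 mulr1; have [] := gK t (s + y) tt.
pose f0 z := gauss_density t (s + z) + (- gauss_density t s + - gauss_ds t s * z).
rewrite (_ : _ - _ - _ = f0 z); last by rewrite /f0; ring.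
apply: (derivative_bound (df := f1)) => //.
- by rewrite /f0 addr0 mulr0; ring.
- move=> y; rewrite /f1 -[- gauss_ds t s in X in is_derive _ _ _ X]add0r.
  apply: is_derive_addf; first by apply: shift => u; exact: is_derive_gauss.
  apply: is_derive_addf.
  rewrite -[X in is_derive _ _ _ X]mulr1.
  by apply: is_derive_scalef; exact: is_derive_idf.
Qed.

(** Ratio of two centred Gaussians. Lower bounds on the exponential turn it into a comparison of
    polynomial multiples of the narrow density with the wide one. *)
Lemma gauss_density_scale t (r : R) s : 0 < t -> 0 < r ->
  r * gauss_density (r ^+ 2 * t) s =
  gauss_density t s * expR ((1 - r ^- 2) * (s ^+ 2 / (2 * t))).
Proof.
move=> t0 r0; rewrite unlock -[RHS]mulrA -expRD mulrCA; congr (_ * _).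
set e := expR _; have -> : r * e = expR (ln r) * e by rewrite lnK// posrE.
rewrite -expRD; congr expR.
rewrite lnM ?posrE ?exprn_gt0// lnXn// mulr2n.
by field; rewrite !gt_eqF.
Qed.

Lemma gauss_density_shift t h s : 0 < t ->
  gauss_density t (s - h) =
  gauss_density t s * expR (s * h / t - h ^+ 2 / (2 * t)).
Proof.
move=> t0; rewrite unlock -[RHS]mulrA -expRD; congr (_ * expR _).
by field; rewrite gt_eqF.
Qed.

Lemma measurable_funV_gt0 d (T : measurableType d) (f : T -> R) :
  measurable_fun setT f -> (forall x, 0 < f x) ->
  measurable_fun setT (fun x => (f x)^-1).
Proof.
move=> mf f0; rewrite (_ : (fun x => _) = (fun x => expR (- ln (f x)))).
  apply: measurableT_comp => //; apply: measurable_funN.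
  by apply: measurableT_comp => //; exact: measurable_ln.
by apply/funext => x; rewrite expRN lnK// posrE.
Qed.

Lemma measurable_gauss_density d (T : measurableType d) (v f : T -> R) :
  measurable_fun setT v -> measurable_fun setT f -> (forall x, 0 < v x) ->
  measurable_fun setT (fun x => gauss_density (v x) (f x)).
Proof.
move=> mv mf v0; rewrite unlock; apply: measurable_funM => //.
apply: measurableT_comp => //; apply: measurable_funB.
  apply: measurable_funN; apply: measurable_funM => //.
  by apply: measurableT_comp => //; exact: measurable_ln.
apply: measurable_funM; first exact: measurable_funX.
apply: measurable_funV_gt0 => [|x]; last by rewrite mulr_gt0.
exact: measurable_funM.
Qed.

End gaussian_density.

Section gaussian_expansions.
Context (R : realType).
Implicit Types (s t m h z : R).

(** Expansion in the mean, to be matched with [gauss_heat]: for a centred displacement [z] of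
    variance [h] the averaged second-order terms coincide. *)
Lemma gauss_taylor3 (t0 : R) : 0 < t0 ->
  exists2 K : R, 0 <= K & forall t s z, t0 <= t <= 1 ->
    `|gauss_density t (s + z) - gauss_density t s - z * gauss_ds t s -
      z ^+ 2 / 2 * gauss_dss t s| <= K * `|z| ^+ 3.
Proof.
move=> t00; have [K K0 gK] := gauss_derivatives_bound t00.
exists K => // t s z tt; have /andP[tt0 t1] := tt.
have tn0 : t != 0 by rewrite gt_eqF// (lt_le_trans t00).
have shift (f df : R -> R) (y : R) : (forall u : R, is_derive u 1 f (df u)) ->
    is_derive y 1 (fun y => f (s + y)) (df (s + y)).
  move=> fd; rewrite -[df _]mulr1; apply: is_derive_compf => //.
  rewrite -[X in is_derive _ _ _ X]add0r.
  apply: is_derive_addf; exact: is_derive_idf.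
pose f2 z := gauss_dss t (s + z) - gauss_dss t s.
have d2 (y : R) : is_derive y 1 f2 (gauss_dsss t (s + y)).
  have d := shift _ _ y (fun u => is_derive_gauss_dss u tn0).
  by apply: (is_derive_eq (is_derive_addf d (is_derive_cstf _ _))); rewrite addr0.
have f20 : f2 0 = 0 by rewrite /f2 addr0 subrr.
have hK y : `|gauss_dsss t (s + y)| <= K * `|y| ^+ 0.
  by rewrite expr0 mulr1; have [] := gK t (s + y) tt.
have f2K := derivative_bound f20 d2 hK.
pose f1 z := gauss_ds t (s + z) + (- gauss_ds t s + - gauss_dss t s * z).
have d1 (y : R) : is_derive y 1 f1 (f2 y).
  have d := shift _ _ y (fun u => is_derive_gauss_ds u tn0).
  apply: (is_derive_eq (is_derive_addf d (is_derive_addf (is_derive_cstf _ _)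
    (is_derive_scalef _ (is_derive_idf _))))).
  by rewrite /f2; ring.
have f10 : f1 0 = 0 by rewrite /f1 addr0 mulr0; ring.
have f1K := derivative_bound f10 d1 f2K.
pose f0 z := gauss_density t (s + z) + ((- gauss_density t s +
  - gauss_ds t s * z) + (- gauss_dss t s / 2) * (z * z)).
have d0 (y : R) : is_derive y 1 f0 (f1 y).
  have d := shift _ _ y (fun u => is_derive_gauss u tn0).
  apply: (is_derive_eq (is_derive_addf d (is_derive_addf
    (is_derive_addf (is_derive_cstf _ _) (is_derive_scalef _ (is_derive_idf _)))
    (is_derive_scalef _ (is_derive_mulf (is_derive_idf y) (is_derive_idf y)))))).
  by rewrite /f1; field.
have f00 : f0 0 = 0 by rewrite /f0 addr0 !mulr0; ring.
rewrite (_ : _ - _ - _ = f0 z); last by rewrite /f0; field.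
exact: (derivative_bound f00 d0 f1K).
Qed.

(** Expansion in the variance; by the heat equation its linear coefficient is half the second
    derivative in [s]. *)
Lemma gauss_heat (t0 : R) : 0 < t0 ->
  exists2 K : R, 0 <= K & forall t s h, t0 <= t -> 0 <= h -> t + h <= 1 ->
    `|gauss_density (t + h) s - gauss_density t s - h / 2 * gauss_dss t s| <=
    K * h ^+ 2.
Proof.
move=> t00; have [K K0 gK] := gauss_derivatives_bound t00.
exists K => // t s h tt0 h0 th1.
have tp y : 0 <= y -> 0 < t + y by move=> y0; rewrite ltr_wpDr// (lt_le_trans t00).
have shift (f df : R -> R) (y : R) : (forall u : R, 0 < u -> is_derive u 1 f (df u)) ->
    0 <= y -> is_derive y 1 (fun y => f (t + y)) (df (t + y)).
  move=> fd y0; rewrite -[df _]mulr1; apply: is_derive_compf.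
    by apply: fd; exact: tp.
  rewrite -[X in is_derive _ _ _ X]add0r.
  apply: is_derive_addf; exact: is_derive_idf.
pose f1 z := 2^-1 * (gauss_dss (t + z) s - gauss_dss t s).
have d1 (y : R) : 0 <= y -> is_derive y 1 f1 (2^-1 * gauss_dsst (t + y) s).
  move=> y0.
  have d := shift (fun u => gauss_dss u s) _ y (fun u u0 => is_derive_gauss_dss_var s u0) y0.
  apply: (is_derive_eq (is_derive_scalef 2^-1
    (is_derive_addf d (is_derive_cstf (- gauss_dss t s) y)))).
  by rewrite addr0.
have f10 : f1 0 = 0 by rewrite /f1 addr0 subrr mulr0.
have f1K z : 0 <= z <= h -> `|f1 z| <= K * z ^+ 1.
  move=> /andP[z0 zh].
  have hK y : 0 <= y <= z -> `|2^-1 * gauss_dsst (t + y) s| <= K * y ^+ 0.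
    move=> /andP[y0 yz]; rewrite expr0 mulr1.
    have tty : t0 <= t + y <= 1.
      by rewrite (le_trans tt0) ?lerDl//= (le_trans _ th1)// lerD2l (le_trans yz).
    have [_ _ _ h4] := gK (t + y) s tty.
    rewrite normrM ger0_norm// (le_trans _ h4)// ler_piMl//.
    by rewrite invf_le1// ler1n.
  exact: (derivative_bound_ge0 z0 f10
    (fun y yz => d1 y (proj1 (andP yz))) hK).
pose f0 z := gauss_density (t + z) s + (- gauss_density t s +
  - (gauss_dss t s / 2) * z).
have d0 (y : R) : 0 <= y -> is_derive y 1 f0 (f1 y).
  move=> y0.
  have d := shift (fun u => gauss_density u s) _ y
    (fun u u0 => is_derive_gauss_var s u0) y0.
  apply: (is_derive_eq (is_derive_addf d
    (is_derive_addf (is_derive_cstf _ _) (is_derive_scalef _ (is_derive_idf _))))).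
  by rewrite /f1; field.
have f00 : f0 0 = 0 by rewrite /f0 addr0 mulr0; ring.
rewrite (_ : _ - _ - _ = f0 h); last by rewrite /f0; field.
exact: (derivative_bound_ge0 h0 f00 (fun y yh => d0 y (proj1 (andP yh))) f1K).
Qed.

End gaussian_expansions.

(** * Moments of the Gaussian densities *)

Section gaussian_moments.
Context (R : realType).
Implicit Types (s t m h z : R).
Local Notation mu := (@lebesgue_measure R).

Let mgauss t m : 0 < t -> measurable_fun setT (fun s : R => gauss_density t (s - m)).
Proof.
by move=> t0; apply: measurable_gauss_density => //; exact: measurable_funB.
Qed.

Lemma gauss_density_integrable t m : 0 < t ->
  Rintegrable mu (fun s => gauss_density t (s - m)).
Proof.
move=> t0; rewrite (_ : _ \o _ = (fun x => (normal_pdf m (Num.sqrt t) x)%:E)).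
  exact: integrable_normal_pdf.
by apply/funext => s /=; rewrite normal_pdf_gauss.
Qed.

Lemma gauss_density_integral t m : 0 < t ->
  \int[mu]_s gauss_density t (s - m) = 1.
Proof.
move=> t0; rewrite /Rintegral.
under eq_integral do rewrite -normal_pdf_gauss//.
by rewrite integral_normal_pdf.
Qed.

(** A Gaussian of variance [4 * t] dominates: [gauss_density_scale] at [r = 2] and [exp u >= 1 + u]
    produce the constant [16 / 3 * t]. *)
Lemma gauss_density_sqr_integrable t m : 0 < t ->
  Rintegrable mu (fun s => (s - m) ^+ 2 * gauss_density t (s - m)).
Proof.
move=> t0.
apply: (@Rintegrable_le _ _ _ mu _ (fun s => (16 / 3 * t) * gauss_density (2 ^+ 2 * t) (s - m))).
- by apply: measurable_funM; [apply: measurable_funX; exact: measurable_funB|exact: mgauss].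
- move=> s; rewrite ger0_norm; last first.
    by apply: mulr_ge0; [exact: sqr_ge0|exact: gauss_density_ge0].
  have r0 : (0 : R) < 2 by [].
  have := gauss_density_scale (s - m) t0 r0.
  have := expR_ge1Dx ((1 - 2 ^- 2) * ((s - m) ^+ 2 / (2 * t))).
  set e := expR _; set g := gauss_density t _; set g4 := gauss_density _ _.
  move=> he hg.
  have g0 : 0 <= g by exact: gauss_density_ge0.
  have : g * (1 + (1 - 2 ^- 2) * ((s - m) ^+ 2 / (2 * t))) <= 2 * g4.
    by rewrite hg ler_wpM2l.
  have -> : (s - m) ^+ 2 * g = 8 / 3 * t * (g * (1 + (1 - 2 ^- 2) *
      ((s - m) ^+ 2 / (2 * t))) - g).
    by field; rewrite gt_eqF.
  move=> h; rewrite (_ : 16 / 3 * t * g4 = 8 / 3 * t * (2 * g4)); last by field.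
  by rewrite ler_pM2l ?mulr_gt0// lerBlDr (le_trans h)// lerDl.
- by apply: RintegrableZ; apply: gauss_density_integrable; rewrite mulr_gt0.
Qed.

Lemma gauss_density_id_integrable t m : 0 < t ->
  Rintegrable mu (fun s => (s - m) * gauss_density t (s - m)).
Proof.
move=> t0.
apply: (@Rintegrable_le _ _ _ mu _ (fun s => gauss_density t (s - m) +
  (s - m) ^+ 2 * gauss_density t (s - m))).
- by apply: measurable_funM; [exact: measurable_funB|exact: mgauss].
- move=> s; rewrite normrM.
  rewrite [leRHS](_ : _ = (1 + (s - m) ^+ 2) * gauss_density t (s - m)); last by ring.
  rewrite [`|gauss_density _ _|]ger0_norm ?gauss_density_ge0//.
  rewrite ler_wpM2r ?gauss_density_ge0// ler_norml.
  have := sqr_ge0 (s - m + 1 / 2); have := sqr_ge0 (s - m - 1 / 2).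
  by set u := s - m => ? ?; apply/andP; split; nra.
- by apply: RintegrableD; [exact: gauss_density_integrable|
                           exact: gauss_density_sqr_integrable].
Qed.

(* Both moments are read off the normalisation of the other Gaussian densities:
   [exp u >= 1 + u] bounds the density with shifted mean, or scaled variance,
   from below by a multiple of the given one. *)
Lemma gauss_density_centered t m : 0 < t ->
  \int[mu]_s ((s - m) * gauss_density t (s - m)) = 0.
Proof.
move=> t0; set M := \int[mu]_s _.
have ig := gauss_density_integrable m t0.
have ig1 := gauss_density_id_integrable m t0.
have hM h : h * M <= h ^+ 2 / 2.
  have : \int[mu]_s ((1 - h ^+ 2 / (2 * t)) * gauss_density t (s - m) +
      h / t * ((s - m) * gauss_density t (s - m))) <=
      \int[mu]_s gauss_density t (s - (m + h)).
    apply: le_RintegralT.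
    - by apply: RintegrableD; exact: RintegrableZ.
    - exact: gauss_density_integrable.
    - move=> s; rewrite opprD addrA (gauss_density_shift h (s - m))//.
      have := expR_ge1Dx ((s - m) * h / t - h ^+ 2 / (2 * t)).
      move=> /(ler_wpM2l (gauss_density_ge0 t (s - m))); apply: le_trans.
      by rewrite le_eqVlt; apply/orP; left; apply/eqP; ring.
  rewrite RintegralTD; [|exact: RintegrableZ..].
  rewrite RintegralTZ// RintegralTZ// !gauss_density_integral// -/M => hh.
  have {hh} : h / t * M <= h ^+ 2 / (2 * t) by lra.
  rewrite -(ler_pM2r t0) (_ : h / t * M * t = h * M); last by field; rewrite gt_eqF.
  by rewrite (_ : _ / (2 * t) * t = h ^+ 2 / 2)//; field; rewrite gt_eqF.
(* The bound at [h = M] reads [M ^+ 2 <= M ^+ 2 / 2]. *)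
by have := hM M; have := sqr_ge0 M => ? ?; apply/eqP; rewrite -sqrf_eq0; apply/eqP; nra.
Qed.

Lemma gauss_density_variance t m : 0 < t ->
  \int[mu]_s ((s - m) ^+ 2 * gauss_density t (s - m)) = t.
Proof.
move=> t0; set M := \int[mu]_s _.
have ig := gauss_density_integrable m t0.
have ig2 := gauss_density_sqr_integrable m t0.
have M0 : 0 <= M.
  apply: RintegralT_ge0 => s.
  by apply: mulr_ge0; [exact: sqr_ge0|exact: gauss_density_ge0].
have hM x : -1 < x -> (2 * x + x ^+ 2) * M <= 2 * x * (1 + x) ^+ 2 * t.
  move=> x1; have r0 : 0 < 1 + x by lra.
  have : \int[mu]_s (gauss_density t (s - m) + (1 - (1 + x) ^- 2) / (2 * t) *
      ((s - m) ^+ 2 * gauss_density t (s - m))) <=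
      \int[mu]_s ((1 + x) * gauss_density ((1 + x) ^+ 2 * t) (s - m)).
    apply: le_RintegralT.
    - by apply: RintegrableD => //; exact: RintegrableZ.
    - by apply/RintegrableZ/gauss_density_integrable; rewrite mulr_gt0// exprn_gt0.
    - move=> s; rewrite (gauss_density_scale (s - m) t0 r0).
      have := expR_ge1Dx ((1 - (1 + x) ^- 2) * ((s - m) ^+ 2 / (2 * t))).
      move=> /(ler_wpM2l (gauss_density_ge0 t (s - m))); apply: le_trans.
      set g := gauss_density t (s - m); set i := 1 - (1 + x) ^- 2.
      set u := (s - m) ^+ 2; set w := (2 * t)^-1.
      by rewrite le_eqVlt; apply/orP; left; apply/eqP; ring.
  have rt : 0 < (1 + x) ^+ 2 * t by rewrite mulr_gt0// exprn_gt0.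
  rewrite RintegralTD//; last exact: RintegrableZ.
  rewrite RintegralTZ// RintegralTZ; last exact: gauss_density_integrable.
  rewrite !gauss_density_integral// -/M mulr1 lerD2l => hh.
  have p0 : 0 < 2 * t * (1 + x) ^+ 2 by rewrite mulr_gt0 ?exprn_gt0// mulr_gt0.
  move: hh; rewrite -(ler_pM2r p0).
  rewrite (_ : _ * M * _ = (2 * x + x ^+ 2) * M); last by field; rewrite !gt_eqF.
  by rewrite (_ : x * _ = 2 * x * (1 + x) ^+ 2 * t)//; ring.
(* Divide [hM] by [2 * x] and let [x] tend to 0: from the right this gives [M <= t], from the left
   [t <= M]. The two choices of [x] below make the errors [3 * t * x] and [2 * t * x] at most
   [e]. *)
apply/eqP; rewrite eq_le; apply/andP; split; apply/ler_addgt0Pl => e e0.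
- pose x := Num.min 1 (e / (3 * t)).
  have x0 : 0 < x by rewrite lt_min ltr01 divr_gt0// mulr_gt0.
  have x1 : x <= 1 by rewrite ge_min lexx.
  have xe : 3 * t * x <= e.
    by rewrite mulrC -ler_pdivlMr ?mulr_gt0// ge_min lexx orbT.
  have xN1 : -1 < x by lra.
  have := hM x xN1.
  rewrite (_ : (2 * x + x ^+ 2) * M = 2 * x * ((1 + x / 2) * M)); last by field.
  rewrite -[2 * x * _ * t]mulrA ler_pM2l ?mulr_gt0// => h.
  have h1 : M <= (1 + x / 2) * M by rewrite ler_peMl// lerDl divr_ge0// ltW.
  rewrite (le_trans h1)// (le_trans h)//.
  apply: (@le_trans _ _ ((1 + 3 * x) * t)); last by lra.
  by rewrite ler_pM2r//; nra.
- pose x := Num.min (1 / 2) (e / (2 * t)).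
  have x0 : 0 < x by rewrite lt_min divr_gt0//= divr_gt0// mulr_gt0.
  have x1 : x <= 1 / 2 by rewrite ge_min lexx.
  have xe : 2 * t * x <= e.
    by rewrite mulrC -ler_pdivlMr ?mulr_gt0// ge_min lexx orbT.
  have xN1 : -1 < - x by lra.
  have := hM (- x) xN1.
  rewrite (_ : (2 * - x + (- x) ^+ 2) * M = - (2 * x * ((1 - x / 2) * M)));
    last by field.
  rewrite (_ : 2 * - x * (1 + - x) ^+ 2 * t = - (2 * x * ((1 - x) ^+ 2 * t)));
    last by ring.
  rewrite lerN2 ler_pM2l ?mulr_gt0// => h.
  have h1 : (1 - x / 2) * M <= M by rewrite ler_piMl//; lra.
  have h2 : (1 - 2 * x) * t <= (1 - x) ^+ 2 * t by rewrite ler_pM2r//; nra.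
  lra.
Qed.

Lemma gauss_density_mean t m : 0 < t ->
  Rintegrable mu (fun s => s * gauss_density t (s - m)) /\
  \int[mu]_s (s * gauss_density t (s - m)) = m.
Proof.
move=> t0; have ig := gauss_density_integrable m t0.
have ig1 := gauss_density_id_integrable m t0.
have E : (fun s => s * gauss_density t (s - m)) =
    fun s => (s - m) * gauss_density t (s - m) + m * gauss_density t (s - m).
  by apply/funext => s; ring.
rewrite E; split; first by apply: RintegrableD => //; exact: RintegrableZ.
rewrite RintegralTD//; last exact: RintegrableZ.
by rewrite gauss_density_centered// RintegralTZ// gauss_density_integral// add0r mulr1.
Qed.

Lemma gauss_density_sqr t m : 0 < t ->
  Rintegrable mu (fun s => s ^+ 2 * gauss_density t (s - m)) /\
  \int[mu]_s (s ^+ 2 * gauss_density t (s - m)) = t + m ^+ 2.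
Proof.
move=> t0; have ig := gauss_density_integrable m t0.
have [ig1 E1] := gauss_density_mean m t0.
have ig2 := gauss_density_sqr_integrable m t0.
have i1 := RintegrableZ (2 * m) ig1.
have i0 := RintegrableZ (- m ^+ 2) ig.
have E : (fun s => s ^+ 2 * gauss_density t (s - m)) =
    fun s => ((s - m) ^+ 2 * gauss_density t (s - m) +
      2 * m * (s * gauss_density t (s - m))) + - m ^+ 2 * gauss_density t (s - m).
  by apply/funext => s; ring.
rewrite E; split; first by do 2 apply: RintegrableD => //.
rewrite RintegralTD//; last exact: RintegrableD.
rewrite RintegralTD// gauss_density_variance// RintegralTZ// E1 RintegralTZ//.
by rewrite gauss_density_integral//; ring.
Qed.

(** As for the second moment, but with [exp u >= 1 + u ^+ 2 / 2] at [u = 3 / 8 * s ^+ 2], whence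
    [256 / 9]. *)
Lemma gauss_density_pow4_integrable :
  Rintegrable mu (fun s => s ^+ 4 * gauss_density 1 s).
Proof.
apply: (@Rintegrable_le _ _ _ mu _ (fun s => 256 / 9 * gauss_density (2 ^+ 2 * 1) (s - 0))).
- apply: measurable_funM; first exact: measurable_funX.
  by apply: measurable_gauss_density.
- move=> s; rewrite ger0_norm; last first.
    by apply: mulr_ge0; [exact: exprn_even_ge0|exact: gauss_density_ge0].
  have r0 : (0 : R) < 2 by [].
  have := gauss_density_scale s ltr01 r0; rewrite subr0.
  have u0 : 0 <= (1 - 2 ^- 2) * (s ^+ 2 / (2 * 1)).
    by rewrite mulr_ge0 ?subr_ge0 ?invf_le1 ?exprn_ege1 ?divr_ge0 ?sqr_ge0 ?ler1n.
  have := expR_ge1Dxn 1 u0; rewrite [2`!]/=.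
  set e := expR _; set g := gauss_density 1 _; set g4 := gauss_density _ _.
  move=> he hg; have g0 : 0 <= g by exact: gauss_density_ge0.
  rewrite (_ : 256 / 9 * g4 = 128 / 9 * (2 * g4)); last by field.
  rewrite hg mulrCA [leLHS]mulrC ler_wpM2l//.
  apply: le_trans (_ : 128 / 9 * (1 + ((1 - 2 ^- 2) * (s ^+ 2 / (2 * 1))) ^+ 2 / 2) <= _).
    rewrite (_ : (1 - 2 ^- 2) * (s ^+ 2 / (2 * 1)) = 3 / 8 * s ^+ 2); last by field.
    by nra.
  by rewrite ler_wpM2l.
- by apply: RintegrableZ; apply: gauss_density_integrable; rewrite mulr_gt0.
Qed.

End gaussian_moments.

(** * Score sums and Lindeberg replacement *)

Section products.
Context d1 d2 (T1 : measurableType d1) (T2 : measurableType d2) (R : realType).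
Variables (P1 : probability T1 R) (P2 : probability T2 R).

Lemma Rintegrable_cst d (T : measurableType d) (P : probability T R) (k : R) :
  Rintegrable P (fun=> k).
Proof. exact: finite_measure_integrable_cst. Qed.

Lemma Rintegral_cst_probability d (T : measurableType d) (P : probability T R)
  (k : R) : \int[P]_x k = k.
Proof. by rewrite Rintegral_cst// [X in fine X](@probability_setT _ _ _ P) mulr1. Qed.

Lemma Rintegrable_fst (f : T1 -> R) : Rintegrable P1 f ->
  Rintegrable (P1 \x P2)%E (fun z => f z.1).
Proof.
move=> fi; have mf := Rintegrable_measurable fi.
apply: (@Rintegrable_product _ _ _ _ _ _ _ _ (fun z => `|f z.1|)) => //.
- exact: measurableT_comp.
- by apply: measurableT_comp => //; exact: measurableT_comp.
- by move=> y; exact: Rintegrable_normr.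
- exact: (Rintegrable_cst P2 (\int[P1]_x `|f x|)).
Qed.

Lemma Rintegrable_snd (f : T2 -> R) : Rintegrable P2 f ->
  Rintegrable (P1 \x P2)%E (fun z => f z.2).
Proof.
move=> fi; have mf := Rintegrable_measurable fi.
apply: (@Rintegrable_product _ _ _ _ _ _ _ _ (fun z => `|f z.2|)) => //.
- exact: measurableT_comp.
- by apply: measurableT_comp => //; exact: measurableT_comp.
- by move=> y; exact: (Rintegrable_cst P1 `|f y|).
- rewrite (_ : (fun y => _) = fun y => `|f y|); first exact: Rintegrable_normr.
  by apply/funext => y; exact: (Rintegral_cst_probability P1 `|f y|).
Qed.

End products.

(** What the limit theorem has to know about a channel and a tangent vector, for some version [L] of
    the score with variance [J]. It is instantiated by local data on a finite input space, by their
    restriction to one input and by multiples of the Gaussian shift. Measurability is joint in input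
    and output because the conditional law of the output, given the smoothed sum, must be a kernel
    in the input too. *)
Record score_data (R : realType) (X Y : mspace R) (Phi : channel X Y)
    (D : tangent X Y) (L : X -> Y -> R) (J : X -> R) (B M : R) := ScoreData {
  sd_measurable : measurable_fun setT (fun z : X * Y => L z.1 z.2);
  sd_var_measurable : measurable_fun setT J;
  sd_fourth : forall x, Rintegrable (out_prob Phi x) (fun y => L x y ^+ 4);
  sd_fourth_le : forall x, \int[out_prob Phi x]_y (L x y ^+ 4) <= M;
  sd_mean : forall x, \int[out_prob Phi x]_y L x y = 0;
  sd_var : forall x, \int[out_prob Phi x]_y (L x y ^+ 2) = J x;
  sd_var_le : forall x, J x <= B;
  sd_op : forall x g, bounded_measurable g ->
    tangent_op D g x = \int[out_prob Phi x]_y (g y * L x y) }.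

Section score_sum.
Context (R : realType) (X Y : mspace R) (Phi : channel X Y) (D : tangent X Y).
Context (L : X -> Y -> R) (J : X -> R) (B M : R).
Hypothesis sd : score_data Phi D L J B M.

Lemma score_measurableP x : measurable_fun setT (L x).
Proof.
exact: (measurableT_comp (sd_measurable sd) (measurable_pair1 x)).
Qed.

Lemma score_pow_integrable x (f : R -> R) : measurable_fun setT f ->
  (forall l, `|f l| <= 1 + l ^+ 4) ->
  Rintegrable (out_prob Phi x) (fun y => f (L x y)).
Proof.
move=> mf fl; apply: (Rintegrable_le (g := fun y => 1 + L x y ^+ 4)).
- by apply: measurableT_comp => //; exact: score_measurableP.
- by move=> y.
- by apply: RintegrableD; [exact: Rintegrable_cst|exact: (sd_fourth sd x)].
Qed.

Lemma score1_integrable x : Rintegrable (out_prob Phi x) (L x).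
Proof.
apply: (@score_pow_integrable x id) => // l.
have := sqr_ge0 (l ^+ 2 - 1 / 2); have := sqr_ge0 (l - 1 / 2).
have := sqr_ge0 (l + 1 / 2).
rewrite ler_norml => ? ? ?; apply/andP; split; nra.
Qed.

Lemma score_sqr_integrable x : Rintegrable (out_prob Phi x) (fun y => L x y ^+ 2).
Proof.
apply: (@score_pow_integrable x (fun l => l ^+ 2)); first exact: exprn_measurable.
by move=> l; rewrite ger0_norm ?sqr_ge0//; have := sqr_ge0 (l ^+ 2 - 1 / 2); nra.
Qed.

Lemma score_cube_le (l : R) : `|l| ^+ 3 <= 1 + l ^+ 4.
Proof.
rewrite (_ : l ^+ 4 = `|l| ^+ 4); last first.
  by rewrite -normrX ger0_norm ?exprn_even_ge0.
have := normr_ge0 l; set u := `|l| => u0.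
have := sqr_ge0 (u ^+ 2 - u / 2); have := sqr_ge0 (u - 1); nra.
Qed.

Lemma score_cube_integrable x :
  Rintegrable (out_prob Phi x) (fun y => `|L x y| ^+ 3).
Proof.
apply: (@score_pow_integrable x (fun l => `|l| ^+ 3)).
  by apply: measurable_funX; exact: normr_measurable.
by move=> l; rewrite ger0_norm ?exprn_ge0//; exact: score_cube_le.
Qed.

Lemma score_cube_integral_le x : \int[out_prob Phi x]_y (`|L x y| ^+ 3) <= 1 + M.
Proof.
apply: le_trans (_ : \int[out_prob Phi x]_y (1 + L x y ^+ 4) <= _).
  apply: le_RintegralT; first exact: score_cube_integrable.
    by apply: RintegrableD; [exact: Rintegrable_cst|exact: (sd_fourth sd x)].
  by move=> y; exact: score_cube_le.
rewrite RintegralTD; [|exact: Rintegrable_cst|exact: (sd_fourth sd x)].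
by rewrite Rintegral_cst_probability lerD2l (sd_fourth_le sd).
Qed.

Lemma score_var_ge0 x : 0 <= J x.
Proof. by rewrite -(sd_var sd); apply: RintegralT_ge0 => y; exact: sqr_ge0. Qed.

Fixpoint score_sum n : space_pow X n -> space_pow Y n -> R :=
  match n with
  | 0 => fun _ _ => 0
  | m.+1 => fun (x : X * space_pow X m) (y : Y * space_pow Y m) =>
              L x.1 y.1 + score_sum x.2 y.2
  end.

Fixpoint var_sum n : space_pow X n -> R :=
  match n with
  | 0 => fun _ => 0
  | m.+1 => fun x : X * space_pow X m => J x.1 + var_sum x.2
  end.

Lemma measurable_score_sum n : measurable_fun setT
  (fun z : space_pow X n * space_pow Y n => score_sum z.1 z.2).
Proof.
elim: n => [|n ih]; first exact: measurable_cst.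
pose T := ((X * space_pow X n) * (Y * space_pow Y n))%type.
have m1 : measurable_fun [set: T] (fun z => (z.1.1, z.2.1)).
  by apply: measurable_fun_pair; apply: measurableT_comp.
have m2 : measurable_fun [set: T] (fun z => (z.1.2, z.2.2)).
  by apply: measurable_fun_pair; apply: measurableT_comp.
apply: measurable_funD; first exact: (measurableT_comp (sd_measurable sd) m1).
exact: (measurableT_comp ih m2).
Qed.

Lemma measurable_score_sum_section n x :
  measurable_fun setT (score_sum (n := n) x).
Proof.
exact: (measurableT_comp (@measurable_score_sum n) (measurable_pair1 x)).
Qed.

Lemma measurable_var_sum n : measurable_fun setT (@var_sum n).
Proof.
elim: n => [|n ih]; first exact: measurable_cst.
apply: measurable_funD; apply: measurableT_comp => //.
exact: sd_var_measurable sd.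
Qed.

Lemma var_sum_ge0 n (x : space_pow X n) : 0 <= var_sum x.
Proof.
by elim: n x => [//|n ih] x; exact: addr_ge0 (score_var_ge0 _) (ih _).
Qed.

Lemma var_sum_le n (x : space_pow X n) : var_sum x <= n%:R * B.
Proof.
elim: n x => [|n ih] x; first by rewrite mul0r.
rewrite -natr1 mulrDl mul1r addrC lerD//; exact: sd_var_le sd _.
Qed.

(** Letters are independent and their scores centred, so the cross terms integrate to 0 and the
    variances add. *)
Lemma score_sum_moments n (x : space_pow X n) :
  [/\ Rintegrable (out_prob (channel_pow Phi n) x) (fun y => score_sum x y ^+ 2),
      \int[out_prob (channel_pow Phi n) x]_y score_sum x y = 0 &
      \int[out_prob (channel_pow Phi n) x]_y (score_sum x y ^+ 2) = var_sum x].
Proof.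
elim: n x => [|n ih] x.
  split.
  - rewrite [X in Rintegrable _ X](_ : _ = fun=> 0); last first.
      by apply/funext => y /=; rewrite expr0n.
    exact: Rintegrable_cst.
  - exact: Rintegral_cst_probability.
  - rewrite (eq_RintegralT _ (g := fun=> 0)).
      exact: Rintegral_cst_probability.
    by move=> y /=; rewrite expr0n.
have [i2 m1 m2] := ih x.2.
set P1 := out_prob Phi x.1; set P2 := out_prob (channel_pow Phi n) x.2 in i2 m1 m2.
have iS : Rintegrable P2 (score_sum x.2).
  apply: (Rintegrable_le (g := fun y => 1 + score_sum x.2 y ^+ 2)).
  - exact: measurable_score_sum_section.
  - move=> y; set l := score_sum _ _; rewrite ler_norml.
    have := sqr_ge0 (l - 1 / 2); have := sqr_ge0 (l + 1 / 2) => ? ?.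
    apply/andP; split; nra.
  - by apply: RintegrableD => //; exact: Rintegrable_cst.
have iL := score1_integrable x.1; have iL2 := score_sqr_integrable x.1.
have iS2 (a b c : R) :
    Rintegrable P2 (fun y => a + b * score_sum x.2 y + c * score_sum x.2 y ^+ 2).
  by do 2 (apply: RintegrableD; last exact: RintegrableZ); exact: Rintegrable_cst.
have iP1 : Rintegrable (P1 \x P2)%E (fun z => L x.1 z.1 + score_sum x.2 z.2).
  by apply: RintegrableD; [exact: Rintegrable_fst|exact: Rintegrable_snd].
have iP2 : Rintegrable (P1 \x P2)%E (fun z => (L x.1 z.1 + score_sum x.2 z.2) ^+ 2).
  apply: (Rintegrable_le (g := fun z => 2 * L x.1 z.1 ^+ 2 + 2 * score_sum x.2 z.2 ^+ 2)).
  - apply: measurable_funX; exact: Rintegrable_measurable iP1.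
  - move=> z; rewrite ger0_norm ?sqr_ge0//; set a := L _ _; set b := score_sum _ _.
    by have := sqr_ge0 (a - b); nra.
  - by apply: RintegrableD; apply: RintegrableZ;
      [exact: (@Rintegrable_fst _ _ _ _ _ P1 P2 (fun y => L x.1 y ^+ 2))|
       exact: (@Rintegrable_snd _ _ _ _ _ P1 P2 (fun y => score_sum x.2 y ^+ 2))].
have sec1 y1 : Rintegrable P2 (fun y2 => L x.1 y1 + score_sum x.2 y2).
  by apply: RintegrableD => //; exact: Rintegrable_cst.
have sec2 y1 : Rintegrable P2 (fun y2 => (L x.1 y1 + score_sum x.2 y2) ^+ 2).
  rewrite [X in Rintegrable _ X](_ : _ = fun y => L x.1 y1 ^+ 2 +
    (2 * L x.1 y1) * score_sum x.2 y + 1 * score_sum x.2 y ^+ 2)//.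
  by apply/funext => y; ring.
split => //.
- apply: etrans (Rintegral_product1 iP1 sec1) _ => /=.
  rewrite -[RHS](sd_mean sd x.1); apply: eq_RintegralT => y1 /=.
  rewrite RintegralTD//; last exact: Rintegrable_cst.
  by rewrite Rintegral_cst_probability m1 addr0.
- apply: etrans (Rintegral_product1 iP2 sec2) _ => /=.
  rewrite (eq_RintegralT _ (g := fun y1 => L x.1 y1 ^+ 2 + var_sum x.2)).
    rewrite RintegralTD//; last exact: Rintegrable_cst.
    by rewrite Rintegral_cst_probability (sd_var sd).
  move=> y1 /=; rewrite (eq_RintegralT _ (g := fun y => (L x.1 y1 ^+ 2 +
    (2 * L x.1 y1) * score_sum x.2 y) + score_sum x.2 y ^+ 2)); last first.
    by move=> y; ring.
  have i0 : Rintegrable P2 (fun=> L x.1 y1 ^+ 2) by exact: Rintegrable_cst.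
  have i1 : Rintegrable P2 (fun y => 2 * L x.1 y1 * score_sum x.2 y).
    exact: RintegrableZ.
  rewrite RintegralTD//; last exact: RintegrableD.
  rewrite RintegralTD// RintegralTZ// Rintegral_cst_probability m1 m2.
  by rewrite mulr0 addr0.
Qed.

Lemma score_sum_integrable n (x : space_pow X n) :
  Rintegrable (out_prob (channel_pow Phi n) x) (score_sum x).
Proof.
have [i2 _ _] := score_sum_moments x.
apply: (Rintegrable_le (g := fun y => 1 + score_sum x y ^+ 2)).
- exact: measurable_score_sum_section.
- move=> y; set l := score_sum _ _; rewrite ler_norml.
  have := sqr_ge0 (l - 1 / 2); have := sqr_ge0 (l + 1 / 2) => ? ?.
  apply/andP; split; nra.
- by apply: RintegrableD => //; exact: Rintegrable_cst.
Qed.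

(** The Leibniz rule: each summand of the n-th tangent contributes the score of its own letter, so
    the score sum is the score of the product. *)
Lemma tangent_op_pow n (x : space_pow X n) g : bounded_measurable g ->
  tangent_op (tangent_pow Phi D n) g x =
  \int[out_prob (channel_pow Phi n) x]_y (g y * score_sum x y).
Proof.
elim: n x g => [|n ih] x g bg.
  rewrite tangent_op_diff subrr (eq_RintegralT _ (g := fun=> 0)).
    by rewrite Rintegral_cst_probability.
  by move=> y /=; rewrite mulr0.
set P1 := out_prob Phi x.1; set P2 := out_prob (channel_pow Phi n) x.2.
have bgs y1 : bounded_measurable (fun y2 => g (y1, y2)).
  exact: bounded_measurable_section.
have iL := score1_integrable x.1.
have iS : Rintegrable P2 (score_sum x.2) := score_sum_integrable x.2.
have iP : Rintegrable (P1 \x P2)%E (fun z => L x.1 z.1 + score_sum x.2 z.2).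
  by apply: RintegrableD; [exact: Rintegrable_fst|exact: Rintegrable_snd].
have sec y1 : Rintegrable P2 (fun y2 => L x.1 y1 + score_sum x.2 y2).
  by apply: RintegrableD => //; exact: Rintegrable_cst.
apply: esym; apply: etrans (Rintegral_product1 (m1 := P1) (m2 := P2)
  (f := fun z => g z * (L x.1 z.1 + score_sum x.2 z.2)) _ _) _.
- exact: Rintegrable_boundedM.
- by move=> y1; exact: Rintegrable_boundedM (sec y1) (bgs y1).
rewrite [RHS]tangent_op_tadd// tangent_op_tensorl// tangent_op_tensorr//.
rewrite (sd_op sd); last exact: bounded_measurable_tensor_section.
rewrite /channel_op -/P1 -/P2.
have b1 : bounded_measurable (fun y1 => \int[P2]_y2 g (y1, y2)).
  exact: (bounded_measurable_tensor_section (channel_pow Phi n) x.2 bg).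
have b2 : bounded_measurable
    (fun y1 => tangent_op (tangent_pow Phi D n) (fun y2 => g (y1, y2)) x.2).
  by apply: bounded_measurableZ; apply: bounded_measurableB;
    exact: bounded_measurable_tensor_section.
rewrite -[RHS]RintegralTD; last 2 first.
- exact: Rintegrable_boundedM.
- exact: channel_bounded.
apply: eq_RintegralT => y1 /=; rewrite ih//.
rewrite mulrC -RintegralTZ; last exact: channel_bounded.
rewrite -RintegralTD; last 2 first.
- by apply: RintegrableZ; exact: channel_bounded.
- exact: Rintegrable_boundedM.
by apply: eq_RintegralT => y2 /=; ring.
Qed.

(** One letter is traded for a Gaussian of equal variance. The linear Taylor term vanishes because
    the score is centred, the quadratic one is the linear term of the heat expansion with
    [h = a ^+ 2 * J x]. What remains is the cubic remainder, bounded through the fourth moment, and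
    [(a ^+ 2 * J x) ^+ 2]. *)
Lemma lindeberg_step (t0 : R) : 0 < t0 ->
  exists2 K : R, 0 <= K & forall x a t s, t0 <= t -> t + a ^+ 2 * J x <= 1 ->
    `|\int[out_prob Phi x]_y gauss_density t (s - a * L x y) -
      gauss_density (t + a ^+ 2 * J x) s| <= K * (`|a| ^+ 3 + a ^+ 4).
Proof.
move=> t00; have [K3 K30 taylor] := gauss_taylor3 t00.
have [K4 K40 heat] := gauss_heat t00.
have [K0 K00 gK] := gauss_derivatives_bound t00.
have M0 : 0 <= 1 + M.
  apply: le_trans (score_cube_integral_le point).
  by apply: RintegralT_ge0 => y; rewrite exprn_ge0.
exists (K3 * (1 + M) + K4 * B ^+ 2).
  by apply: addr_ge0; apply: mulr_ge0 => //; exact: sqr_ge0.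
move=> x a t s tt0 ta1; have aJ0 : 0 <= a ^+ 2 * J x.
  by rewrite mulr_ge0 ?sqr_ge0 ?score_var_ge0.
have tt : t0 <= t <= 1 by rewrite tt0 (le_trans _ ta1)// lerDl.
have tp : 0 < t by exact: lt_le_trans tt0.
set P := out_prob Phi x.
have iL := score1_integrable x; have iL2 := score_sqr_integrable x.
have iL3 := score_cube_integrable x.
have mg : measurable_fun setT (fun y => gauss_density t (s - a * L x y)).
  apply: measurable_gauss_density => //; apply: measurable_funB => //.
  by apply: measurable_funM => //; exact: score_measurableP.
have ig : Rintegrable P (fun y => gauss_density t (s - a * L x y)).
  apply: (Rintegrable_le (g := fun=> K0)) => //; last exact: Rintegrable_cst.
  move=> y; rewrite ger0_norm ?gauss_density_ge0//.
  by have [] := gK t (s - a * L x y) tt.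
(* Second-order Taylor polynomial of the density at [s], for the displacement [- a * L x y]. *)
pose T y := gauss_density t s + (- a * gauss_ds t s) * L x y +
  (a ^+ 2 / 2 * gauss_dss t s) * L x y ^+ 2.
have iT : Rintegrable P T.
  by do 2 (apply: RintegrableD; last exact: RintegrableZ); exact: Rintegrable_cst.
have TE : \int[P]_y T y = gauss_density t s + a ^+ 2 * J x / 2 * gauss_dss t s.
  rewrite RintegralTD; last exact: RintegrableZ; last first.
    by apply: RintegrableD; [exact: Rintegrable_cst|exact: RintegrableZ].
  rewrite RintegralTD; [|exact: Rintegrable_cst|exact: RintegrableZ].
  rewrite RintegralTZ// RintegralTZ// (sd_mean sd) (sd_var sd).
  by rewrite Rintegral_cst_probability; ring.
have h1 : `|\int[P]_y gauss_density t (s - a * L x y) - \int[P]_y T y| <=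
    K3 * (1 + M) * `|a| ^+ 3.
  rewrite -RintegralTB//.
  apply: le_trans (_ : \int[P]_y (K3 * `|a| ^+ 3 * `|L x y| ^+ 3) <= _).
    apply: normr_Rintegral_le.
    - exact: RintegrableB.
    - exact: RintegrableZ.
    - move=> y; have := taylor t s (- a * L x y) tt.
      have -> : `|- a * L x y| ^+ 3 = `|a| ^+ 3 * `|L x y| ^+ 3.
        by rewrite normrM normrN exprMn.
      rewrite (mulrA K3); apply: le_trans.
      have -> : s - a * L x y = s + - a * L x y by rewrite mulNr.
      by rewrite le_eqVlt; apply/orP; left; apply/eqP; congr `|_|; rewrite /T; field.
  rewrite RintegralTZ// mulrAC ler_wpM2r ?exprn_ge0// ler_wpM2l//.
  exact: score_cube_integral_le.
have h2 := heat t s (a ^+ 2 * J x) tt0 aJ0 ta1.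
have h3 : K4 * (a ^+ 2 * J x) ^+ 2 <= K4 * B ^+ 2 * a ^+ 4.
  rewrite (_ : (a ^+ 2 * J x) ^+ 2 = J x ^+ 2 * a ^+ 4); last by ring.
  rewrite -[leRHS]mulrA ler_wpM2l// ler_wpM2r ?exprn_even_ge0//.
  by rewrite lerXn2r ?nnegrE ?score_var_ge0 ?(sd_var_le sd)//
    (le_trans (score_var_ge0 x))// (sd_var_le sd).
move: h1 h2; rewrite TE; set I := \int[P]_y _; set g1 := gauss_density (t + _) s.
set g0 := gauss_density t s; set g2 := _ / 2 * gauss_dss t s => h1 h2.
rewrite (_ : I - g1 = (I - (g0 + g2)) - (g1 - g0 - g2)); last by ring.
apply: le_trans (ler_normB _ _) _; apply: le_trans (lerD h1 (le_trans h2 h3)) _.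
rewrite [leRHS]mulrDl; apply: lerD.
- apply: ler_wpM2l; first exact: mulr_ge0.
  by rewrite lerDl exprn_even_ge0.
- apply: ler_wpM2l; last by rewrite lerDr exprn_ge0.
  by apply: mulr_ge0 => //; exact: sqr_ge0.
Qed.

(** Induction on the letters: integrating out the tail leaves a Gaussian of larger variance, to
    which the step is applied for the head. The constant does not degrade since all variances met on
    the way stay in [[t0, 1]]. The comparison is between densities, pointwise in [s]. *)
Lemma lindeberg (t0 : R) : 0 < t0 ->
  exists2 K : R, 0 <= K & forall n (x : space_pow X n) a t s,
    t0 <= t -> t + a ^+ 2 * var_sum x <= 1 ->
    `|\int[out_prob (channel_pow Phi n) x]_y gauss_density t (s - a * score_sum x y) -
      gauss_density (t + a ^+ 2 * var_sum x) s| <=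
    n%:R * (K * (`|a| ^+ 3 + a ^+ 4)).
Proof.
move=> t00; have [K K0 step] := lindeberg_step t00; exists K => //.
have [K1 K10 gK] := gauss_derivatives_bound t00.
elim=> [|n ih] x a t s tt0 ta1.
  rewrite mul0r (eq_RintegralT _ (g := fun=> gauss_density t s)); last first.
    by move=> y /=; rewrite mulr0 subr0.
  by rewrite Rintegral_cst_probability/= mulr0 addr0 subrr normr0.
set P1 := out_prob Phi x.1; set P2 := out_prob (channel_pow Phi n) x.2.
have J0 := score_var_ge0 x.1; have V0 := var_sum_ge0 x.2.
have a20 := sqr_ge0 a.
have tV1 : t + a ^+ 2 * var_sum x.2 <= 1.
  by apply: le_trans ta1; rewrite lerD2l ler_wpM2l//= lerDr.
have tt : t0 <= t <= 1 by rewrite tt0 (le_trans _ tV1)// lerDl mulr_ge0.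
have tp : 0 < t by exact: lt_le_trans tt0.
pose h (z : Y * space_pow Y n) :=
  gauss_density t (s - a * (L x.1 z.1 + score_sum x.2 z.2)).
have bh : bounded_measurable h.
  split; last first.
    exists K1 => z; rewrite ger0_norm ?gauss_density_ge0//.
    by have [] := gK t (s - a * (L x.1 z.1 + score_sum x.2 z.2)) tt.
  apply: measurable_gauss_density => //; apply: measurable_funB => //.
  apply: measurable_funM => //; apply: measurable_funD.
    by apply: measurableT_comp => //; exact: score_measurableP.
  by apply: measurableT_comp => //; exact: measurable_score_sum_section.
have -> : \int[out_prob (channel_pow Phi n.+1) x]_y
    gauss_density t (s - a * score_sum x y) =
    \int[P1]_y1 \int[P2]_y2 h (y1, y2).
  exact: (channel_op_tensor Phi (channel_pow Phi n) x bh).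
pose f y1 := gauss_density (t + a ^+ 2 * var_sum x.2) (s - a * L x.1 y1).
have tp' : 0 < t + a ^+ 2 * var_sum x.2 by rewrite ltr_wpDr// mulr_ge0.
have tt' : t0 <= t + a ^+ 2 * var_sum x.2 <= 1.
  by rewrite tV1 andbT (le_trans tt0)// lerDl mulr_ge0.
have i1 : Rintegrable P1 (fun y1 => \int[P2]_y2 h (y1, y2)).
  apply: channel_bounded.
  exact: (bounded_measurable_tensor_section (channel_pow Phi n) x.2 bh).
have i2 : Rintegrable P1 f.
  apply: channel_bounded; split; last first.
    exists K1 => y; rewrite ger0_norm ?gauss_density_ge0//.
    by have [] := gK _ (s - a * L x.1 y) tt'.
  apply: measurable_gauss_density => //; apply: measurable_funB => //.
  by apply: measurable_funM => //; exact: score_measurableP.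
have e1 : `|\int[P1]_y1 \int[P2]_y2 h (y1, y2) - \int[P1]_y1 f y1| <=
    n%:R * (K * (`|a| ^+ 3 + a ^+ 4)).
  rewrite -RintegralTB// -[leRHS](Rintegral_cst_probability P1).
  apply: normr_Rintegral_le; [exact: RintegrableB|exact: Rintegrable_cst|].
  move=> y1; have := ih x.2 a t (s - a * L x.1 y1) tt0 tV1.
  apply: le_trans; rewrite le_eqVlt; apply/orP; left; apply/eqP.
  congr `|_ - _|; apply: eq_RintegralT => y2; rewrite /h /=; congr gauss_density.
  by ring.
have e2 := step x.1 a (t + a ^+ 2 * var_sum x.2) s.
have ta1' : t + a ^+ 2 * var_sum x.2 + a ^+ 2 * J x.1 <= 1.
  by rewrite (le_trans _ ta1)//= mulrDr addrAC addrA.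
have {}e2 := e2 (proj1 (andP tt')) ta1'.
have -> : t + a ^+ 2 * var_sum x = t + a ^+ 2 * var_sum x.2 + a ^+ 2 * J x.1.
  by rewrite /= mulrDr addrAC addrA.
rewrite -natr1 mulrDl mul1r.
move: e1 e2; set I1 := \int[P1]_y1 _; set I2 := \int[P1]_y1 f y1.
set g1 := gauss_density _ _; set k := K * _; move=> e1 e2.
rewrite (_ : I1 - g1 = (I1 - I2) + (I2 - g1)); last by ring.
by rewrite (le_trans (ler_normD _ _))// lerD.
Qed.

End score_sum.

(** * Smoothed score sums *)

Section sup_norm_and_tail.
Context (R : realType).
Local Notation mu := (@lebesgue_measure R).

(** Use the pointwise bound on [[-K, K]], an interval of length [2 * K], and [|d| <= e / K] outside
    it, as in Markov's inequality. *)
Lemma lebesgue_L1_bound (d e : R -> R) (K delta E : R) : 0 < K -> 0 <= delta ->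
  measurable_fun setT d -> Rintegrable mu e ->
  (forall s, `|d s| <= (1 + `|s|) * delta) -> (forall s, `|s| * `|d s| <= e s) ->
  \int[mu]_s e s <= E ->
  Rintegrable mu d /\ \int[mu]_s `|d s| <= 2 * K * (1 + K) * delta + E / K.
Proof.
move=> K0 delta0 md ie dd de eE.
pose I : R -> R := \1_(`[- K, K] : set R).
have iI : Rintegrable mu I by exact: integrable_indic_itv.
have II : \int[mu]_s I s = 2 * K.
  rewrite /Rintegral integral_indic//= setIT lebesgue_measure_itv/=.
  rewrite lte_fin ifT; first by rewrite -EFinD/=; ring.
  by lra.
have e0 s : 0 <= e s by rewrite (le_trans _ (de s))// mulr_ge0.
have dI s : `|d s| <= (1 + K) * delta * I s + K^-1 * e s.
  rewrite /I indicE; have [/=|sK] := boolP (s \in _).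
    rewrite inE/= in_itv/= -ler_norml => sK.
    rewrite mulr1 (le_trans (dd s))//.
    apply: (@le_trans _ _ ((1 + K) * delta)); first by rewrite ler_wpM2r// lerD2l.
    by rewrite lerDl mulr_ge0// invr_ge0 ltW.
  rewrite mulr0 add0r -(ler_pM2l K0) mulVKf ?gt_eqF//.
  apply: le_trans (de s); rewrite ler_wpM2r//.
  move: sK; rewrite notin_setE/= in_itv/= -ler_norml => /negP.
  by rewrite -ltNge => /ltW.
have iR : Rintegrable mu (fun s => (1 + K) * delta * I s + K^-1 * e s).
  by apply: RintegrableD; exact: RintegrableZ.
have id : Rintegrable mu d by exact: Rintegrable_le iR.
split => //.
apply: (le_trans (le_RintegralT (Rintegrable_normr id) iR dI)).
rewrite RintegralTD; [|exact: RintegrableZ..].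
rewrite RintegralTZ// RintegralTZ// II; apply: lerD.
  by rewrite le_eqVlt; apply/orP; left; apply/eqP; ring.
by rewrite mulrC ler_wpM2r// invr_ge0 ltW.
Qed.

Lemma le_normr_1Dsqr (x : R) : `|x| <= 1 + x ^+ 2.
Proof.
have := sqr_ge0 (x - 1 / 2); have := sqr_ge0 (x + 1 / 2) => ? ?.
by rewrite ler_norml; apply/andP; split; nra.
Qed.

Lemma normrM_le_sqrD (x y : R) : `|x * y| <= y ^+ 2 + x ^+ 2.
Proof.
have := sqr_ge0 (x - y); have := sqr_ge0 (x + y) => ? ?.
by rewrite ler_norml; apply/andP; split; nra.
Qed.

End sup_norm_and_tail.

Section smoothing.
Context (R : realType) (X Y : mspace R) (Phi : channel X Y) (D : tangent X Y).
Context (L : X -> Y -> R) (J : X -> R) (B M : R).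
Hypothesis sd : score_data Phi D L J B M.
Context (c : R).
Hypothesis c0 : 0 < c.
Hypothesis Bc : B < c ^+ 2.
Local Notation mu := (@lebesgue_measure R).
Local Notation S := (score_sum L).
Local Notation V := (var_sum J).
Local Notation P := (fun x => out_prob (channel_pow Phi _) x).

(* [noise x] is the variance of the Gaussian that has to be added to the
   normalised score sum [scaling n * S x] for the total variance to be 1. *)
Definition scaling (n : nat) : R := (c * Num.sqrt n%:R)^-1.
Definition noise n (x : space_pow X n) : R := 1 - scaling n ^+ 2 * V x.
Definition smooth_kernel n (x : space_pow X n) (s : R) (y : space_pow Y n) : R :=
  gauss_density (noise x) (s - scaling n * S x y).
Definition smooth_density n (x : space_pow X n) (s : R) : R :=
  \int[out_prob (channel_pow Phi n) x]_y smooth_kernel x s y.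

Lemma scaling_sqr n : (0 < n)%N -> n%:R * scaling n ^+ 2 = c ^- 2.
Proof.
move=> n0; rewrite /scaling exprVn exprMn sqr_sqrtr ?ler0n//.
by field; rewrite pnatr_eq0 -lt0n n0 gt_eqF.
Qed.

Lemma scaling_ge0 n : 0 <= scaling n.
Proof. by rewrite invr_ge0 mulr_ge0 ?sqrtr_ge0// ltW. Qed.

Lemma B_ge0 : 0 <= B.
Proof. exact: le_trans (score_var_ge0 sd point) (sd_var_le sd point). Qed.

Lemma scaled_var_le n (x : space_pow X n) : scaling n ^+ 2 * V x <= B / c ^+ 2.
Proof.
(* The case [n = 0] is separate: there [scaling] has the default value 0 and [scaling_sqr] does not
   apply, but the sum is empty. *)
case: n x => [|n] x; first by rewrite /= mulr0 divr_ge0 ?sqr_ge0 ?B_ge0.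
apply: (@le_trans _ _ (scaling n.+1 ^+ 2 * (n.+1%:R * B))).
  by rewrite ler_wpM2l ?sqr_ge0// (var_sum_le sd).
by rewrite mulrA [X in X * _]mulrC scaling_sqr// mulrC.
Qed.

Definition noise_min : R := 1 - B / c ^+ 2.

Lemma noise_min_gt0 : 0 < noise_min.
Proof. by rewrite subr_gt0 ltr_pdivrMr ?mul1r// exprn_gt0. Qed.

Lemma noise_itv n (x : space_pow X n) : noise_min <= noise x <= 1.
Proof.
rewrite lerD2l lerN2 scaled_var_le gerBl mulr_ge0 ?sqr_ge0//.
exact: (var_sum_ge0 sd).
Qed.

Lemma noise_gt0 n (x : space_pow X n) : 0 < noise x.
Proof.
by have /andP[h _] := noise_itv x; exact: lt_le_trans noise_min_gt0 h.
Qed.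

Lemma noiseD n (x : space_pow X n) : noise x + scaling n ^+ 2 * V x = 1.
Proof. by rewrite /noise subrK. Qed.

Lemma smooth_kernel_bounded : exists2 K : R, 0 <= K &
  forall n (x : space_pow X n) s y, smooth_kernel x s y <= K.
Proof.
have [K K0 gK] := gauss_derivatives_bound noise_min_gt0.
by exists K => // n x s y; have [] := gK _ (s - scaling n * S x y) (noise_itv x).
Qed.

Lemma smooth_kernel_gt0 n (x : space_pow X n) s y : 0 < smooth_kernel x s y.
Proof. exact: gauss_density_gt0. Qed.

Lemma smooth_kernel_ge0 n (x : space_pow X n) s y : 0 <= smooth_kernel x s y.
Proof. exact: gauss_density_ge0. Qed.

Lemma measurable_smooth_kernel n : measurable_fun setT
  (fun z : (R * space_pow X n) * space_pow Y n =>
     smooth_kernel z.1.2 z.1.1 z.2).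
Proof.
apply: measurable_gauss_density; last by move=> z; exact: noise_gt0.
- apply: measurable_funB => //; apply: measurable_funM => //.
  have mV := @measurable_var_sum _ _ _ _ _ _ _ _ _ sd n.
  have m : measurable_fun [set: (R * space_pow X n) * space_pow Y n]
      (fun z => z.1.2) by exact: measurableT_comp.
  exact: (measurableT_comp mV m).
- apply: measurable_funB; first exact: measurableT_comp.
  apply: measurable_funM => //.
  have m : measurable_fun [set: (R * space_pow X n) * space_pow Y n]
      (fun z => (z.1.2, z.2)).
    by apply: measurable_fun_pair => //; exact: measurableT_comp.
  have mS := @measurable_score_sum _ _ _ _ _ _ _ _ _ sd n.
  exact: (measurableT_comp mS m).
Qed.

Lemma measurable_smooth_kernel2 n (x : space_pow X n) : measurable_fun setT
  (fun z : R * space_pow Y n => smooth_kernel x z.1 z.2).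
Proof.
have m : measurable_fun [set: R * space_pow Y n] (fun z => ((z.1, x), z.2)).
  apply: measurable_fun_pair => //; apply: measurable_fun_pair => //.
exact: (measurableT_comp (@measurable_smooth_kernel n) m).
Qed.

Section fixed_input.
Context n (x : space_pow X n).
Local Notation Q := (out_prob (channel_pow Phi n) x).
Local Notation k := (smooth_kernel x).
Local Notation a := (scaling n).

Lemma smooth_kernel_moments y :
  [/\ Rintegrable mu (fun s => k s y), \int[mu]_s k s y = 1,
      Rintegrable mu (fun s => s * k s y) /\ \int[mu]_s (s * k s y) = a * S x y &
      Rintegrable mu (fun s => s ^+ 2 * k s y) /\
      \int[mu]_s (s ^+ 2 * k s y) = noise x + a ^+ 2 * S x y ^+ 2].
Proof.
have t0 := noise_gt0 x; rewrite -exprMn; split.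
- exact: gauss_density_integrable.
- exact: gauss_density_integral.
- exact: gauss_density_mean.
- exact: gauss_density_sqr.
Qed.

(** Weights of quadratic growth can be integrated in either order: integrating the majorant against
    the kernel in [s] leaves an affine function of the squared score sum, which has finite mean. *)
Lemma smooth_fubini (G : R * space_pow Y n -> R) (A : R) :
  measurable_fun setT G ->
  (forall s y, `|G (s, y)| <= A * (1 + s ^+ 2 + S x y ^+ 2)) ->
  [/\ forall s, Rintegrable Q (fun y => G (s, y) * k s y),
      forall y, Rintegrable mu (fun s => G (s, y) * k s y),
      Rintegrable mu (fun s => \int[Q]_y (G (s, y) * k s y)) &
      \int[mu]_s \int[Q]_y (G (s, y) * k s y) =
      \int[Q]_y \int[mu]_s (G (s, y) * k s y)].
Proof.
move=> mG GA; have [C C0 kC] := smooth_kernel_bounded.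
have [iS2 _ _] := score_sum_moments sd x.
have mk := measurable_smooth_kernel2 x.
have mS : measurable_fun setT (S x) by exact: (measurable_score_sum_section sd x).
have A0 : 0 <= A.
  have := le_trans (normr_ge0 _) (GA 0 point).
  rewrite pmulr_lge0// expr0n/= addr0.
  by rewrite ltr_wpDr ?sqr_ge0.
pose W s y := A * (1 + s ^+ 2 + S x y ^+ 2).
have i1 s : Rintegrable Q (fun y => G (s, y) * k s y).
  apply: (Rintegrable_le (g := fun y => C * (A * (1 + s ^+ 2)) + C * A * S x y ^+ 2)).
  - apply: measurable_funM.
      exact: (measurableT_comp mG (measurable_pair1 s)).
    exact: (measurableT_comp mk (measurable_pair1 s)).
  - move=> y; rewrite normrM [`|k s y|]ger0_norm ?smooth_kernel_ge0//.
    rewrite (_ : _ + _ = A * (1 + s ^+ 2 + S x y ^+ 2) * C); last by ring.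
    by rewrite ler_pM ?smooth_kernel_ge0.
  - by apply: RintegrableD; [exact: Rintegrable_cst|exact: RintegrableZ].
have iW y : Rintegrable mu (fun s => W s y * k s y) /\ \int[mu]_s (W s y * k s y) =
    A * (1 + noise x) + A * (1 + a ^+ 2) * S x y ^+ 2.
  have [k0 E0 _ [k2 E2]] := smooth_kernel_moments y.
  have E : (fun s => W s y * k s y) =
      fun s => A * (1 + S x y ^+ 2) * k s y + A * (s ^+ 2 * k s y).
    by apply/funext => s; rewrite /W; ring.
  rewrite E; split; first by apply: RintegrableD; exact: RintegrableZ.
  rewrite RintegralTD; [|exact: RintegrableZ..].
  by rewrite RintegralTZ// RintegralTZ// E0 E2; ring.
have mGk : measurable_fun setT (fun z => G z * k z.1 z.2).
  exact: measurable_funM.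
have i2 y : Rintegrable mu (fun s => G (s, y) * k s y).
  apply: Rintegrable_le (proj1 (iW y)).
  - exact: (measurableT_comp mGk (measurable_pair2 y)).
  - move=> s; rewrite normrM [`|k s y|]ger0_norm ?smooth_kernel_ge0//.
    by rewrite ler_wpM2r ?smooth_kernel_ge0.
have ip : Rintegrable (mu \x Q)%E (fun z => G z * k z.1 z.2).
  apply: (@Rintegrable_product _ _ _ _ _ mu Q _ (fun z => W z.1 z.2 * k z.1 z.2)).
  - exact: mGk.
  - apply: measurable_funM => //; apply: measurable_funM => //.
    apply: measurable_funD.
      by apply: measurable_funD => //; apply: measurable_funX.
    by apply: measurable_funX; exact: measurableT_comp.
  - move=> [s y] /=; rewrite normrM [`|k s y|]ger0_norm ?smooth_kernel_ge0//.
    by rewrite ler_wpM2r ?smooth_kernel_ge0// GA.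
  - by move=> y; have [] := iW y.
  - rewrite [X in Rintegrable _ X](_ : _ = fun y =>
        A * (1 + noise x) + A * (1 + a ^+ 2) * S x y ^+ 2); last first.
      by apply/funext => y; have [_ <-] := iW y.
    by apply: RintegrableD; [exact: Rintegrable_cst|exact: RintegrableZ].
split => //.
- exact: (Rintegrable_fubini1 ip i1).
- exact: (Rfubini ip i1 i2).
Qed.

Lemma smooth_kernel_integrable s : Rintegrable Q (fun y => k s y).
Proof.
have [|s' y|h _ _ _] := @smooth_fubini (fun=> 1) 1; first exact: measurable_cst.
  by rewrite normr1 mul1r -addrA lerDl addr_ge0 ?sqr_ge0.
rewrite [X in Rintegrable _ X](_ : _ = fun y => 1 * k s y)//.
by apply/funext => y; rewrite mul1r.
Qed.

Lemma smooth_density_ge0 s : 0 <= smooth_density x s.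
Proof. by apply: RintegralT_ge0 => y; exact: smooth_kernel_ge0. Qed.

(** The second moment is exactly 1 for every [n] and every input string, by the choice of the noise;
    this is the uniform tail control. *)
Lemma smooth_density_moments :
  [/\ Rintegrable mu (smooth_density x), \int[mu]_s smooth_density x s = 1,
      Rintegrable mu (fun s => s ^+ 2 * smooth_density x s) &
      \int[mu]_s (s ^+ 2 * smooth_density x s) = 1].
Proof.
have [iS2 _ E2] := score_sum_moments sd x.
have [|s y|_ _ i1 e1] := @smooth_fubini (fun=> 1) 1; first exact: measurable_cst.
  by rewrite normr1 mul1r -addrA lerDl addr_ge0 ?sqr_ge0.
have [|s y|h2 _ i2 e2] := @smooth_fubini (fun z => z.1 ^+ 2) 1.
- exact: measurable_funX.
- rewrite mul1r ger0_norm ?sqr_ge0//= addrAC lerDr addr_ge0 ?sqr_ge0//.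
have E s : \int[Q]_y (1 * k s y) = smooth_density x s.
  by apply: eq_RintegralT => y; rewrite mul1r.
have Es s : \int[Q]_y (s ^+ 2 * k s y) = s ^+ 2 * smooth_density x s.
  by rewrite RintegralTZ//; exact: smooth_kernel_integrable.
split.
- by apply: eq_integrable i1 => // s _; congr EFin; exact: E.
- transitivity (\int[mu]_s \int[Q]_y (1 * k s y)).
    by apply: eq_RintegralT => s; rewrite E.
  rewrite e1.
  rewrite (eq_RintegralT _ (g := fun=> 1)) ?Rintegral_cst_probability// => y.
  have [_ k1 _ _] := smooth_kernel_moments y; rewrite -[RHS]k1.
  by apply: eq_RintegralT => s; rewrite mul1r.
- by apply: eq_integrable i2 => // s _; congr EFin; exact: Es.
- transitivity (\int[mu]_s \int[Q]_y (s ^+ 2 * k s y)).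
    by apply: eq_RintegralT => s; rewrite Es.
  rewrite e2.
  rewrite (eq_RintegralT _ (g := fun y => noise x + a ^+ 2 * S x y ^+ 2)).
    rewrite RintegralTD; [|exact: Rintegrable_cst|exact: RintegrableZ].
    by rewrite RintegralTZ// E2 Rintegral_cst_probability noiseD.
  by move=> y; have [_ _ _ [_ <-]] := smooth_kernel_moments y.
Qed.

Lemma gauss1_moments :
  [/\ Rintegrable mu (gauss_density 1), \int[mu]_s gauss_density 1 s = 1,
      Rintegrable mu (fun s => s ^+ 2 * gauss_density 1 s) &
      \int[mu]_s (s ^+ 2 * gauss_density 1 s) = 1].
Proof.
have E : gauss_density 1 = (fun s : R => gauss_density 1 (s - 0)).
  by apply/funext => s; rewrite subr0.
have [i2 e2] := gauss_density_sqr (0 : R) ltr01.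
rewrite expr0n/= addr0 in e2; split.
- rewrite E; exact: gauss_density_integrable.
- by rewrite E; exact: gauss_density_integral.
- by rewrite E; exact: i2.
- by rewrite E; exact: e2.
Qed.

Lemma smooth_density_L1 (K delta : R) : 0 < K -> 0 <= delta ->
  (forall s, `|smooth_density x s - gauss_density 1 s| <= delta) ->
  Rintegrable mu (fun s => (1 + `|s|) * (smooth_density x s - gauss_density 1 s)) /\
  \int[mu]_s `|(1 + `|s|) * (smooth_density x s - gauss_density 1 s)| <=
  2 * K * (1 + K) * delta + 6 / K.
Proof.
move=> K0 delta0 fd.
have [i0 e0 i2 e2] := smooth_density_moments.
have [j0 g0 j2 g2] := gauss1_moments.
(* From [|s| * (1 + |s|) <= 1 + 2 * s ^+ 2]; masses and second moments are all 1, so [e] has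
   integral [2 + 4 = 6]. *)
pose e s := (smooth_density x s + gauss_density 1 s) +
  2 * (s ^+ 2 * smooth_density x s + s ^+ 2 * gauss_density 1 s).
have ie : Rintegrable mu e.
  apply: RintegrableD; first exact: RintegrableD.
  by apply: RintegrableZ; exact: RintegrableD.
apply: (lebesgue_L1_bound (e := e)) => //.
- apply: measurable_funM.
    by apply: measurable_funD => //; exact: normr_measurable.
  apply: measurable_funB; first exact: (Rintegrable_measurable i0).
  exact: (Rintegrable_measurable j0).
- by move=> s; rewrite normrM ger0_norm ?addr_ge0// ler_wpM2l// addr_ge0.
- move=> s; rewrite normrM mulrA [`|1 + `|s| |]ger0_norm ?addr_ge0//.
  have h : `|smooth_density x s - gauss_density 1 s| <=
      smooth_density x s + gauss_density 1 s.
    apply: le_trans (ler_normB _ _) _.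
    by rewrite !ger0_norm ?gauss_density_ge0 ?smooth_density_ge0.
  apply: (@le_trans _ _ ((1 + 2 * s ^+ 2) *
      (smooth_density x s + gauss_density 1 s))).
    have h6 : 0 <= `|s| * (1 + `|s|) by rewrite mulr_ge0// addr_ge0.
    apply: ler_pM => //; rewrite mulrDr mulr1 -expr2 real_normK ?num_real//.
    by have := le_normr_1Dsqr s; lra.
  by rewrite /e le_eqVlt; apply/orP; left; apply/eqP; ring.
- rewrite RintegralTD; [|exact: RintegrableD|by apply: RintegrableZ; exact: RintegrableD].
  rewrite RintegralTD// RintegralTZ; last exact: RintegrableD.
  by rewrite RintegralTD// e0 g0 e2 g2; lra.
Qed.

(* Density of the image of the normalised tangent under the smoothed score. *)
Definition smooth_tangent s : R := \int[Q]_y (a * S x y * k s y).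

(** Rewrites [t * gauss_ds t u = - u * gauss_density t u] at [u = s - a * S x y]. The tangent
    density is thereby expressed through the smoothed density and its derivative. For N(0,1) the
    same expression equals [1 - noise x] times the shift, and [1 - noise x] is [a ^+ 2 * V x]. *)
Lemma smooth_tangentE s : smooth_tangent s = s * smooth_density x s +
  noise x * \int[Q]_y gauss_ds (noise x) (s - a * S x y).
Proof.
have t0 := noise_gt0 x.
have mS : measurable_fun setT (S x) by exact: (measurable_score_sum_section sd x).
have [|s' y|h _ _ _] := @smooth_fubini (fun z => a * S x z.2) a.
- by apply: measurable_funM => //; exact: measurableT_comp.
- rewrite /= normrM ger0_norm ?scaling_ge0// ler_wpM2l ?scaling_ge0//.
  by rewrite addrAC (le_trans (le_normr_1Dsqr _))// lerDl sqr_ge0.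
have ik := smooth_kernel_integrable s.
have E y : gauss_ds (noise x) (s - a * S x y) =
    (noise x)^-1 * (a * S x y * k s y) + - (s / noise x) * k s y.
  by rewrite /gauss_ds -/(k s y); field; rewrite gt_eqF.
have -> : \int[Q]_y gauss_ds (noise x) (s - a * S x y) =
    (noise x)^-1 * smooth_tangent s + - (s / noise x) * smooth_density x s.
  rewrite -(RintegralTZ _ (h s)) -(RintegralTZ _ ik) -RintegralTD.
  - exact: eq_RintegralT.
  - exact: RintegrableZ (h s).
  - exact: RintegrableZ.
by field; rewrite gt_eqF.
Qed.

Lemma smooth_tangent_integrable :
  (forall s, Rintegrable Q (fun y => a * S x y * k s y)) /\
  Rintegrable mu smooth_tangent.
Proof.
have mS : measurable_fun setT (S x) by exact: (measurable_score_sum_section sd x).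
have [|s' y|h _ h' _] := @smooth_fubini (fun z => a * S x z.2) a => //.
- by apply: measurable_funM => //; exact: measurableT_comp.
- rewrite /= normrM ger0_norm ?scaling_ge0// ler_wpM2l ?scaling_ge0//.
  by rewrite addrAC (le_trans (le_normr_1Dsqr _))// lerDl sqr_ge0.
Qed.

Lemma smooth_tangent_L1 (K delta delta' : R) : 0 < K -> 0 <= delta -> 0 <= delta' ->
  (forall s, `|smooth_density x s - gauss_density 1 s| <= delta) ->
  (forall s, `|\int[Q]_y gauss_ds (noise x) (s - a * S x y) - gauss_ds 1 s| <= delta') ->
  Rintegrable mu (fun s => smooth_tangent s -
     a ^+ 2 * V x * (s * gauss_density 1 s)) /\
  \int[mu]_s `|smooth_tangent s - a ^+ 2 * V x * (s * gauss_density 1 s)| <=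
  2 * K * (1 + K) * (delta + delta') + 3 / K.
Proof.
move=> K0 delta0 delta'0 fd fd'.
have [i0 e0 i2 e2] := smooth_density_moments.
have [j0 g0 j2 g2] := gauss1_moments.
have [iS2 _ ES2] := score_sum_moments sd x.
have mS : measurable_fun setT (S x) by exact: (measurable_score_sum_section sd x).
have /andP[_ n1] := noise_itv x; have n0 := noise_gt0 x.
have aV : a ^+ 2 * V x = 1 - noise x by rewrite /noise; ring.
have [|s y|h1 _ h2 h3] := @smooth_fubini (fun z => a ^+ 2 * S x z.2 ^+ 2) (a ^+ 2).
- by apply: measurable_funM => //; apply: measurable_funX; exact: measurableT_comp.
- rewrite /= -exprMn ger0_norm ?sqr_ge0// exprMn; apply: ler_wpM2l.
    exact: sqr_ge0.
  by rewrite lerDr addr_ge0 ?sqr_ge0.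
have [ih iT] := smooth_tangent_integrable.
have ea : \int[mu]_s \int[Q]_y (a ^+ 2 * S x y ^+ 2 * k s y) = a ^+ 2 * V x.
  rewrite h3 -ES2 -RintegralTZ//; apply: eq_RintegralT => y.
  have [k0 k1 _ _] := smooth_kernel_moments y.
  by rewrite -[RHS]mulr1 -[in RHS]k1 -[RHS](RintegralTZ _ k0).
(* Tail majorant, from [|s * (a * S)| <= s ^+ 2 + (a * S) ^+ 2]; its integral is
   [a ^+ 2 * V x + 1 + 1], at most 3. *)
pose e s := \int[Q]_y (a ^+ 2 * S x y ^+ 2 * k s y) +
  s ^+ 2 * smooth_density x s + s ^+ 2 * gauss_density 1 s.
have ie : Rintegrable mu e by do 2 (apply: RintegrableD => //).
apply: (lebesgue_L1_bound (e := e)) => //.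
- exact: addr_ge0.
- apply: measurable_funB; first exact: Rintegrable_measurable iT.
  apply: measurable_funM => //; apply: measurable_funM => //.
  exact: Rintegrable_measurable j0.
- move=> s; rewrite smooth_tangentE.
  set f1 := \int[Q]_y _.
  rewrite (_ : _ - _ = s * (smooth_density x s - gauss_density 1 s) +
      noise x * (f1 - gauss_ds 1 s)); last first.
    by rewrite aV /gauss_ds; field.
  apply: le_trans (ler_normD _ _) _.
  have h4 : `|s * (smooth_density x s - gauss_density 1 s)| <= `|s| * delta.
    by rewrite normrM ler_wpM2l.
  have h5 : `|noise x * (f1 - gauss_ds 1 s)| <= delta'.
    rewrite normrM ger0_norm ?(ltW n0)// (le_trans _ (fd' s))// ler_piMl//.
  apply: le_trans (lerD h4 h5) _.
  rewrite [leRHS]mulrDr; apply: lerD; first by rewrite ler_wpM2r// lerDr.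
  by rewrite ler_peMl// lerDl.
- move=> s.
  have h4 : `|s| * `|smooth_tangent s| <= \int[Q]_y (a ^+ 2 * S x y ^+ 2 * k s y) +
      s ^+ 2 * smooth_density x s.
    have ik := smooth_kernel_integrable s.
    have -> : \int[Q]_y (a ^+ 2 * S x y ^+ 2 * k s y) + s ^+ 2 * smooth_density x s =
        \int[Q]_y (a ^+ 2 * S x y ^+ 2 * k s y + s ^+ 2 * k s y).
      rewrite -(RintegralTZ _ ik) [RHS]RintegralTD//; first exact: h1.
      exact: RintegrableZ.
    rewrite -normrM -(RintegralTZ _ (ih s)); apply: normr_Rintegral_le.
    - exact: RintegrableZ.
    - apply: RintegrableD; first exact: h1.
      by apply: RintegrableZ; exact: smooth_kernel_integrable.
    - move=> y; rewrite mulrA normrM [`|k s y|]ger0_norm ?smooth_kernel_ge0//.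
      rewrite -mulrDl ler_wpM2r ?smooth_kernel_ge0// -exprMn.
      exact: normrM_le_sqrD.
  have h5 : `|s| * `|a ^+ 2 * V x * (s * gauss_density 1 s)| <=
      s ^+ 2 * gauss_density 1 s.
    rewrite aV !normrM ger0_norm ?subr_ge0//.
    rewrite [`|gauss_density _ _|]ger0_norm ?gauss_density_ge0//.
    rewrite (_ : _ * _ = (1 - noise x) * (`|s| ^+ 2 * gauss_density 1 s)); last by ring.
    rewrite real_normK ?num_real//; apply: ler_piMl; last by rewrite gerBl ltW.
    by apply: mulr_ge0; [exact: sqr_ge0|exact: gauss_density_ge0].
  apply: le_trans (ler_wpM2l (normr_ge0 s) (ler_normB _ _)) _.
  by rewrite mulrDr /e lerD.
- rewrite RintegralTD; [|by apply: RintegrableD|exact: j2].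
  by rewrite RintegralTD// ea e2 g2 aV; lra.
Qed.

End fixed_input.

(** Lindeberg replacement at [t = noise x], where the total variance is 1. With
    [a = 1 / (c * sqrt n)], the error [n * a ^+ 3] is of order [1 / sqrt n], and [n * a ^+ 4] is
    smaller. *)
Lemma smooth_density_sup : exists2 K : R, 0 <= K &
  forall n (x : space_pow X n) s, (0 < n)%N ->
    `|smooth_density x s - gauss_density 1 s| <= K * (Num.sqrt n%:R)^-1.
Proof.
have [K K0 lind] := lindeberg sd noise_min_gt0.
exists (K * (c ^- 3 + c ^- 4)).
  by rewrite mulr_ge0// addr_ge0// invr_ge0 exprn_ge0// ltW.
move=> n x s n0; have /andP[h _] := noise_itv x.
have := lind n x (scaling n) (noise x) s h; rewrite noiseD lexx => /(_ isT).
rewrite -/(smooth_density x s); move=> hh; apply: le_trans hh _.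
rewrite ger0_norm ?scaling_ge0// mulrCA -mulrA ler_wpM2l//.
have r0 : 0 < Num.sqrt (n%:R : R) by rewrite sqrtr_gt0 ltr0n.
have r1 : 1 <= Num.sqrt (n%:R : R) by rewrite -[leLHS]sqrtr1 ler_wsqrtr// ler1n.
have nE : n%:R = Num.sqrt n%:R ^+ 2 :> R by rewrite sqr_sqrtr// ler0n.
rewrite /scaling {1}nE; set r := Num.sqrt _ in r0 r1 *.
rewrite (_ : r ^+ 2 * _ = (c ^- 3 + c ^- 4 * r^-1) * r^-1); last first.
  by field; rewrite !gt_eqF.
rewrite ler_wpM2r ?invr_ge0 ?(ltW r0)// lerD2l ler_piMr ?invr_ge0 ?exprn_ge0 ?(ltW c0)//.
by rewrite invf_le1.
Qed.

(* Landau's trick: the derivatives are close because the functions are close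
   and have bounded second derivatives. *)
Lemma smooth_ds_sup : exists2 K : R, 0 <= K &
  forall n (x : space_pow X n) (delta h : R), 0 < h ->
    (forall s, `|smooth_density x s - gauss_density 1 s| <= delta) ->
    forall s, `|\int[out_prob (channel_pow Phi n) x]_y
                gauss_ds (noise x) (s - scaling n * S x y) - gauss_ds 1 s| <=
              2 * delta / h + K * h.
Proof.
have [K K0 taylor] := gauss_taylor2 noise_min_gt0.
exists (2 * K); first by rewrite mulr_ge0.
move=> n x delta h h0 fd s; set Q := out_prob _ _.
have i0 := smooth_kernel_integrable x s.
have ih := smooth_kernel_integrable x (s + h).
have t0 := noise_gt0 x.
have i1 : Rintegrable Q (fun y => gauss_ds (noise x) (s - scaling n * S x y)).
  have [ik _] := smooth_tangent_integrable x.
  rewrite [X in Rintegrable _ X](_ : _ = fun y =>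
    (noise x)^-1 * (scaling n * S x y * smooth_kernel x s y) +
    - (s / noise x) * smooth_kernel x s y); last first.
    apply/funext => y; rewrite /gauss_ds -/(smooth_kernel x s y).
    by field; rewrite gt_eqF.
  by apply: RintegrableD; exact: RintegrableZ.
set f1 := \int[Q]_y _.
have e1 : `|smooth_density x (s + h) - smooth_density x s - h * f1| <= K * h ^+ 2.
  rewrite -RintegralTB// -RintegralTZ// -RintegralTB//; last 2 first.
  - exact: RintegrableB.
  - exact: RintegrableZ.
  rewrite -[leRHS](Rintegral_cst_probability Q); apply: normr_Rintegral_le.
  - by apply: RintegrableB; [exact: RintegrableB|exact: RintegrableZ].
  - exact: Rintegrable_cst.
  - move=> y; have := taylor (noise x) (s - scaling n * S x y) h (noise_itv x).
    by rewrite [_ - _ + h]addrAC.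
have /andP[nm n1] := noise_itv x.
have e2 := taylor 1 s h; rewrite lexx (le_trans nm n1) in e2; have {}e2 := e2 isT.
rewrite -(ler_pM2l h0) -{1}(ger0_norm (ltW h0)) -normrM.
set F := smooth_density x in fd e1; set g := gauss_density 1 in fd e2.
(* Multiplied by [h], the difference of the derivatives is the increment of [F - g] over
   [[s, s + h]] minus the difference of two Taylor remainders. *)
rewrite (_ : h * (f1 - gauss_ds 1 s) = (F (s + h) - g (s + h)) - (F s - g s) -
  ((F (s + h) - F s - h * f1) - (g (s + h) - g s - h * gauss_ds 1 s))); last by ring.
apply: le_trans (ler_normB _ _) _.
apply: le_trans (lerD (ler_normB _ _) (ler_normB _ _)) _.
apply: le_trans (lerD (lerD (fd _) (fd _)) (lerD e1 e2)) _.
by rewrite le_eqVlt; apply/orP; left; apply/eqP; field; rewrite gt_eqF.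
Qed.

Lemma inv_sqrt_small (e : R) : 0 < e ->
  exists2 N, (0 < N)%N & forall n, (N <= n)%N -> (Num.sqrt n%:R)^-1 <= e.
Proof.
move=> e0; exists (Num.truncn (e ^- 2)).+1 => // n Nn.
have n0 : 0 < (n%:R : R) by rewrite ltr0n (leq_trans _ Nn).
rewrite -[leRHS]invrK lef_pV2 ?posrE ?sqrtr_gt0 ?invr_gt0//.
rewrite -[leLHS]ger0_norm ?invr_ge0 ?(ltW e0)// -sqrtr_sqr ler_wsqrtr//.
rewrite exprVn (le_trans (ltW (Num.Theory.truncnS_gt _)))// ler_nat//.
Qed.

Lemma smooth_density_cvg (e : R) : 0 < e ->
  exists2 N, (0 < N)%N & forall n (x : space_pow X n), (N <= n)%N ->
    Rintegrable mu (fun s => (1 + `|s|) * (smooth_density x s - gauss_density 1 s)) /\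
    \int[mu]_s `|(1 + `|s|) * (smooth_density x s - gauss_density 1 s)| <= e.
Proof.
move=> e0; have [C C0 sup] := smooth_density_sup.
(* This [K] makes the tail term [6 / K] equal to [e / 2]; [N] then makes the central term at most
   [e / 2]. *)
have [K K0 KE] : exists2 K : R, 0 < K & K = 12 / e.
  by exists (12 / e) => //; rewrite divr_gt0.
pose T := 2 * K * (1 + K) * (C + 1).
have C1 : 0 < C + 1 by rewrite ltr_wpDl.
have K1 : 0 < 1 + K by rewrite addr_gt0.
have T0 : 0 < T by rewrite /T !mulr_gt0.
have [N N0 hN] := inv_sqrt_small (divr_gt0 (divr_gt0 e0 (ltr0Sn R 1)) T0).
exists N => // n x Nn.
have n0 : (0 < n)%N by exact: leq_trans Nn.
set r := (Num.sqrt (n%:R : R))^-1.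
have r0 : 0 <= r by rewrite invr_ge0 sqrtr_ge0.
have [i ib] := smooth_density_L1 K0 (mulr_ge0 C0 r0) (fun s => sup n x s n0).
split => //; apply: le_trans ib _.
have : r * T <= e / 2 by rewrite -ler_pdivlMr// hN.
have -> : 6 / K = e / 2 by rewrite KE; field; rewrite gt_eqF.
have : 0 <= 2 * K * (1 + K) * r.
  by rewrite !mulr_ge0// ?addr_ge0// ltW.
rewrite /T; nra.
Qed.

Lemma smooth_tangent_cvg (e : R) : 0 < e ->
  exists2 N, (0 < N)%N & forall n (x : space_pow X n), (N <= n)%N ->
    Rintegrable mu (fun s => smooth_tangent x s -
      scaling n ^+ 2 * V x * (s * gauss_density 1 s)) /\
    \int[mu]_s `|smooth_tangent x s -
      scaling n ^+ 2 * V x * (s * gauss_density 1 s)| <= e.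
Proof.
move=> e0; have [C C0 sup] := smooth_density_sup.
have [C' C'0 sup'] := smooth_ds_sup.
(* Order of choices: [K] makes the tail [3 / K] equal to [e / 4], then [h] brings the
   second-derivative term [C' * h] of Landau's bound, multiplied by [T], below [e / 4], and only
   then [N], which depends on [h], takes care of the remaining [e / 2]. *)
have [K K0 KE] : exists2 K : R, 0 < K & K = 12 / e.
  by exists (12 / e) => //; rewrite divr_gt0.
have K1 : 0 < 1 + K by rewrite addr_gt0.
have [T T0 TE] : exists2 T : R, 0 < T & T = 2 * K * (1 + K).
  by exists (2 * K * (1 + K)) => //; rewrite !mulr_gt0.
have C'1 : 0 < C' + 1 by rewrite ltr_wpDl.
have [h h0 hE] : exists2 h : R, 0 < h & h = e / (4 * T * (C' + 1)).
  by exists (e / (4 * T * (C' + 1))) => //; rewrite divr_gt0// !mulr_gt0.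
pose U := T * (C + 2 * C / h) + 1.
have U0 : 0 < U.
  rewrite /U ltr_wpDl// mulr_ge0 ?(ltW T0)// addr_ge0//.
  by rewrite divr_ge0 ?mulr_ge0 ?(ltW h0).
have [N N0 hN] := inv_sqrt_small (divr_gt0 (divr_gt0 e0 (ltr0Sn R 1)) U0).
exists N => // n x Nn.
have n0 : (0 < n)%N by exact: leq_trans Nn.
set r := (Num.sqrt (n%:R : R))^-1.
have r0 : 0 <= r by rewrite invr_ge0 sqrtr_ge0.
have d0 := mulr_ge0 C0 r0.
have d'0 : 0 <= 2 * (C * r) / h + C' * h.
  by rewrite addr_ge0 ?mulr_ge0 ?invr_ge0 ?(ltW h0).
have [i ib] := smooth_tangent_L1 K0 d0 d'0 (fun s => sup n x s n0)
  (sup' n x _ h h0 (fun s => sup n x s n0)).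
split => //; apply: le_trans ib _.
have : r * U <= e / 2 by rewrite -ler_pdivlMr// hN.
have -> : 3 / K = e / 4 by rewrite KE; field; rewrite gt_eqF.
have : T * (C' * h) <= e / 4.
  rewrite (_ : T * _ = e / 4 * (C' / (C' + 1))); last first.
    by rewrite hE; field; rewrite !gt_eqF.
  rewrite ler_piMr ?divr_ge0 ?(ltW e0)// ler_pdivrMr// mul1r.
  by rewrite lerDl.
rewrite -TE /U (_ : T * (C * r + (2 * (C * r) / h + C' * h)) =
  r * (T * (C + 2 * C / h)) + T * (C' * h)); last by ring.
lra.
Qed.

End smoothing.

(** * The Gaussian shift *)

Section density_channel.
Context (R : realType) (A B : mspace R) (K : channel A B) (f : A * B -> R).

(** The proofs travel as arguments so that the measure and Markov kernel structures can be attached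
    to this function canonically. *)
Definition kdensity (mf : measurable_fun setT f) (f0 : forall z, 0 <= f z)
    (f1 : forall a, (\int[K a]_b (f (a, b))%:E = 1)%E) (a : A) (U : set B)
    : \bar R :=
  (\int[K a]_(b in U) (f (a, b))%:E)%E.

Hypotheses (mf : measurable_fun setT f) (f0 : forall z, 0 <= f z).
Hypothesis f1 : forall a, (\int[K a]_b (f (a, b))%:E = 1)%E.
Local Notation nu := (kdensity mf f0 f1).

Let mfa a : measurable_fun setT (fun b => f (a, b)).
Proof. exact: (measurableT_comp mf (measurable_pair1 a)). Qed.

Lemma kdensity_integrable a : Rintegrable (K a) (fun b => f (a, b)).
Proof.
apply/integrableP; split; first exact/measurable_EFinP.
by under eq_integral do rewrite /= ger0_norm//; rewrite f1 ltry.
Qed.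

Let nu0 a : nu a set0 = 0%E.
Proof. exact: integral_set0. Qed.

Let nu_ge0 a U : (0 <= nu a U)%E.
Proof. by apply: integral_ge0 => b _; rewrite lee_fin. Qed.

Let nu_sigma_additive a : semi_sigma_additive (nu a).
Proof.
move=> F mF tF mUF; rewrite /kdensity integral_bigcup//=; last first.
  by apply: (integrableS _ _ (subsetT _)) => //; exact: kdensity_integrable.
apply: is_cvg_ereal_nneg_natsum_cond => n _ _.
by apply: integral_ge0 => b _; rewrite lee_fin.
Qed.

HB.instance Definition _ a := isMeasure.Build _ _ _ (nu a)
  (nu0 a) (@nu_ge0 a) (@nu_sigma_additive a).

Definition mkdensity : A -> {measure set B -> \bar R} := fun a => nu a.

Let measurable_kdensity U : measurable U ->
  measurable_fun [set: A] (mkdensity ^~ U).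
Proof.
move=> mU; rewrite /mkdensity /kdensity.
rewrite (_ : (fun a => _) =
    fun a => (\int[K a]_b (f (a, b) * \1_U b)%:E)%E); last first.
  apply/funext => a; rewrite [LHS]integral_mkcond; apply: eq_integral => b _.
  by rewrite patchE indicE; case: (b \in U); rewrite ?mulr1 ?mulr0.
apply: (measurable_fun_integral_finite_kernel (fun z => (f z * \1_U z.2)%:E) K).
  by move=> z; rewrite lee_fin mulr_ge0.
apply/measurable_EFinP; apply: measurable_funM => //.
have mI : measurable_fun setT (\1_U : B -> R) by exact: measurable_indic.
exact: (measurableT_comp mI measurable_snd).
Qed.

HB.instance Definition _ :=
  isKernel.Build _ _ _ _ _ mkdensity measurable_kdensity.

Let mkdensityT a : mkdensity a setT = 1%E.
Proof. exact: f1. Qed.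

HB.instance Definition _ :=
  Kernel_isProbability.Build _ _ _ _ _ mkdensity mkdensityT.

Definition density_channel : channel A B := mkdensity.

Lemma channel_op_density g a : bounded_measurable g ->
  channel_op density_channel g a = \int[K a]_b (g b * f (a, b)).
Proof.
move: g; apply: bounded_functional_ext.
- exact: channel_op_functional.
- exact: Rintegral_functional (kdensity_integrable a).
- by move=> U mU; rewrite channel_op_indic// Rintegral_indicM.
Qed.

End density_channel.

Section gaussian_channel.
Context (R : realType).
Local Notation mu := (@lebesgue_measure R).
Local Notation N01 := (normal_prob (0 : R) 1).

Lemma normal_pdf01 s : normal_pdf (0 : R) 1 s = gauss_density 1 s.
Proof.
by have := normal_pdf_gauss (0 : R) s ltr01; rewrite sqrtr1 subr0.
Qed.

Lemma measurable_gauss1 : measurable_fun setT (gauss_density (1 : R)).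
Proof. exact: measurable_gauss_density. Qed.

(** By uniqueness, the Radon-Nikodym derivative of N(0,1) with respect to Lebesgue measure is almost
    everywhere the explicit density; the rest is change of variables. *)
Lemma ge0_integral_normal01 (f : R -> R) : measurable_fun setT f ->
  (forall s, 0 <= f s) ->
  (\int[N01]_s (f s)%:E = \int[mu]_s (f s * gauss_density 1 s)%:E)%E.
Proof.
move=> mf f0; have dom := @normal_prob_dominates R 0 1.
have fE0 s : (0 <= (f s)%:E)%E by rewrite lee_fin.
have mfE : measurable_fun setT (EFin \o f) by exact/measurable_EFinP.
rewrite -(Radon_Nikodym_SigmaFinite.change_of_variables dom fE0 measurableT mfE).
have iRN := Radon_Nikodym_SigmaFinite.f_integrable dom.
have RN : ae_eq mu setT (Radon_Nikodym_SigmaFinite.f N01 mu)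
    (EFin \o gauss_density 1).
  apply: integral_ae_eq => //.
  - by apply/measurable_EFinP; exact: measurable_gauss1.
  - move=> E _ mE; rewrite -Radon_Nikodym_SigmaFinite.f_integral//.
    by apply: eq_integral => s _; rewrite normal_pdf01.
apply: ae_eq_integral => //.
- apply: emeasurable_funM; first exact/measurable_EFinP.
  exact: measurable_int iRN.
- by apply/measurable_EFinP; apply: measurable_funM => //; exact: measurable_gauss1.
- by apply: filterS RN => s h _; rewrite h// EFinM.
Qed.

Lemma Rintegral_normal01 (f : R -> R) : measurable_fun setT f ->
  Rintegrable mu (fun s => f s * gauss_density 1 s) ->
  Rintegrable N01 f /\ \int[N01]_s f s = \int[mu]_s (f s * gauss_density 1 s).
Proof.
move=> mf fi.
have mnf : measurable_fun setT (fun s => `|f s|) by exact: measurableT_comp.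
have fni : Rintegrable mu (fun s => `|f s| * gauss_density 1 s).
  apply: (@Rintegrable_le _ _ _ mu _ (fun s => `|f s * gauss_density 1 s|)).
  - by apply: measurable_funM => //; exact: measurable_gauss1.
  - by move=> s; rewrite !normrM normr_id.
  - exact: Rintegrable_normr.
have iN : Rintegrable N01 (fun s => `|f s|).
  apply/integrableP; split; first exact/measurable_EFinP.
  under eq_integral do rewrite /= normr_id.
  by rewrite ge0_integral_normal01// (Rintegral_EFin fni) ltry.
have ifN : Rintegrable N01 f by apply: (@Rintegrable_le _ _ _ N01 _ (fun s => `|f s|)).
split => //.
have pos (g : R -> R) : measurable_fun setT g -> (forall s, 0 <= g s) ->
    \int[N01]_s g s = \int[mu]_s (g s * gauss_density 1 s).
  by move=> mg g0; rewrite /Rintegral ge0_integral_normal01.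
(* Both [f + |f|] and [|f|] are nonnegative, and their difference is [f]. *)
have E : \int[N01]_s (f s + `|f s|) = \int[mu]_s (f s * gauss_density 1 s) +
    \int[mu]_s (`|f s| * gauss_density 1 s).
  rewrite pos.
  - by rewrite -(RintegralTD fi fni); apply: eq_RintegralT => s; rewrite mulrDl.
  - exact: measurable_funD.
  - by move=> s; have := ler_norm (- f s); rewrite normrN; lra.
have h := RintegralTD ifN iN; rewrite E (pos _ mnf (fun s => normr_ge0 _)) in h.
exact: (esym (addIr _ h)).
Qed.

Lemma channel_op_std_gaussian (g : R -> R) : bounded_measurable g ->
  channel_op (std_gaussian R) g tt = \int[mu]_s (g s * gauss_density 1 s).
Proof.
move=> bg; have [mg _] := bg; have [i0 _ _ _] := gauss1_moments R.
by have [_ <-] := Rintegral_normal01 mg (Rintegrable_boundedM i0 bg).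
Qed.

Lemma normal01_moments (a b d : R) :
  Rintegrable N01 (fun s => a + b * s + d * s ^+ 2) /\
  \int[N01]_s (a + b * s + d * s ^+ 2) = a + d.
Proof.
have [i0 e0 i2 e2] := gauss1_moments R.
have [i1 e1] := gauss_density_mean (0 : R) ltr01.
have E : (fun s : R => s * gauss_density 1 (s - 0)) = fun s => s * gauss_density 1 s.
  by apply/funext => s; rewrite subr0.
rewrite E in i1 e1.
have EE : (fun s => (a + b * s + d * s ^+ 2) * gauss_density 1 s) =
   fun s => (a * gauss_density 1 s + b * (s * gauss_density 1 s)) +
     d * (s ^+ 2 * gauss_density 1 s).
  by apply/funext => s; ring.
have ja := RintegrableZ a i0; have jb := RintegrableZ b i1.
have jd := RintegrableZ d i2.
have jE : Rintegrable mu (fun s => (a + b * s + d * s ^+ 2) * gauss_density 1 s).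
  by rewrite EE; apply: RintegrableD => //; exact: RintegrableD.
have m : measurable_fun setT (fun s : R => a + b * s + d * s ^+ 2).
  apply: measurable_funD; last by apply: measurable_funM => //; exact: exprn_measurable.
  by apply: measurable_funD => //; exact: measurable_funM.
have [h1 h2] := Rintegral_normal01 m jE; split => //; rewrite h2 EE.
rewrite RintegralTD//; last exact: RintegrableD.
by rewrite RintegralTD// !RintegralTZ// e0 e1 e2; ring.
Qed.

(** A tangent vector has to be presented by two channels, so the shift needs two probability
    densities whose difference is linear in [s]. The square ensures positivity, and [1 + b ^+ 2] is
    its integral against N(0,1). *)
Definition shift_density (b : R) (z : one_point R * real_line R) : R :=
  (1 + b * z.2) ^+ 2 / (1 + b ^+ 2).

Let shift_measurable b : measurable_fun setT (shift_density b).
Proof.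
apply: measurable_funM => //; apply: measurable_funX; apply: measurable_funD => //.
by apply: measurable_funM => //; exact: measurable_snd.
Qed.

Let shift_ge0 b z : 0 <= shift_density b z.
Proof. by rewrite divr_ge0 ?sqr_ge0// addr_ge0 ?sqr_ge0. Qed.

Let shift_moments (b : R) a : Rintegrable (std_gaussian R a) (fun s => shift_density b (a, s)) /\
  \int[std_gaussian R a]_s (shift_density b (a, s)) = 1.
Proof.
have b0 : 1 + b ^+ 2 != 0 by rewrite gt_eqF// ltr_wpDr ?sqr_ge0.
have [h1 h2] := normal01_moments ((1 + b ^+ 2)^-1) (2 * b / (1 + b ^+ 2))
  (b ^+ 2 / (1 + b ^+ 2)).
have E : (fun s => shift_density b (a, s)) = fun s => (1 + b ^+ 2)^-1 +
    2 * b / (1 + b ^+ 2) * s + b ^+ 2 / (1 + b ^+ 2) * s ^+ 2.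
  by apply/funext => s; rewrite /shift_density /=; field.
rewrite E; split; first exact: h1.
by apply: etrans h2 _; field.
Qed.

Let shift_norm b a : (\int[std_gaussian R a]_s (shift_density b (a, s))%:E = 1)%E.
Proof. by have [h1 h2] := shift_moments b a; rewrite (Rintegral_EFin h1) h2. Qed.

(* The densities [(1 + s)^2 / 2] and [(1 - s)^2 / 2] with respect to N(0,1)
   differ by [2 s]. *)
Definition gaussian_shift : tangent (one_point R) (real_line R) :=
  Tangent (1 / 2)
    (density_channel (@shift_measurable 1) (@shift_ge0 1) (@shift_norm 1))
    (density_channel (@shift_measurable (-1)) (@shift_ge0 (-1)) (@shift_norm (-1))).

Lemma tangent_op_gaussian_shift (g : R -> R) x : bounded_measurable g ->
  tangent_op gaussian_shift g x = \int[N01]_s (g s * s).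
Proof.
move=> bg; rewrite /tangent_op /= !channel_op_density//.
have [i1 _] := shift_moments 1 x; have [i2 _] := shift_moments (-1) x.
have j1 := Rintegrable_boundedM i1 bg; have j2 := Rintegrable_boundedM i2 bg.
rewrite -(RintegralTB j1 j2) -RintegralTZ; last exact: RintegrableB j1 j2.
by apply: eq_RintegralT => s; rewrite /shift_density /=; field.
Qed.

Lemma Rintegrable_id_gauss : Rintegrable mu (fun s => s * gauss_density 1 s).
Proof.
have [i1 e1] := gauss_density_mean (0 : R) ltr01.
by apply: eq_integrable i1 => // s _ /=; rewrite subr0.
Qed.

Lemma tangent_op_gaussian_shift_density (g : R -> R) x : bounded_measurable g ->
  tangent_op gaussian_shift g x = \int[mu]_s (g s * (s * gauss_density 1 s)).
Proof.
move=> bg; have [mg _] := bg; rewrite tangent_op_gaussian_shift//.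
have E : (fun s => g s * s * gauss_density 1 s) =
    fun s => g s * (s * gauss_density 1 s).
  by apply/funext => s; rewrite mulrA.
have m : measurable_fun setT (fun s : R => g s * s) by exact: measurable_funM.
have [|_ ->] := Rintegral_normal01 m.
  by rewrite E; apply: Rintegrable_boundedM => //; exact: Rintegrable_id_gauss.
by rewrite E.
Qed.

Lemma gaussian_shift_is_shift : is_gaussian_shift gaussian_shift.
Proof.
move=> U mU; rewrite -tangent_op_indic//.
have bU : bounded_measurable (\1_U : R -> R) by exact: bounded_measurable_indic.
rewrite tangent_op_gaussian_shift_density//.
have i1 : Rintegrable mu (fun s => \1_U s * (s * gauss_density 1 s)).
  exact: (Rintegrable_boundedM Rintegrable_id_gauss bU).
rewrite -(Rintegral_EFin i1) [RHS]integral_mkcond; apply: eq_integral => s _.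
by rewrite patchE indicE normal_pdf01; case: ifP; rewrite ?mul1r ?mul0r.
Qed.

(** Makes N(0,1), with [k] times the shift, itself an admissible target of the simulation, as the
    lower bound requires. *)
Lemma gaussian_score_data (k : R) :
  exists M, score_data (std_gaussian R) (tscale k gaussian_shift)
    (fun _ s => k * s) (fun=> k ^+ 2) (k ^+ 2) M.
Proof.
have m4 : measurable_fun setT (fun s : R => (k * s) ^+ 4).
  by apply: measurable_funX; exact: measurable_funM.
have i4 : Rintegrable N01 (fun s => (k * s) ^+ 4).
  have j4 : Rintegrable mu (fun s => (k * s) ^+ 4 * gauss_density 1 s).
    have := RintegrableZ (k ^+ 4) (gauss_density_pow4_integrable R).
    by apply: eq_integrable => // s _ /=; rewrite exprMn mulrA.
  by have [] := Rintegral_normal01 m4 j4.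
exists (\int[N01]_s ((k * s) ^+ 4)); split.
- by apply: measurable_funM => //; exact: measurable_snd.
- exact: measurable_cst.
- by move=> x.
- by move=> x.
- move=> x; have [_] := normal01_moments 0 k 0; rewrite addr0 => h.
  by apply: etrans h; apply: eq_RintegralT => s; ring.
- move=> x; have [_] := normal01_moments 0 0 (k ^+ 2); rewrite add0r => h.
  by apply: etrans h; apply: eq_RintegralT => s; ring.
- by [].
- move=> x g bg; rewrite tangent_op_tscale tangent_op_gaussian_shift//.
  have [i1 _] := normal01_moments 0 1 0.
  have j1 : Rintegrable N01 (fun s => s).
    by apply: eq_integrable i1 => // s _ /=; rewrite mul0r addr0 add0r mul1r.
  rewrite -RintegralTZ; last exact: Rintegrable_boundedM.
  by apply: eq_RintegralT => s; ring.
Qed.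

Lemma gaussian_shift_score_bound : score_bound (std_gaussian R) gaussian_shift 1.
Proof.
split=> // x g bg; rewrite tangent_op_gaussian_shift//.
have [i1 e1] := normal01_moments 0 0 1.
have E : (fun s : R => 0 + 0 * s + 1 * s ^+ 2) = fun s => s ^+ 2.
  by apply/funext => s; ring.
rewrite E add0r in i1 e1; rewrite -[X in X * _]e1.
have [mg _] := bg.
apply: (cauchy_schwarz (mu := N01)) => //.
by apply: (@channel_bounded R (one_point R) (real_line R) (std_gaussian R) _ tt);
  exact: bounded_measurableX.
Qed.

End gaussian_channel.

(** * Approximate simulation *)

Lemma Rintegral_gt0 d (T : measurableType d) (R : realType) (P : probability T R)
    (f : T -> R) : Rintegrable P f -> (forall x, 0 < f x) -> 0 < \int[P]_x f x.
Proof.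
move=> fi f0; rewrite lt_def RintegralT_ge0 ?andbT => [|x]; last exact: ltW.
apply/eqP => I0.
have mf : measurable_fun setT (EFin \o f) by exact: measurable_int fi.
have : (\int[P]_x `|(f x)%:E| = 0)%E.
  under eq_integral do rewrite /= ger0_norm ?ltW//.
  by rewrite (Rintegral_EFin fi) I0.
move=> /(ae_eq_integral_abs _ measurableT mf)[A [mA PA sA]].
have AT : A = setT.
  apply/seteqP; split => // x _; apply: sA => /= /(_ Logic.I) [] h.
  by have := f0 x; rewrite h ltxx.
have PT : (P A = 1)%E by rewrite AT; exact: probability_setT.
by have /eqP := etrans (esym PT) PA; rewrite onee_eq0.
Qed.

Section simulation.
Context (R : realType) (X Y : mspace R) (Phi : channel X Y) (D : tangent X Y).
Context (L : X -> Y -> R) (J : X -> R) (B M : R).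
Hypothesis sd : score_data Phi D L J B M.
Context (c : R).
Hypothesis c0 : 0 < c.
Hypothesis Bc : B < c ^+ 2.
Local Notation mu := (@lebesgue_measure R).
Local Notation S := (score_sum L).
Local Notation V := (var_sum J).
Local Notation a := (scaling c).
Local Notation k := (smooth_kernel L J c).
Local Notation f := (smooth_density Phi L J c).

Lemma smooth_density_gt0 n (x : space_pow X n) s : 0 < f x s.
Proof.
apply: Rintegral_gt0 => [|y]; first exact: (smooth_kernel_integrable sd c0 Bc).
exact: smooth_kernel_gt0.
Qed.

Lemma measurable_smooth_density n :
  measurable_fun setT (fun z : R * space_pow X n => f z.2 z.1).
Proof.
have [C C0 kC] := smooth_kernel_bounded sd c0 Bc.
pose K : channel (prod_space (real_line R) (space_pow X n)) (space_pow Y n) :=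
  kpullback (channel_pow Phi n) (@measurable_snd _ _ (real_line R) (space_pow X n)).
have bk : bounded_measurable
    (fun z : (R * space_pow X n) * space_pow Y n => k z.1.2 z.1.1 z.2).
  split; first exact: (measurable_smooth_kernel sd c0 Bc).
  by exists C => z; rewrite ger0_norm ?smooth_kernel_ge0// kC.
by have [] := bounded_measurable_channel_op2 K bk.
Qed.

(* [Psi] is the conditional law of [y], given that the smoothed score sum
   is [s]. *)
Definition is_posterior n
    (Psi : channel (prod_space (real_line R) (space_pow X n)) (space_pow Y n)) :=
  forall g s x, bounded_measurable g ->
    channel_op Psi g (s, x) * f x s =
    \int[out_prob (channel_pow Phi n) x]_y (g y * k x s y).

(** Bayes' formula: the density against the n-th power is kernel over marginal. The Gaussian kernel
    is positive everywhere, hence so is the marginal, and the formula holds at every [s] without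
    exceptional set. *)
Lemma posterior_exists n : exists Psi, @is_posterior n Psi.
Proof.
pose A := prod_space (real_line R) (space_pow X n).
pose K : channel A (space_pow Y n) :=
  kpullback (channel_pow Phi n) (@measurable_snd _ _ (real_line R) (space_pow X n)).
pose d (z : A * space_pow Y n) := (f z.1.2 z.1.1)^-1 * k z.1.2 z.1.1 z.2.
have md : measurable_fun setT d.
  apply: measurable_funM; last exact: (measurable_smooth_kernel sd c0 Bc).
  apply: measurable_funV_gt0; last by move=> z; exact: smooth_density_gt0.
  have m := @measurable_smooth_density n.
  exact: (measurableT_comp m measurable_fst).
have d0 z : 0 <= d z.
  by rewrite mulr_ge0 ?smooth_kernel_ge0// invr_ge0 ltW// smooth_density_gt0.
have di (z : A) : Rintegrable (K z) (fun y => d (z, y)).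
  have h := RintegrableZ (f z.2 z.1)^-1 (smooth_kernel_integrable sd c0 Bc z.2 z.1).
  exact h.
have d1 z : (\int[K z]_y (d (z, y))%:E = 1)%E.
  rewrite (Rintegral_EFin (di z)); congr EFin.
  have h := RintegralTZ (f z.2 z.1)^-1 (smooth_kernel_integrable sd c0 Bc z.2 z.1).
  refine (etrans h _).
  by rewrite mulVf// gt_eqF// smooth_density_gt0.
exists (density_channel md d0 d1) => g s x bg.
rewrite channel_op_density// mulrC -RintegralTZ; last first.
  exact: Rintegrable_boundedM (di (s, x)) bg.
apply: eq_RintegralT => y; rewrite /d /=.
by field; rewrite gt_eqF// smooth_density_gt0.
Qed.

Let diff_bound n (x : space_pow X n) (G h : R -> R) e :
  (forall s, `|G s| <= 1) -> (forall s, `|h s| <= 1 + `|s|) ->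
  measurable_fun setT G -> measurable_fun setT h ->
  Rintegrable mu (fun s => (1 + `|s|) * (f x s - gauss_density 1 s)) ->
  \int[mu]_s `|(1 + `|s|) * (f x s - gauss_density 1 s)| <= e ->
  Rintegrable mu (fun s => G s * (h s * f x s)) ->
  Rintegrable mu (fun s => G s * (h s * gauss_density 1 s)) ->
  `|\int[mu]_s (G s * (h s * gauss_density 1 s)) -
    \int[mu]_s (G s * (h s * f x s))| <= e.
Proof.
move=> G1 h1 mG mh iw we i1 i2; rewrite distrC -RintegralTB//.
apply: le_trans we; apply: normr_Rintegral_le.
- exact: RintegrableB.
- exact: Rintegrable_normr.
- move=> s; rewrite (_ : _ - _ = G s * (h s * (f x s - gauss_density 1 s))); last by ring.
  rewrite !normrM mulrA ler_wpM2r// [`|1 + _|]ger0_norm ?addr_ge0//.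
  by rewrite -[leRHS]mul1r ler_pM.
Qed.

(** If [s] had the smoothed law instead of N(0,1), the simulation would be exact: averaging the
    conditional law returns the n-th power, and with the weight [s] it returns [a n] times the n-th
    tangent, since the mean of [s] given [y] is [a n * S x y]. Both errors thus come from exchanging
    the two laws, against the weights 1 and [s]. *)
Lemma posterior_estimates (e : R) : 0 < e ->
  exists2 N, (0 < N)%N & forall n
    (Psi : channel (prod_space (real_line R) (space_pow X n)) (space_pow Y n)),
  (N <= n)%N -> is_posterior Psi ->
  forall x g, bounded_measurable g -> (forall y, `|g y| <= 1) ->
    `|\int[mu]_s (channel_op Psi g (s, x) * gauss_density 1 s) -
      channel_op (channel_pow Phi n) g x| <= e /\
    `|c * \int[mu]_s (channel_op Psi g (s, x) * (s * gauss_density 1 s)) -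
      (Num.sqrt n%:R)^-1 * tangent_op (tangent_pow Phi D n) g x| <= e.
Proof.
move=> e0; have c1 : 0 < 1 + c by rewrite addr_gt0.
(* Accuracy [e / (1 + c)] is at most [e] both as it stands and after the multiplication by [c] in
   the tangent estimate. *)
have [N N0 cvg] := smooth_density_cvg sd c0 Bc (divr_gt0 e0 c1).
exists N => // n Psi Nn PsiE x g bg g1; have [mg _] := bg.
have [iw we] := cvg n x Nn.
have n0 : (0 < n)%N by exact: leq_trans Nn.
set G := fun s => channel_op Psi g (s, x).
have [mG0 _] : bounded_measurable (channel_op Psi g).
  exact: bounded_measurable_channel_op.
have mG : measurable_fun setT G.
  exact: (measurableT_comp mG0 (measurable_pair2 x)).
have G1 s : `|G s| <= 1.
  by apply: channel_op_normr_le => //; exact: channel_bounded.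
have bG : bounded_measurable G by split => //; exists 1.
set Q := out_prob (channel_pow Phi n) x.
have kE (y : space_pow Y n) := smooth_kernel_moments sd c0 Bc x y.
have [i0 _ _ _] := gauss1_moments R.
have ig1 := Rintegrable_id_gauss R.
have [|s y|_ _ j1 e1] := @smooth_fubini _ _ _ _ _ _ _ _ _ sd _ c0 Bc n x
    (fun z => g z.2) 1.
- exact: measurableT_comp.
- by rewrite mul1r (le_trans (g1 _))// -addrA lerDl addr_ge0 ?sqr_ge0.
have [|s y|h2 _ j2 e2] := @smooth_fubini _ _ _ _ _ _ _ _ _ sd _ c0 Bc n x
    (fun z => g z.2 * z.1) 1.
- by apply: measurable_funM; [exact: measurableT_comp|exact: measurable_fst].
- rewrite mul1r normrM (@le_trans _ _ `|s|) ?ler_piMl//.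
  by rewrite (le_trans (le_normr_1Dsqr s))// lerDl sqr_ge0.
have kI s := smooth_kernel_integrable sd c0 Bc x s.
have E1 s : \int[Q]_y (g y * k x s y) = G s * (1 * f x s).
  by rewrite mul1r -PsiE.
have E2 s : \int[Q]_y (g y * s * k x s y) = G s * (s * f x s).
  rewrite mulrCA /G PsiE// -RintegralTZ; last exact: Rintegrable_boundedM.
  by apply: eq_RintegralT => y; ring.
have J1 : Rintegrable mu (fun s => G s * (1 * f x s)).
  by apply: eq_integrable j1 => // s _; congr EFin; exact: E1.
have J2 : Rintegrable mu (fun s => G s * (s * f x s)).
  by apply: eq_integrable j2 => // s _; congr EFin; exact: E2.
have F1 : \int[mu]_s (G s * (1 * f x s)) = channel_op (channel_pow Phi n) g x.
  transitivity (\int[mu]_s \int[Q]_y (g y * k x s y)).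
    by apply: eq_RintegralT => s; rewrite E1.
  apply: etrans e1 _; apply: eq_RintegralT => y /=.
  have [k0 k1 _ _] := kE y.
  by rewrite -[RHS]mulr1 -[in RHS]k1 -[RHS](RintegralTZ _ k0).
have F2 : \int[mu]_s (G s * (s * f x s)) =
    a n * tangent_op (tangent_pow Phi D n) g x.
  transitivity (\int[mu]_s \int[Q]_y (g y * s * k x s y)).
    by apply: eq_RintegralT => s; rewrite E2.
  apply: etrans e2 _; rewrite (tangent_op_pow sd x bg) -RintegralTZ; last first.
    by apply: Rintegrable_boundedM => //; exact: (score_sum_integrable sd x).
  apply: eq_RintegralT => y /=.
  have [_ _ [k1 m1] _] := kE y.
  rewrite mulrCA -m1 -[RHS](RintegralTZ _ k1).
  by apply: eq_RintegralT => s; rewrite mulrA.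
have ec : e / (1 + c) <= e by rewrite ler_pdivrMr// ler_peMr ?lerDl// ltW.
have cec : c * (e / (1 + c)) <= e.
  rewrite mulrA ler_pdivrMr// mulrC ler_pM2l//.
  by rewrite lerDr.
split.
- apply: le_trans ec; rewrite -F1.
  have := @diff_bound n x G (fun=> 1) _ G1 _ mG (measurable_cst _) iw we J1.
  have -> : \int[mu]_s (G s * gauss_density 1 s) =
      \int[mu]_s (G s * (1 * gauss_density 1 s)).
    by apply: eq_RintegralT => s; rewrite mul1r.
  apply; first by move=> s; rewrite normr1 lerDl.
  apply: Rintegrable_boundedM bG.
  by apply: eq_integrable i0 => // s _ /=; rewrite mul1r.
- apply: le_trans cec.
  have -> : (Num.sqrt n%:R)^-1 * tangent_op (tangent_pow Phi D n) g x =
      c * (a n * tangent_op (tangent_pow Phi D n) g x).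
    rewrite mulrA; congr (_ * _); rewrite /scaling.
    have r0 : 0 < Num.sqrt (n%:R : R) by rewrite sqrtr_gt0 ltr0n.
    by field; rewrite !gt_eqF.
  rewrite -F2 -mulrBr normrM ger0_norm ?(ltW c0)// ler_pM2l//.
  apply: (@diff_bound n x G id _ G1 _ mG _ iw we J2) => //.
    by move=> s; rewrite lerDr.
  exact: Rintegrable_boundedM bG.
Qed.

(* [Xi] sends [y] to its smoothed score sum. *)
Definition is_smoothed_score n (x : space_pow X n)
    (Xi : channel (space_pow Y n) (real_line R)) :=
  forall g y, bounded_measurable g ->
    channel_op Xi g y = \int[mu]_s (g s * k x s y).

(** Densities of channels are taken against a channel, here the constant N(0,1), so the Gaussian
    kernel is divided by the standard density. *)
Lemma smoothed_score_exists n (x : space_pow X n) :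
  exists Xi, is_smoothed_score x Xi.
Proof.
pose K : channel (space_pow Y n) (real_line R) :=
  @channel_const R (space_pow Y n) (real_line R) (normal_prob 0 1).
pose d (z : space_pow Y n * real_line R) := (gauss_density 1 z.2)^-1 * k x z.2 z.1.
have md : measurable_fun setT d.
  apply: measurable_funM.
    apply: measurable_funV_gt0; last by move=> z; exact: gauss_density_gt0.
    by apply: measurable_gauss_density => //; exact: measurable_snd.
  have m := measurable_smooth_kernel2 sd c0 Bc x.
  have ms : measurable_fun [set: space_pow Y n * real_line R] (fun z => (z.2, z.1)).
    exact: measurable_fun_pair.
  exact: (measurableT_comp m ms).
have d0 z : 0 <= d z.
  by rewrite mulr_ge0 ?smooth_kernel_ge0// invr_ge0 gauss_density_ge0.
have E (g : R -> R) y : (fun s => g s * d (y, s) * gauss_density 1 s) =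
    fun s => g s * k x s y.
  by apply/funext => s; rewrite /d /=; field; rewrite gt_eqF// gauss_density_gt0.
have mdy y : measurable_fun setT (fun s => d (y, s)).
  exact: (measurableT_comp md (measurable_pair1 y)).
have op (g : R -> R) y : bounded_measurable g ->
    Rintegrable (normal_prob 0 1) (fun s => g s * d (y, s)) /\
    \int[normal_prob 0 1]_s (g s * d (y, s)) = \int[mu]_s (g s * k x s y).
  move=> bg; rewrite -E; apply: Rintegral_normal01.
    by apply: measurable_funM; [case: bg|exact: mdy].
  rewrite E; apply: Rintegrable_boundedM => //.
  by have [] := smooth_kernel_moments sd c0 Bc x y.
have d1 y : (\int[K y]_s (d (y, s))%:E = 1)%E.
  have [h1 h2] := op _ y (bounded_measurable_cst _ (1 : R)).
  have [_ k1 _ _] := smooth_kernel_moments sd c0 Bc x y.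
  have E1 : (fun s => 1 * d (y, s)) = fun s => d (y, s).
    by apply/funext => s; rewrite mul1r.
  rewrite E1 in h1 h2; rewrite (Rintegral_EFin h1) h2; congr EFin.
  by rewrite -[RHS]k1; apply: eq_RintegralT => s; rewrite mul1r.
exists (density_channel md d0 d1) => g y bg; rewrite channel_op_density//.
by have [_] := op g y bg.
Qed.

(** Smoothing sends [a n] times the n-th tangent to the measure of density [smooth_tangent], which
    is close to [a n ^+ 2 * V x] times the shift; the factor [c] appears because
    [1 / sqrt n = c * a n]. *)
Lemma smoothed_score_estimates (e : R) : 0 < e ->
  exists2 N, (0 < N)%N & forall n (x : space_pow X n) Xi, (N <= n)%N ->
  is_smoothed_score x Xi ->
  forall g, bounded_measurable g -> (forall s, `|g s| <= 1) ->
    `|channel_op (channel_pow Phi n) (channel_op Xi g) x -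
      \int[mu]_s (g s * gauss_density 1 s)| <= e /\
    `|(Num.sqrt n%:R)^-1 * tangent_op (tangent_pow Phi D n) (channel_op Xi g) x -
      c * (a n ^+ 2 * V x) * \int[mu]_s (g s * (s * gauss_density 1 s))| <= e.
Proof.
move=> e0; have c1 : 0 < 1 + c by rewrite addr_gt0.
have [N N0 cvg] := smooth_density_cvg sd c0 Bc (divr_gt0 e0 c1).
have [N' N'0 cvg'] := smooth_tangent_cvg sd c0 Bc (divr_gt0 e0 c1).
exists (maxn N N'); first by rewrite leq_max N0.
move=> n x Xi; rewrite geq_max => /andP[Nn N'n] XiE g bg g1; have [mg _] := bg.
have [iw we] := cvg n x Nn; have [it te] := cvg' n x N'n.
have n0 : (0 < n)%N by exact: leq_trans Nn.
set Q := out_prob (channel_pow Phi n) x.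
have bT : bounded_measurable (channel_op Xi g).
  exact: bounded_measurable_channel_op.
have [i0 _ _ _] := gauss1_moments R.
have ig1 := Rintegrable_id_gauss R.
have mS : measurable_fun setT (S x) by exact: (measurable_score_sum_section sd x).
have kE (y : space_pow Y n) := smooth_kernel_moments sd c0 Bc x y.
have kI s := smooth_kernel_integrable sd c0 Bc x s.
have a0 : 0 <= a n by exact: scaling_ge0.
have [|s y|_ _ j1 e1] := @smooth_fubini _ _ _ _ _ _ _ _ _ sd _ c0 Bc n x
    (fun z => g z.1) 1.
- exact: measurableT_comp.
- by rewrite mul1r (le_trans (g1 _))// -addrA lerDl addr_ge0 ?sqr_ge0.
have [|s y|h2 _ j2 e2] := @smooth_fubini _ _ _ _ _ _ _ _ _ sd _ c0 Bc n x
    (fun z => g z.1 * (a n * S x z.2)) (a n).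
- apply: measurable_funM; first exact: measurableT_comp.
  by apply: measurable_funM => //; exact: measurableT_comp.
- rewrite /= normrM (@le_trans _ _ `|a n * S x y|) ?ler_piMl//.
  rewrite normrM ger0_norm// ler_wpM2l//.
  by rewrite addrAC (le_trans (le_normr_1Dsqr _))// lerDl sqr_ge0.
have [ik iT] := smooth_tangent_integrable sd c0 Bc x.
have E1 s : \int[Q]_y (g s * k x s y) = g s * (1 * f x s).
  by rewrite RintegralTZ// mul1r.
have E2 s : \int[Q]_y (g s * (a n * S x y) * k x s y) =
    g s * smooth_tangent Phi L J c x s.
  rewrite -(RintegralTZ _ (ik s)); apply: eq_RintegralT => y; ring.
have J1 : Rintegrable mu (fun s => g s * (1 * f x s)).
  by apply: eq_integrable j1 => // s _; congr EFin; exact: E1.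
have J2 : Rintegrable mu (fun s => g s * smooth_tangent Phi L J c x s).
  exact: Rintegrable_boundedM.
have F1 : channel_op (channel_pow Phi n) (channel_op Xi g) x =
    \int[mu]_s (g s * (1 * f x s)).
  apply: etrans (_ : \int[mu]_s \int[Q]_y (g s * k x s y) = _); last first.
    by apply: eq_RintegralT => s; rewrite E1.
  by apply: etrans (esym e1); apply: eq_RintegralT => y; rewrite XiE.
have F2 : a n * tangent_op (tangent_pow Phi D n) (channel_op Xi g) x =
    \int[mu]_s (g s * smooth_tangent Phi L J c x s).
  apply: etrans (_ : \int[mu]_s \int[Q]_y (g s * (a n * S x y) * k x s y) = _); last first.
    by apply: eq_RintegralT => s; rewrite E2.
  apply: etrans (esym e2).
  rewrite (tangent_op_pow sd x bT) -RintegralTZ; last first.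
    by apply: Rintegrable_boundedM => //; exact: (score_sum_integrable sd x).
  apply: eq_RintegralT => y /=.
  have [k0 _ _ _] := kE y.
  rewrite XiE// mulrCA mulrC.
  rewrite -[LHS](RintegralTZ _ (Rintegrable_boundedM k0 bg)).
  by apply: eq_RintegralT => s; ring.
have ec : e / (1 + c) <= e by rewrite ler_pdivrMr// ler_peMr ?lerDl// ltW.
have cec : c * (e / (1 + c)) <= e.
  rewrite mulrA ler_pdivrMr// mulrC ler_pM2l//.
  by rewrite lerDr.
split.
- apply: le_trans ec; rewrite F1 distrC.
  have := @diff_bound n x g (fun=> 1) _ g1 _ mg (measurable_cst _) iw we J1.
  have -> : \int[mu]_s (g s * gauss_density 1 s) =
      \int[mu]_s (g s * (1 * gauss_density 1 s)).
    by apply: eq_RintegralT => s; rewrite mul1r.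
  apply; first by move=> s; rewrite normr1 lerDl.
  apply: Rintegrable_boundedM bg.
  by apply: eq_integrable i0 => // s _ /=; rewrite mul1r.
- apply: le_trans cec.
  have -> : (Num.sqrt n%:R)^-1 * tangent_op (tangent_pow Phi D n) (channel_op Xi g) x =
      c * (a n * tangent_op (tangent_pow Phi D n) (channel_op Xi g) x).
    rewrite mulrA; congr (_ * _); rewrite /scaling.
    have r0 : 0 < Num.sqrt (n%:R : R) by rewrite sqrtr_gt0 ltr0n.
    by field; rewrite !gt_eqF.
  rewrite F2 -mulrA -mulrBr normrM ger0_norm ?(ltW c0)// ler_pM2l//.
  have ig := Rintegrable_boundedM ig1 bg.
  rewrite -(RintegralTZ _ ig) -RintegralTB//; last exact: RintegrableZ.
  apply: le_trans te; apply: normr_Rintegral_le.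
  - by apply: RintegrableB => //; exact: RintegrableZ.
  - exact: Rintegrable_normr.
  - move=> s; rewrite (_ : _ - _ = g s * (smooth_tangent Phi L J c x s -
      a n ^+ 2 * V x * (s * gauss_density 1 s))); last by ring.
    by rewrite normrM ler_piMl.
Qed.

End simulation.

(** * Bounds on the metric *)

Section limits.
Context (R : realType).

Lemma ge0_cvge0 (u : nat -> \bar R) : (forall n, (0 <= u n)%E) ->
  (forall e : R, 0 < e -> exists N, forall n, (N <= n)%N -> (u n <= e%:E)%E) ->
  u n @[n --> \oo] --> 0%E.
Proof.
move=> u0 ue; apply/fine_cvgP; split.
  have [N uN] := ue 1 ltr01; exists N => // n /= Nn.
  by rewrite ge0_fin_numE// (le_lt_trans (uN n Nn))// ltry.
apply/cvgrPdist_le => e e0; have [N uN] := ue e e0; exists N => // n /= Nn.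
have h := uN n Nn; have fn : u n \is a fin_num.
  by rewrite ge0_fin_numE// (le_lt_trans h)// ltry.
rewrite sub0r normrN ger0_norm ?fine_ge0//.
by rewrite -lee_fin fineK.
Qed.

Lemma limn_einf_le0 (u v : nat -> R) l : (0 <= limn_einf (fun n => (u n)%:E))%E ->
  (forall n, u n <= v n) -> v n @[n --> \oo] --> l -> 0 <= l.
Proof.
move=> u0 uv vl.
have vl' : ((v n)%:E)%E @[n --> \oo] --> l%:E by exact/cvg_EFin/vl/nearW.
have [+ _] := cvg_limn_einf_sup vl'; rewrite -lee_fin => <-.
apply: le_trans u0 _; rewrite !limn_einf_lim.
apply: lee_lim; [exact: is_cvg_einfs..|].
apply: nearW => n; apply: le_ereal_inf_tmp => _ [m /= nm <-].
apply: (@le_trans _ _ (u m)%:E); last by rewrite lee_fin.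
by apply: ereal_inf_lbound; exists m.
Qed.

End limits.

Section asymptotic_simulation.
Context (R : realType) (G : metric_fun R).
Hypothesis additiveG : asymptotically_additive G.
Hypothesis continuousG : asymptotically_continuous G.

(** Axiom (C) compares the simulations with the n-fold data, and (A) turns the latter into [G Phi D]
    after division by [n]. The estimates are uniform in the input, and the tangent one carries
    [1 / sqrt n], to match the cb norms in (C). Both bounds on the metric are instances, with the
    Gaussian as resource in one and as target in the other. *)
Lemma metric_le_of_simulation (X Y : mspace R) (Phi : channel X Y)
    (D : tangent X Y) (PhiD : local_data Phi D)
    (Phis : forall n, channel (space_pow X n) (space_pow Y n))
    (Ds : forall n, tangent (space_pow X n) (space_pow Y n))
    (h : nat -> R) (K : R) :
  (forall n, local_data (Phis n) (Ds n)) ->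
  (forall e : R, 0 < e -> exists2 N, (0 < N)%N & forall n, (N <= n)%N ->
    forall x g, bounded_measurable g -> (forall y, `|g y| <= 1) ->
    `|channel_op (Phis n) g x - channel_op (channel_pow Phi n) g x| <= e /\
    `|(Num.sqrt n%:R)^-1 * tangent_op (Ds n) g x -
      (Num.sqrt n%:R)^-1 * tangent_op (tangent_pow Phi D n) g x| <= e) ->
  (forall n, G (Phis n) (Ds n) <= h n) ->
  n%:R^-1 * h n @[n --> \oo] --> K ->
  G Phi D <= K.
Proof.
move=> ld sim Gh hK.
have c1 : cb_norm (channel_diff (Phis n) (channel_pow Phi n)) @[n --> \oo] --> 0%E.
  apply: ge0_cvge0 => [n|e e0]; first exact: cb_norm_ge0.
  have [N N0 simN] := sim e e0; exists N => n Nn.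
  apply: cb_norm_le => x g bg g1; rewrite tangent_op_diff.
  by have [] := simN n Nn x g bg g1.
have c2 : (((Num.sqrt n%:R)^-1)%:E * cb_norm (tsub (Ds n) (tangent_pow Phi D n)))%E
    @[n --> \oo] --> 0%E.
  apply: ge0_cvge0 => [n|e e0].
    by rewrite mule_ge0 ?cb_norm_ge0// lee_fin invr_ge0 sqrtr_ge0.
  have [N N0 simN] := sim e e0; exists N => n Nn.
  have n0 : (0 < n)%N by exact: leq_trans Nn.
  have r0 : 0 < Num.sqrt (n%:R : R) by rewrite sqrtr_gt0 ltr0n.
  rewrite lee_pdivrMl// -EFinM; apply: cb_norm_le => x g bg g1.
  have [_] := simN n Nn x g bg g1.
  rewrite tangent_op_tsub// -mulrBr normrM ger0_norm ?invr_ge0 ?(ltW r0)//.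
  by rewrite ler_pdivrMl.
have lim := continuousG PhiD ld c1 c2.
rewrite -subr_ge0; apply: limn_einf_le0 lim _ (cvgB hK (additiveG PhiD)) => n.
rewrite -[leRHS]mulrBr ler_wpM2l ?invr_ge0//.
by rewrite lerB.
Qed.

End asymptotic_simulation.

(** * Scores on a finite input space *)

Lemma finite_discrete_measurable_section d d1 d2 (X : measurableType d)
    (Y : measurableType d1) (Z : measurableType d2) (f : X * Y -> Z) :
  finite_discrete X -> (forall x, measurable_fun setT (fun y => f (x, y))) ->
  measurable_fun setT f.
Proof.
move=> [finX mX] mf _ A mA; rewrite setTI.
rewrite (_ : f @^-1` A =
    \bigcup_(x in [set: X]) ([set x] `*` ((fun y => f (x, y)) @^-1` A))).
  apply: fin_bigcup_measurable => // x _; apply: measurableX; first exact: mX.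
  by rewrite -[X in measurable X]setTI; exact: mf.
apply/seteqP; split => [[x y] /= Afxy|[x y] /= [x' _ /= [<-]]].
  by exists x.
by [].
Qed.

Section score_data_of_local_data.
Context (R : realType) (X Y : mspace R).

(** Finiteness of the input space gives joint measurability of the score and one bound for all
    fourth moments; the bound on the variances is the value claimed for the metric. *)
Lemma local_data_score_data (finX : finite_discrete X) (Phi : channel X Y)
    (D : tangent X Y) : local_data Phi D ->
  let L x := score (out_prob Phi x) (tangent_map D x) in
  (forall x, (\int[out_prob Phi x]_y (L x y ^+ 4)%:E < +oo)%E) ->
  exists M, score_data Phi D L (fun x => \int[out_prob Phi x]_y (L x y ^+ 2))
    (fine (G_min Phi D)) M.
Proof.
move=> PhiD L L4; have [DPhi Gmin] := PhiD.
have mL x : measurable_fun setT (L x) by exact: score_measurable.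
have i4 x : Rintegrable (out_prob Phi x) (fun y => L x y ^+ 4).
  apply/integrableP; split; first by apply/measurable_EFinP; exact: measurable_funX.
  apply: le_lt_trans (L4 x); apply: ge0_le_integral => //.
  - by apply/measurable_EFinP/measurableT_comp => //; exact: measurable_funX.
  - by apply/measurable_EFinP; exact: measurable_funX.
  - by move=> w _ /=; rewrite ger0_norm ?exprn_even_ge0.
have [M M4] : exists M, forall x, \int[out_prob Phi x]_y (L x y ^+ 4) <= M.
  have /finite_seqP[s sE] := finX.1.
  exists (\sum_(z <- s) \int[out_prob Phi z]_y (L z y ^+ 4)) => x.
  have xs : x \in s.
    by have : [set: X] x by []; rewrite sE.
  rewrite (perm_big _ (perm_to_rem xs)) big_cons lerDl sumr_ge0// => z _.
  by apply: RintegralT_ge0 => y; rewrite exprn_even_ge0.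
have G0 := G_min_ge0 Phi D.
have Gfin : G_min Phi D \is a fin_num by rewrite ge0_fin_numE.
exists M; split => //.
- exact: (finite_discrete_measurable_section (f := fun z : X * Y => L z.1 z.2) finX mL).
- by move=> _ A _; rewrite setTI; exact: finX.2.
(* A tangent vector has total mass 0: test it on the constant 1. *)
- move=> x; have := tangent_op_score (DPhi x) (bounded_measurable_cst _ (1 : R)).
  rewrite {1}/tangent_op !channel_op_cst subrr mulr0 => h.
  by rewrite [RHS]h; apply: eq_RintegralT => y; rewrite mul1r.
- move=> x; rewrite -lee_fin (fineK Gfin).
  apply: le_trans _ (fisher_le_G_min Phi D x).
  rewrite (fisher_score (DPhi x)) (Rintegral_EFin (score2_integrable x PhiD)).
  exact: lexx.
- by move=> x g bg; exact: tangent_op_score.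
Qed.

End score_data_of_local_data.

(** * Upper bound: the Gaussian shift as a resource *)

Section upper_bound.
Context (R : realType) (G : metric_fun R).
Hypothesis metricG : is_metric G.

Lemma metric_tscale (X Y : mspace R) (Phi : channel X Y) (D : tangent X Y) k :
  local_data Phi D -> local_data Phi (tscale k D) ->
  G Phi (tscale k D) = k ^+ 2 * G Phi D.
Proof.
move=> PhiD PhikD; have := is_metric_scale metricG k PhiD.
move=> /(congr1 (fun r => r ^+ 2)).
rewrite exprMn !sqr_sqrtr ?(is_metric_ge0 metricG)// => ->.
by rewrite -normrX ger0_norm ?sqr_ge0.
Qed.

Hypothesis monotone_preG : monotone_pre G.
Hypothesis monotone_postG : monotone_post G.
Hypothesis tensor_idG : tensor_id_invariant G.
Hypothesis additiveG : asymptotically_additive G.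
Hypothesis continuousG : asymptotically_continuous G.
Hypothesis normalizedG : gaussian_normalized G.

Lemma local_data_gaussian_shift (k : R) :
  local_data (std_gaussian R) (tscale k (gaussian_shift R)).
Proof.
exact: score_bound_local_data (score_bound_tscale k (gaussian_shift_score_bound R)).
Qed.

Lemma metric_gaussian_shift (k : R) :
  G (std_gaussian R) (tscale k (gaussian_shift R)) = k ^+ 2.
Proof.
rewrite metric_tscale; last exact: local_data_gaussian_shift.
  by rewrite (normalizedG (@gaussian_shift_is_shift R)) mulr1.
exact: score_bound_local_data (gaussian_shift_score_bound R).
Qed.

Section simulate.
Context (X Y : mspace R).

(** The Gaussian is a channel from the one-point space, so its tensor product with the identity of
    [X] takes its input from the product of a point with [X]; this map supplies the missing
    coordinate. *)
Definition pair_pt (x : X) : prod_space (one_point R) X := (tt, x).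

Lemma measurable_pair_pt : measurable_fun setT pair_pt.
Proof. exact: (measurable_pair1 tt). Qed.

Definition prepend : channel X (prod_space (one_point R) X) :=
  kdirac measurable_pair_pt.

Definition gauss_channel (Psi : channel (prod_space (real_line R) X) Y)
  : channel X Y :=
  channel_comp Psi (channel_comp
    (channel_tensor (std_gaussian R) (channel_id X)) prepend).

Definition gauss_tangent (k : R) (Psi : channel (prod_space (real_line R) X) Y)
  : tangent X Y :=
  tangent_post Psi (tangent_pre
    (tangent_tensorl (tscale k (gaussian_shift R)) (channel_id X)) prepend).

Context (Psi : channel (prod_space (real_line R) X) Y) (k : R).

Lemma local_data_gauss : local_data (gauss_channel Psi) (gauss_tangent k Psi).
Proof.
apply: score_bound_local_data; apply: score_bound_post; apply: score_bound_pre.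
apply: score_bound_tensorl; apply: score_bound_tscale.
exact: gaussian_shift_score_bound.
Qed.

(** Neither processing by [Psi], nor relabelling the input, nor carrying the input along by an
    identity raises the metric, so only the cost of the scaled shift remains. By (E) this cost is
    the same although [Psi] sees the input. *)
Lemma metric_gauss_le : G (gauss_channel Psi) (gauss_tangent k Psi) <= k ^+ 2.
Proof.
have sb := score_bound_tscale k (gaussian_shift_score_bound R).
have sbt := score_bound_tensorl (channel_id X) sb.
have sbp := score_bound_pre prepend sbt.
apply: le_trans (monotone_postG (score_bound_local_data sbp) Psi) _.
apply: le_trans (monotone_preG (score_bound_local_data sbt) prepend) _.
rewrite (tensor_idG (score_bound_local_data sb)).
by rewrite metric_gaussian_shift.
Qed.

Lemma channel_op_gauss g x : bounded_measurable g ->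
  channel_op (gauss_channel Psi) g x =
  \int[@lebesgue_measure R]_s (channel_op Psi g (s, x) * gauss_density 1 s).
Proof.
move=> bg; have bG : bounded_measurable (channel_op Psi g).
  exact: bounded_measurable_channel_op.
have bS x' : bounded_measurable (fun s => channel_op Psi g (s, x')).
  by apply: bounded_measurable_comp bG; exact: measurable_pair2.
have bT : bounded_measurable
    (channel_op (channel_tensor (std_gaussian R) (channel_id X)) (channel_op Psi g)).
  exact: bounded_measurable_channel_op.
rewrite !channel_op_comp// channel_op_dirac; last by case: bT.
rewrite channel_op_tensor//= -channel_op_std_gaussian//; last exact: bS.
apply: eq_RintegralT => s.
by rewrite channel_op_id//; have [] := bounded_measurable_section s bG.
Qed.

Lemma tangent_op_gauss g x : bounded_measurable g ->
  tangent_op (gauss_tangent k Psi) g x =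
  k * \int[@lebesgue_measure R]_s (channel_op Psi g (s, x) * (s * gauss_density 1 s)).
Proof.
move=> bg; have bG : bounded_measurable (channel_op Psi g).
  exact: bounded_measurable_channel_op.
have bS x' : bounded_measurable (fun s => channel_op Psi g (s, x')).
  by apply: bounded_measurable_comp bG; exact: measurable_pair2.
have bT : bounded_measurable (tangent_op (tangent_tensorl
    (tscale k (gaussian_shift R)) (channel_id X)) (channel_op Psi g)).
  exact: bounded_measurable_tangent_op.
rewrite tangent_op_post// tangent_op_pre// channel_op_dirac; last by case: bT.
rewrite tangent_op_tensorl// tangent_op_tscale; congr (k * _).
rewrite -(tangent_op_gaussian_shift_density tt (bS x)).
congr (tangent_op _ _ _); apply/funext => s.
by rewrite channel_op_id//; have [] := bounded_measurable_section s bG.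
Qed.

End simulate.

Lemma metric_upper (X Y : mspace R) (Phi : channel X Y) (D : tangent X Y)
    (L : X -> Y -> R) (J : X -> R) (B M c : R) : local_data Phi D ->
  score_data Phi D L J B M -> 0 < c -> B < c ^+ 2 -> G Phi D <= c ^+ 2.
Proof.
move=> PhiD sd c0 Bc.
pose Psi n := sval (cid (posterior_exists sd c0 Bc n)).
have PsiE n : is_posterior Phi L J c (Psi n).
  exact: (svalP (cid (posterior_exists sd c0 Bc n))).
apply: (@metric_le_of_simulation _ G additiveG continuousG _ _ _ _ PhiD
  (fun n => gauss_channel (Psi n))
  (fun n => gauss_tangent (c * Num.sqrt n%:R) (Psi n))
  (fun n => (c * Num.sqrt n%:R) ^+ 2)).
- by move=> n; exact: local_data_gauss.
- move=> e e0; have [N N0 est] := posterior_estimates sd c0 Bc e0.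
  exists N => // n Nn x g bg g1; have [e1 e2] := est n (Psi n) Nn (PsiE n) x g bg g1.
  rewrite channel_op_gauss// tangent_op_gauss//; split => //.
  have r0 : 0 < Num.sqrt (n%:R : R) by rewrite sqrtr_gt0 ltr0n (leq_trans N0).
  rewrite [c * _]mulrC -mulrA [X in X - _]mulrA mulVf ?gt_eqF// mul1r.
  exact: e2.
- by move=> n; exact: metric_gauss_le.
(* The normalised cost equals [c ^+ 2] for every [n > 0]; at [n = 0] it is 0. *)
- apply: cvg_near_cst; exists 1 => // n /= n0.
  rewrite exprMn sqr_sqrtr ?ler0n//; field; rewrite pnatr_eq0 -lt0n//.
Qed.

End upper_bound.

(** * Lower bound: the Gaussian shift as a target *)

Section deterministic_input.
Context (R : realType) (W X Y : mspace R) (Phi : channel X Y) (D : tangent X Y).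
Context (f : W -> X) (mf : measurable_fun setT f).

Lemma channel_comp_dirac w A : measurable A ->
  channel_comp Phi (kdirac mf) w A = Phi (f w) A.
Proof.
move=> mA; rewrite /channel_comp /kcomposition /= /kcomp_noparam.
rewrite /kdirac integral_dirac ?diracT ?mul1e//.
exact: measurable_kernel.
Qed.

Lemma integral_comp_dirac w (g : Y -> \bar R) :
  (\int[out_prob (channel_comp Phi (kdirac mf)) w]_y g y =
   \int[out_prob Phi (f w)]_y g y)%E.
Proof. by apply: eq_measure_integral => A mA _; exact: channel_comp_dirac. Qed.

Lemma Rintegral_comp_dirac w (g : Y -> R) :
  \int[out_prob (channel_comp Phi (kdirac mf)) w]_y g y =
  \int[out_prob Phi (f w)]_y g y.
Proof. by congr fine; exact: integral_comp_dirac. Qed.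

Lemma Rintegrable_comp_dirac w (g : Y -> R) : Rintegrable (out_prob Phi (f w)) g ->
  Rintegrable (out_prob (channel_comp Phi (kdirac mf)) w) g.
Proof.
move=> /integrableP[mg ig]; apply/integrableP; split => //.
by rewrite integral_comp_dirac.
Qed.

(** The variance bound may shrink to [B']: at a single input it becomes the variance there, which
    allows [c ^+ 2] close to [J x] even when other inputs have larger variance. *)
Lemma score_data_comp_dirac L J B B' M : score_data Phi D L J B M ->
  (forall w, J (f w) <= B') ->
  score_data (channel_comp Phi (kdirac mf)) (tangent_pre D (kdirac mf))
    (fun w => L (f w)) (fun w => J (f w)) B' M.
Proof.
move=> sd JB'; split => //.
- have mfy : measurable_fun [set: W * Y] (fun z => (f z.1, z.2)).
    by apply: measurable_fun_pair => //; exact: measurableT_comp.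
  exact: (measurableT_comp (sd_measurable sd) mfy).
- exact: (measurableT_comp (sd_var_measurable sd) mf).
- by move=> w; apply: Rintegrable_comp_dirac; exact: (sd_fourth sd (f w)).
- by move=> w; rewrite Rintegral_comp_dirac; exact: sd_fourth_le sd (f w).
- by move=> w; rewrite Rintegral_comp_dirac; exact: sd_mean sd (f w).
- by move=> w; rewrite Rintegral_comp_dirac; exact: sd_var sd (f w).
- move=> w g bg; rewrite Rintegral_comp_dirac tangent_op_pre//.
  have [mg _] := bounded_measurable_tangent_op D bg.
  by rewrite channel_op_dirac//; exact: (sd_op sd).
Qed.

End deterministic_input.

Lemma one_point_pow_eq (R : realType) n (x y : space_pow (one_point R) n) : x = y.
Proof.
elim: n x y => [[] []//|n ih] [[] x] [[] y].
by congr pair; exact: ih.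
Qed.

Lemma var_sum_cst (R : realType) (X : mspace R) (j : R) n (x : space_pow X n) :
  var_sum (fun=> j) x = n%:R * j.
Proof.
by elim: n x => [|n ih] x /=; rewrite ?mul0r// ih -natr1 mulrDl mul1r addrC.
Qed.

Section lower_bound.
Context (R : realType) (G : metric_fun R).
Hypothesis metricG : is_metric G.
Hypothesis monotone_preG : monotone_pre G.
Hypothesis monotone_postG : monotone_post G.
Hypothesis additiveG : asymptotically_additive G.
Hypothesis continuousG : asymptotically_continuous G.
Hypothesis normalizedG : gaussian_normalized G.

Local Notation mu := (@lebesgue_measure R).

(** Smoothing turns the n-fold data into about [j / c * sqrt n] times the shift, which is precisely
    what the conditional-law simulation with constant [j / c] consumes. The margin [j < c ^+ 2]
    leaves noise for the smoothing, and [k < j / c] leaves noise for the simulation. Monotonicity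
    under processing of the output bounds the cost by [G] of the n-fold data. *)
Lemma one_point_lower (Y : mspace R) (P : channel (one_point R) Y)
    (D : tangent (one_point R) Y) (L : one_point R -> Y -> R) (j M k c : R) :
  local_data P D -> score_data P D L (fun=> j) j M ->
  0 < k -> 0 < c -> j < c ^+ 2 -> k < j / c -> k ^+ 2 <= G P D.
Proof.
move=> PD sd k0 c0 jc kc.
have c'0 : 0 < j / c by exact: lt_trans kc.
have kc2 : k ^+ 2 < (j / c) ^+ 2 by rewrite ltrXn2r// ?nnegrE ?(ltW k0) ?(ltW c'0).
have [M' sg] := gaussian_score_data k.
pose pt n : space_pow (one_point R) n := point.
pose Xi n := sval (cid (smoothed_score_exists sd c0 jc (pt n))).
have XiE n : is_smoothed_score L (fun=> j) c (pt n) (Xi n).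
  exact: (svalP (cid (smoothed_score_exists sd c0 jc (pt n)))).
pose Psi n := sval (cid (posterior_exists sg c'0 kc2 n)).
have PsiE n : is_posterior (std_gaussian R) (fun _ s => k * s) (fun=> k ^+ 2) (j / c) (Psi n).
  exact: (svalP (cid (posterior_exists sg c'0 kc2 n))).
have mpt n : measurable_fun [set: real_line R]
    (fun s => (s, pt n) : prod_space (real_line R) (space_pow (one_point R) n)).
  exact: (measurable_pair2 (pt n)).
pose Sim n : channel (space_pow Y n) (space_pow (real_line R) n) :=
  channel_comp (channel_comp (Psi n) (kdirac (mpt n))) (Xi n).
rewrite -(metric_gaussian_shift metricG normalizedG k).
apply: (@metric_le_of_simulation _ G additiveG continuousG _ _ _ _
  (local_data_gaussian_shift k)
  (fun n => channel_comp (Sim n) (channel_pow P n))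
  (fun n => tangent_post (Sim n) (tangent_pow P D n))
  (fun n => G (channel_pow P n) (tangent_pow P D n))).
- move=> n; have [C sb] := score_bound_pow n (local_data_score_bound PD).
  exact: score_bound_local_data (score_bound_post (Sim n) sb).
- move=> e e0; have e20 : 0 < e / 2 by rewrite divr_gt0.
  have [N N0 est] := smoothed_score_estimates sd c0 jc e20.
  have [N' N'0 est'] := posterior_estimates sg c'0 kc2 e20.
  exists (maxn N N'); first by rewrite leq_max N0.
  move=> n; rewrite geq_max => /andP[Nn N'n] x g bg g1.
  rewrite (one_point_pow_eq x (pt n)) => {x}.
  have n0 : (0 < n)%N by exact: leq_trans Nn.
  have bPsi : bounded_measurable (channel_op (Psi n) g).
    exact: bounded_measurable_channel_op.
  pose h s := channel_op (Psi n) g (s, pt n).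
  have bh : bounded_measurable h.
    by apply: bounded_measurable_comp bPsi; exact: mpt.
  have h1 s : `|h s| <= 1.
    by apply: channel_op_normr_le => //; exact: channel_bounded.
  have bS : bounded_measurable (channel_op (Sim n) g).
    exact: bounded_measurable_channel_op.
  have SimE : channel_op (Sim n) g = channel_op (Xi n) h.
    apply/funext => y; rewrite channel_op_comp//; congr (channel_op _ _ y).
    apply/funext => s; rewrite channel_op_comp// channel_op_dirac//.
    by case: bPsi.
  rewrite channel_op_comp// tangent_op_post// SimE.
  have [e1 e2] := est n (pt n) (Xi n) Nn (XiE n) h bh h1.
  have [e3 e4] := est' n (Psi n) N'n (PsiE n) (pt n) g bg g1.
  rewrite [e in _ <= e]splitr [e in _ /\ _ <= e]splitr.
  split; first exact: le_trans (ler_distD _ _ _) (lerD e1 e3).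
  apply: le_trans (ler_distD _ _ _) (lerD e2 _).
  (* All letters have variance [j], so the coefficient of the shift is
     [c * scaling c n ^+ 2 * (n * j)]. *)
  rewrite var_sum_cst (_ : c * _ = j / c)//.
  rewrite [_ * (n%:R * j)]mulrA [_ * n%:R]mulrC scaling_sqr//.
  by field; rewrite gt_eqF.
- move=> n; have [C sb] := score_bound_pow n (local_data_score_bound PD).
  exact: monotone_postG (score_bound_local_data sb) _ (Sim n).
- exact: additiveG.
Qed.

(** If [q = sqrt G] were below [r = sqrt (J x)], there would be [k] with [q < k < r] and [c] with
    [r < c < r ^+ 2 / k]; these meet both margins of [one_point_lower] and yield [k <= q]. *)
Lemma metric_lower (X Y : mspace R) (Phi : channel X Y) (D : tangent X Y)
    (L : X -> Y -> R) (J : X -> R) (B M : R) x : local_data Phi D ->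
  score_data Phi D L J B M -> J x <= G Phi D.
Proof.
move=> PhiD sd; have G0 := is_metric_ge0 metricG PhiD.
rewrite leNgt; apply/negP => GJ.
have J0 : 0 < J x by exact: le_lt_trans GJ.
set q := Num.sqrt (G Phi D); set r := Num.sqrt (J x).
have q0 : 0 <= q by exact: sqrtr_ge0.
have r0 : 0 < r by rewrite sqrtr_gt0.
have qE : q ^+ 2 = G Phi D by rewrite sqr_sqrtr.
have rE : r ^+ 2 = J x by rewrite sqr_sqrtr// ltW.
have qr : q < r by rewrite ltr_sqrt.
have [k qk kr] : exists2 k, q < k & k < r by exists ((q + r) / 2); lra.
have k0 : 0 < k by exact: le_lt_trans qk.
have rk : r < r ^+ 2 / k by rewrite ltr_pdivlMr// expr2 ltr_pM2l.
have [c rc ck] : exists2 c, r < c & c < r ^+ 2 / k.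
  by exists ((r + r ^+ 2 / k) / 2); lra.
have c0 : 0 < c by exact: lt_trans rc.
have mx : measurable_fun [set: one_point R] (fun=> x) by exact: measurable_cst.
have sd' := score_data_comp_dirac mx sd (fun=> lexx (J x)).
have sb := score_bound_pre (kdirac mx : channel _ _) (local_data_score_bound PhiD).
suff : k ^+ 2 <= G Phi D by rewrite -qE leNgt ltrXn2r ?nnegrE ?(ltW k0).
apply: le_trans (monotone_preG PhiD (kdirac mx : channel _ _)).
apply: (one_point_lower (score_bound_local_data sb) sd' k0 c0).
  by rewrite -rE ltrXn2r ?nnegrE ?(ltW r0) ?(ltW c0).
by rewrite -rE ltr_pdivlMr// mulrC -ltr_pdivlMr.
Qed.

End lower_bound.

Local Open Scope ereal_scope.

Theorem theorem18 (R : realType) (G : metric_fun R)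
    (metricG : is_metric G)
    (monotone_preG : monotone_pre G)
    (monotone_postG : monotone_post G)
    (tensor_idG : tensor_id_invariant G)
    (additiveG : asymptotically_additive G)
    (continuousG : asymptotically_continuous G)
    (normalizedG : gaussian_normalized G)
    (X Y : mspace R) (finX : finite_discrete X)
    (Phi : channel X Y) (D : tangent X Y) (PhiD : local_data Phi D)
    (score_moment : forall x : X,
       \int[out_prob Phi x]_y
         ((score (out_prob Phi x) (tangent_map D x) y ^+ 4)%R)%:E < +oo)
    (regular : forall x : X,
       finite_discrete Y \/
       score_density_condition (out_prob Phi x) (tangent_map D x)) :
  (G X Y Phi D)%:E = G_min Phi D.
Proof.
have [M sd] := local_data_score_data finX PhiD score_moment.
have Gfin : G_min Phi D \is a fin_num.
  by rewrite ge0_fin_numE ?G_min_ge0//; case: PhiD.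
apply/eqP; rewrite eq_le; apply/andP; split.
- rewrite -(fineK Gfin) lee_fin leNgt; apply/negP => GG.
  have g0 : (0 <= fine (G_min Phi D))%R by rewrite fine_ge0// G_min_ge0.
  (* Any value strictly between the two sides can serve as [c ^+ 2]; strictness on the left leaves
     room for the noise. *)
  have [s s0 [gs sG]] : exists2 s : R, (0 < s)%R &
      (fine (G_min Phi D) < s)%R /\ (s < G X Y Phi D)%R.
    by exists ((fine (G_min Phi D) + G X Y Phi D) / 2)%R; [lra|split; lra].
  have r0 : (0 < Num.sqrt s)%R by rewrite sqrtr_gt0.
  have sE : (Num.sqrt s ^+ 2 = s)%R by rewrite sqr_sqrtr// ltW.
  have := metric_upper metricG monotone_preG monotone_postG tensor_idG
    additiveG continuousG normalizedG PhiD sd r0.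
  by rewrite sE => /(_ gs); rewrite leNgt sG.
- apply: ge_ereal_sup => _ [x _ <-].
  rewrite (fisher_score (PhiD.1 x)) (Rintegral_EFin (score2_integrable x PhiD)).
  rewrite lee_fin; exact: (metric_lower metricG monotone_preG monotone_postG
    additiveG continuousG normalizedG x PhiD sd).
Qed.
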